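(* Let $U=[a_1,b_1]\cup\dots\cup[a_k,b_k]\subseteq\mathbb{R}$ with $a_1\le b_1<a_2\le b_2<\dots<a_k\le b_k$, with natural choice of generators $N=\{x-a_1,\ (x-a_2)(x-b_1),\ \dots,\ (x-a_k)(x-b_{k-1}),\ b_k-x\}$, and let $q(x)\in\mathbb{R}[x]$ satisfy $q(x)\ge0$ on $U$. Let $S=N\cup\{y-q(x)\}\subseteq\mathbb{R}[x,y]$, so that $K_S=\{(x,y)\in\mathbb{R}^2: x\in U,\ y\ge q(x)\}$, and let $T$ be the preordering in $\mathbb{R}[x,y]$ generated by $S$. Then $T$ is saturated: every $f\in\mathbb{R}[x,y]$ with $f\ge0$ on $K_S$ lies in $T$.
   Context: For a finite set $S=\{s_1,\dots,s_m\}\subseteq\mathbb{R}[x,y]$, the preordering generated by $S$ is the set of all $\sum_{e\in\{0,1\}^m}\sigma_e s_1^{e_1}\cdots s_m^{e_m}$ with each $\sigma_e$ a sum of squares of polynomials in $\mathbb{R}[x,y]$; $K_S=\{p\in\mathbb{R}^2: s_i(p)\ge0\ \forall i\}$. The preordering is saturated if it contains every polynomial non-negative on $K_S$. *)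

(* Defs.v *)
From HB Require Import structures.
From mathcomp Require Import all_boot all_order all_algebra.
From mathcomp Require Import reals.
Set Implicit Arguments. Unset Strict Implicit. Unset Printing Implicit Defensive.
Import Order.TTheory GRing.Theory Num.Theory.
Local Open Scope ring_scope.

(* Bivariate polynomials R[x,y] represented as {poly {poly R}}:
   the outer variable is y, the inner variable (coefficients) is x. *)
Notation bipoly R := {poly {poly R}}.

Definition varx (R : ringType) : bipoly R := ('X)%:P.
Definition vary (R : ringType) : bipoly R := 'X.
Definition cst (R : ringType) (c : R) : bipoly R := c%:P%:P.

Definition ev2 (R : comRingType) (p : bipoly R) (x y : R) : R := (p.[y%:P]).[x].

Definition is_sos (R : comRingType) (p : bipoly R) : Prop :=
  exists l : seq (bipoly R), p = \sum_(g <- l) g ^+ 2.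

(* the preordering generated by the finite family S = [:: s_1; ...; s_m]:
   sums over e in {0,1}^m (encoded as subsets E of 'I_m) of
   sigma_E * prod_{i in E} s_i, each sigma_E a sum of squares *)
Definition in_preordering (R : comRingType) (S : seq (bipoly R)) (f : bipoly R) : Prop :=
  exists sigma : {set 'I_(size S)} -> bipoly R,
    (forall E, is_sos (sigma E)) /\
    f = \sum_(E : {set 'I_(size S)}) sigma E * \prod_(i in E) S`_i.

Definition in_KS (R : realDomainType) (S : seq (bipoly R)) (x y : R) : Prop :=
  forall s, s \in S -> 0 <= ev2 s x y.

Definition in_U (R : realDomainType) (k : nat) (a b : nat -> R) (x : R) : Prop :=
  exists2 i, (i < k)%N & a i <= x <= b i.

Definition natgens (R : ringType) (k : nat) (a b : nat -> R) : seq (bipoly R) :=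
  [:: varx R - cst (a 0%N)] ++
  [seq (varx R - cst (a i.+1)) * (varx R - cst (b i)) | i <- iota 0 k.-1] ++
  [:: cst (b k.-1) - varx R].

(* Main.v *)
(* After the substitution y -> y + q(x) we may take q = 0, so that f >= 0 on
   U x [0, oo). A univariate polynomial positive on U lies in T: pair its roots
   within the gaps of U. For general f induct on the degree in y. By Gauss's lemma
   a square factor P^2 can be split off with P nonzero on every vertical line, and a
   factor y is harmless. A squarefree f with f(x, 0) <> 0 satisfies
   f >= e w(x)^2 (1 + y + ... + y^D) on U x [0, oo) for some w <> 0 and e > 0.
   Such an f is treated by induction on deg w.
   If w has no zero in U, then f is a Bernstein sum in x of univariate polynomials
   in y that are nonnegative on the half-line, plus a small correction with
   coefficients positive on U. If w(x0) = 0 for some x0 in U, it suffices to find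
   an element of T with the same jet as f at x0. On an interval [c, d] of U around
   x0 the polynomial f(x, z^2) is nonnegative at every ordering of R(x, z) for which
   (x - c)(d - x) >= 0 (positivity transfers to infinitesimally near points by
   toric substitutions, as in the Newton-Puiseux algorithm); hence some h(x, z)^2
   times it is s0 + (x - c)(d - x) s1 with sums of squares s0, s1, and the
   Cassels-Pfister argument makes h independent of z. Cancelling powers of x - x0
   makes h invertible modulo (x - x0)^M, which yields the jet. *)

Require Import Defs.
From HB Require Import structures.
From mathcomp Require Import all_boot all_order all_algebra.
From mathcomp Require Import reals.
From mathcomp Require Import classical_sets boolp.
From mathcomp Require Import ring lra zify.
From mathcomp Require Import polyrcf polyorder complex.
Set Implicit Arguments. Unset Strict Implicit. Unset Printing Implicit Defensive.
Import Order.TTheory GRing.Theory Num.Theory.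
Local Open Scope ring_scope.

(** * Transfer of positivity to ordered extensions of the reals *)

(** The set on which [f] is nonnegative is unbounded, so strict positivity alone is too weak: it may
    degenerate as y grows. The bound e w(x)^2 (1 + y + ... + y^D) is the invariant that replaces it.
    Its term 1 controls finite y, its term y^D controls y at infinity, and w confines all
    degeneration to finitely many vertical lines. On such a line only a power of x - x0 has to be
    matched, which is why the denominator h must be freed from z. The same bound drives the transfer
    step: near a point it reads g(a, b) >= e a^N, and with N in the induction measure the toric
    descent stops, so that no root in an extension of the ordered field is needed. A jet of [f]
    agrees with [f] only near x0. It is therefore multiplied by a square that peaks at x0, and
    matching one order beyond twice the multiplicity leaves an error that is small against the
    bound. Isolated points of U carry no interval; their jets come from the generators, which supply
    multiples of x - x0 of both signs. *)

Section Evaluation.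
Variables (R A : comNzRingType) (iota : {rmorphism R -> A}).

Definition ev1 (a : A) : {poly R} -> A :=
  horner_morph (fun x => mulrC a (iota x)).
HB.instance Definition _ a := GRing.RMorphism.on (ev1 a).

(** One evaluation map serves three targets: the reals themselves ([ev2E]), an ordered field over
    them, and the polynomial ring, where it is substitution. *)
Definition ev (a b : A) : {poly {poly R}} -> A :=
  horner_morph (fun p => mulrC b (ev1 a p)).
HB.instance Definition _ a b := GRing.RMorphism.on (ev a b).

Lemma ev1C a c : ev1 a c%:P = iota c. Proof. exact: horner_morphC. Qed.
Lemma ev1X a : ev1 a 'X = a. Proof. exact: horner_morphX. Qed.
Lemma evC a b p : ev a b p%:P = ev1 a p. Proof. exact: horner_morphC. Qed.
Lemma evY a b : ev a b 'X = b. Proof. exact: horner_morphX. Qed.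
Lemma evcst a b c : ev a b (cst c) = iota c. Proof. by rewrite evC ev1C. Qed.
Lemma evX a b : ev a b (varx R) = a. Proof. by rewrite evC ev1X. Qed.

Lemma evN a b p : ev a b (- p) = - ev a b p. Proof. exact: raddfN. Qed.
Lemma evD a b p q : ev a b (p + q) = ev a b p + ev a b q.
Proof. exact: raddfD. Qed.
Lemma evB a b p q : ev a b (p - q) = ev a b p - ev a b q.
Proof. exact: raddfB. Qed.
Lemma evM a b p q : ev a b (p * q) = ev a b p * ev a b q.
Proof. exact: rmorphM. Qed.
Lemma evXn a b p n : ev a b (p ^+ n) = ev a b p ^+ n.
Proof. exact: rmorphXn. Qed.
Lemma ev_sum a b (I : Type) (r : seq I) (P : pred I) F :
  ev a b (\sum_(i <- r | P i) F i) = \sum_(i <- r | P i) ev a b (F i).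
Proof. exact: raddf_sum. Qed.

Lemma ev_comp a b p q : ev a b (p \Po q) = ev a (ev a b q) p.
Proof.
by rewrite /ev /horner_morph /= map_comp_poly horner_comp.
Qed.

End Evaluation.

Section Support.
Variable R : comNzRingType.
Implicit Type g : {poly {poly R}}.

(** A pair [m] stands for x^[m.1] y^[m.2]: the x-exponent comes first, although y is the outer
    variable. *)
Definition supp g : seq (nat * nat) :=
  [seq m <- [seq (i, j) | i <- iota 0 (\max_(j < size g) size (g`_j)%R),
                          j <- iota 0 (size g)] | g`_m.2`_m.1 != 0].

Lemma mem_supp g i j : ((i, j) \in supp g) = (g`_j`_i != 0).
Proof.
rewrite mem_filter /=; case: eqVneq => //= nz; apply/allpairsP; exists (i, j).
have sj : (j < size g)%N.
  by rewrite ltnNge; apply: contra nz => h; rewrite (nth_default _ h) coef0.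
rewrite !mem_iota /= !add0n sj; split => //.
have -> : (i < \max_(j < size g) size (g`_j)%R)%N => //.
apply: leq_trans (leq_bigmax (Ordinal sj)) => /=.
by rewrite ltnNge; apply: contra nz => h; rewrite (nth_default _ h).
Qed.

Lemma supp_uniq g : uniq (supp g).
Proof.
apply/filter_uniq/allpairs_uniq; rewrite ?iota_uniq //.
by case=> a b [c d] _ _ /= [-> ->].
Qed.

Lemma supp_sum g :
  g = \sum_(m <- supp g) cst g`_m.2`_m.1 * varx R ^+ m.1 * 'X^(m.2).
Proof.
have iotaE n : iota 0 n = index_iota 0 n by rewrite /index_iota subn0.
rewrite big_filter big_mkcond big_allpairs_dep /= -[LHS]coefK poly_def.
rewrite exchange_big /= iotaE big_mkord; apply: eq_bigr => j _.
have : (size (g`_j)%R <= \max_(j < size g) size (g`_j)%R)%N by apply: leq_bigmax.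
move: (\max_(_ < _) _)%N => M le.
rewrite -mul_polyC -[g`_j in LHS]coefK poly_def rmorph_sum mulr_suml /=.
rewrite iotaE (big_cat_nat _ le) //=.
rewrite [X in _ = _ + X]big1_seq ?addr0; last first.
  move=> i /=; rewrite mem_index_iota => /andP[h _].
  by rewrite (nth_default _ h) eqxx.
rewrite big_mkord; apply: eq_bigr => i _.
case: eqP => [->|_] /=; first by rewrite scale0r polyC0 mul0r.
by rewrite -mul_polyC polyCM /cst /varx rmorphXn.
Qed.

End Support.

Lemma ev_supp (R A : comNzRingType) (iota : {rmorphism R -> A}) a b
    (g : {poly {poly R}}) :
  ev iota a b g = \sum_(m <- supp g) iota g`_m.2`_m.1 * a ^+ m.1 * b ^+ m.2.
Proof.
rewrite [in LHS](supp_sum g) rmorph_sum; apply: eq_bigr => m _.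
by rewrite !rmorphM !rmorphXn /= evcst evX evY.
Qed.

Lemma ev2E (R : comNzRingType) (g : {poly {poly R}}) (x y : R) :
  ev2 g x y = ev idfun x y g.
Proof.
rewrite /ev2 ev_supp {1}(supp_sum g) horner_sum horner_sum.
apply: eq_bigr => m _; rewrite /cst /varx -rmorphXn /= -polyCM.
by rewrite hornerM hornerC hornerXn -rmorphXn !hornerE.
Qed.

Section PolyNearZero.
Variable R : realType.
Implicit Type p : {poly R}.

Lemma poly_near0 p e : 0 < e ->
  exists2 d, 0 < d & forall s, `|s| < d -> `|p.[s] - p.[0]| < e.
Proof.
move=> e0.
have /factor_theorem[q] : root (p - p.[0]%:P) 0 by rewrite rootE !hornerE subrr.
rewrite subr0 => pq; have [C hC] := poly_disk_bound q 1.
have C0 : 0 <= C by apply: le_trans (hC 0 _); rewrite ?normr0.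
exists (Num.min 1 (e / (C + 1))).
  by rewrite lt_min ltr01 divr_gt0 // ltr_wpDl.
move=> s; rewrite lt_min => /andP[s1 s2].
have -> : p.[s] - p.[0] = q.[s] * s.
  by rewrite -[p.[0]](hornerC _ s) -hornerN -hornerD pq !hornerE.
rewrite normrM; rewrite ltr_pdivlMr in s2; last by rewrite ltr_wpDl.
apply: le_lt_trans s2; rewrite mulrC ler_wpM2l //.
by apply: le_trans (hC _ (ltW s1)) _; rewrite lerDl.
Qed.

Lemma poly_lim0 p d e : 0 < d -> (forall s, 0 < s < d -> e <= p.[s]) ->
  e <= p.[0].
Proof.
move=> d0 h; rewrite leNgt; apply/negP => lt.
have e0 : 0 < e - p.[0] by rewrite subr_gt0.
have [d' d'0 h'] := poly_near0 p e0.
pose s := Num.min d d' / 2.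
have m0 : 0 < Num.min d d' by rewrite lt_min d0.
have s0 : 0 < s by rewrite /s; lra.
have sm : s < Num.min d d' by rewrite /s; lra.
move: sm; rewrite lt_min => /andP[sd sd'].
have := h s; rewrite s0 sd => /(_ isT).
have := h' s; rewrite gtr0_norm // => /(_ sd').
have := ler_norm (p.[s] - p.[0]); lra.
Qed.

End PolyNearZero.

(** * Infinitesimal, finite and appreciable elements of an ordered extension *)

Section Infinitesimal.
Variables (R : realType) (L : realFieldType) (iota : {rmorphism R -> L}).
Implicit Types (u v : L) (r : R).

(** Nonnegative reals are squares, so every ring morphism into an ordered field preserves the
    order. *)
Lemma iota_ge0 r : 0 <= r -> 0 <= iota r.
Proof. by move=> /sqr_sqrtr <-; rewrite rmorphXn /= sqr_ge0. Qed.

Lemma iota_le r s : (iota r <= iota s) = (r <= s).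
Proof.
apply/idP/idP => [|rs]; last by rewrite -subr_ge0 -rmorphB iota_ge0 ?subr_ge0.
rewrite [r <= s]leNgt; apply: contraL => sr; rewrite -ltNge lt_neqAle.
rewrite (inj_eq (fmorph_inj iota)) lt_eqF //=.
by rewrite -subr_ge0 -rmorphB iota_ge0 ?subr_ge0 ?ltW.
Qed.

Lemma iota_lt r s : (iota r < iota s) = (r < s).
Proof. by rewrite !ltNge iota_le. Qed.

Lemma iota_gt0 r : (0 < iota r) = (0 < r).
Proof. by rewrite -(rmorph0 iota) iota_lt. Qed.

Definition infml u := forall r, 0 < r -> `|u| < iota r.
Definition finite u := exists r, `|u| <= iota r.
(** Positive, finite and not infinitesimal. A single [r] gives both bounds, which makes the notion
    visibly stable under inversion. *)
Definition appr u := exists2 r, 0 < r & iota r <= u <= iota r^-1.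

Lemma finiteP u : finite u -> exists2 r, 0 < r & `|u| <= iota r.
Proof.
move=> [r ur]; exists (`|r| + 1); first by rewrite ltr_wpDl.
by apply: le_trans ur _; rewrite iota_le (le_trans (ler_norm r)) // lerDl.
Qed.

Lemma finite_iota r : finite (iota r).
Proof.
exists `|r|; rewrite ler_norml -rmorphN !iota_le ler_norm andbT.
by rewrite lerNl -normrN ler_norm.
Qed.

Lemma finiteD u v : finite u -> finite v -> finite (u + v).
Proof.
move=> [r ur] [s vs]; exists (r + s); rewrite rmorphD /=.
by apply: le_trans (ler_normD _ _) _; apply: lerD.
Qed.

Lemma finiteM u v : finite u -> finite v -> finite (u * v).
Proof.
move=> [r ur] [s vs]; exists (r * s); rewrite rmorphM /= normrM.
by apply: ler_pM.
Qed.

Lemma finiteX u n : finite u -> finite (u ^+ n).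
Proof.
move=> fu; elim: n => [|n IH]; last by rewrite exprS; apply: finiteM.
by rewrite expr0 -(rmorph1 iota); apply: finite_iota.
Qed.

Lemma finite_sum (I : Type) (r : seq I) (F : I -> L) :
  (forall i, finite (F i)) -> finite (\sum_(i <- r) F i).
Proof.
move=> h; elim/big_ind: _ => //; last by move=> *; apply: finiteD.
by rewrite -(rmorph0 iota); apply: finite_iota.
Qed.

Lemma infml_finite u : infml u -> finite u.
Proof. by move=> h; exists 1; apply/ltW/h. Qed.

Lemma infml0 : infml 0.
Proof. by move=> r r0; rewrite normr0 iota_gt0. Qed.

Lemma infmlN u : infml u -> infml (- u).
Proof. by move=> h r r0; rewrite normrN h. Qed.

Lemma infmlD u v : infml u -> infml v -> infml (u + v).
Proof.
move=> hu hv r r0; apply: le_lt_trans (ler_normD _ _) _.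
have r2 : 0 < r / 2 by lra.
by rewrite [r](_ : _ = r / 2 + r / 2) ?rmorphD ?ltrD ?hu ?hv //; lra.
Qed.

Lemma infmlM u v : infml u -> finite v -> infml (u * v).
Proof.
move=> hu /finiteP[s s0 hv] r r0; rewrite normrM.
have := hu (r / s); rewrite divr_gt0 // => /(_ isT) hu'.
have -> : iota r = iota (r / s) * iota s by rewrite -rmorphM divfK ?gt_eqF.
have [->|v0] := eqVneq `|v| 0.
  by rewrite mulr0 -rmorphM iota_gt0 mulr_gt0 ?divr_gt0.
apply: lt_le_trans (_ : iota (r / s) * `|v| <= _).
  by rewrite ltr_pM2r // lt_def v0 normr_ge0.
by apply: ler_wpM2l => //; apply/iota_ge0/ltW/divr_gt0.
Qed.

Lemma infmlX u n : infml u -> (0 < n)%N -> infml (u ^+ n).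
Proof.
case: n => // n hu _; rewrite exprS; apply: infmlM => //.
exact/finiteX/infml_finite.
Qed.

Lemma infml_sum (I : eqType) (r : seq I) (P : pred I) (F : I -> L) :
  (forall i, i \in r -> P i -> infml (F i)) -> infml (\sum_(i <- r | P i) F i).
Proof.
move=> h; rewrite big_seq_cond; elim/big_ind: _ => //.
- exact: infml0.
- by move=> *; apply: infmlD.
by move=> i /andP[]; apply: h.
Qed.

Lemma infml_lt1 u : infml u -> `|u| < 1.
Proof. by move=> /(_ 1 ltr01); rewrite rmorph1. Qed.

Lemma near_gt0 r u : infml (u - iota r) -> 0 < r -> 0 < u.
Proof.
move=> h r0; have := h _ r0; have := ler_norm (- (u - iota r)).
rewrite normrN; lra.
Qed.

Lemma appr_neq_infml u : 0 < u -> u <= 1 -> ~ infml u -> appr u.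
Proof.
move=> u0 u1 /existsNP[r /not_implyP[r0 /negP]].
rewrite -leNgt gtr0_norm // => ru; exists r => //; rewrite ru /=.
apply: (le_trans u1); rewrite -(rmorph1 iota) iota_le invf_ge1 //.
by rewrite -iota_le rmorph1; apply: le_trans ru u1.
Qed.

Lemma apprV u : appr u -> appr u^-1.
Proof.
move=> [r r0 /andP[ru ur]]; exists r => //.
have u0 : 0 < u by apply: lt_le_trans ru; rewrite iota_gt0.
rewrite fmorphV in ur *; apply/andP; split; last first.
  by rewrite lef_pV2 ?posrE ?iota_gt0.
by rewrite -[iota r]invrK lef_pV2 ?posrE ?invr_gt0 ?iota_gt0.
Qed.

Lemma appr_finite u : appr u -> finite u.
Proof.
move=> [r r0 /andP[ru ur]]; exists r^-1; rewrite gtr0_norm //.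
by apply: lt_le_trans ru; rewrite iota_gt0.
Qed.

Lemma appr_not_infml u : appr u -> ~ infml u.
Proof.
move=> [r r0 /andP[ru _]] /(_ r r0); apply/negP; rewrite -leNgt.
by apply: le_trans ru _; apply: ler_norm.
Qed.

Lemma appr_root u n : 0 < u -> (0 < n)%N -> appr (u ^+ n) -> appr u.
Proof.
move=> u0 n0 [r r0 /andP[ru ur]]; exists r => //.
have r1 : r <= 1.
  have := le_trans ru ur; rewrite iota_le => h.
  by rewrite leNgt; apply/negP => r1; have := r1; rewrite -invf_lt1 //; lra.
have [u1|u1] := leP u 1.
  apply/andP; split.
    by apply: le_trans ru _; apply: ler_iXnr => //; apply: ltW.
  by apply: le_trans u1 _; rewrite -(rmorph1 iota) iota_le invf_ge1.
apply/andP; split; first by apply: le_trans (ltW u1); rewrite -(rmorph1 iota) iota_le.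
by apply: le_trans ur; apply: ler_eXnr => //; apply: ltW.
Qed.

(** The standard part is the supremum of the reals below [u]; completeness of [R] is what provides
    it. *)
Lemma standard_part u : finite u -> exists c, infml (u - iota c).
Proof.
move=> [B uB].
pose E := [set r | iota r <= u]%classic.
have hs : has_sup E.
  split.
    exists (- B); rewrite /E /= rmorphN /=; move: uB; rewrite ler_norml.
    by case/andP.
  exists B => r; rewrite /E /= => ru; rewrite -iota_le.
  by apply: le_trans ru (le_trans (ler_norm u) uB).
exists (sup E) => r r0; rewrite ltr_norml; apply/andP; split.
  have /(_ r r0)[s Es] := sup_adherent _ hs.
  rewrite -(iota_lt _ s) rmorphB /=; move: Es; rewrite /E /=; lra.
rewrite ltNge; apply/negP => h.
have : E (sup E + r / 2).
  rewrite /E /= rmorphD /=.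
  have : iota (r / 2) < iota r by rewrite iota_lt; lra.
  lra.
by move=> /(sup_upper_bound hs); lra.
Qed.

Lemma ev1_finite a p : finite a -> finite (ev1 iota a p).
Proof.
move=> fa; elim/poly_ind: p => [|p c IH].
  by rewrite rmorph0 -(rmorph0 iota); apply: finite_iota.
rewrite rmorphD rmorphM /= ev1C ev1X.
by apply: finiteD; [apply: finiteM|apply: finite_iota].
Qed.

Lemma ev1_infml t p : infml t -> infml (ev1 iota t p - iota p.[0]).
Proof.
move=> it; have /factor_theorem[q] : root (p - p.[0]%:P) 0.
  by rewrite rootE !hornerE subrr.
rewrite subr0 => pq; rewrite -(ev1C iota t) -rmorphB pq rmorphM /= ev1X mulrC.
exact/infmlM/ev1_finite/infml_finite.
Qed.

(** Split off the power of ['X] dividing [p]. The cofactor is positive at 0, and its value at [t] is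
    infinitely close to that. *)
Lemma ev1_gt0 t p d : 0 < t -> infml t -> 0 < d ->
  (forall s, 0 < s < d -> 0 < p.[s]) -> 0 < ev1 iota t p.
Proof.
move=> t0 it d0 h.
have pn0 : p != 0.
  apply/eqP => p0; have /h : 0 < d / 2 < d by lra.
  by rewrite p0 horner0 ltxx.
have [m [q]] := multiplicity_XsubC p 0.
rewrite pn0 /= subr0 => q0 pE.
have q0p : 0 < q.[0].
  rewrite lt_def; move: q0; rewrite rootE => -> /=.
  apply: (@poly_lim0 _ _ d) => // s /andP[s0 sd].
  have := h s; rewrite s0 sd => /(_ isT).
  by rewrite pE !hornerE pmulr_lgt0 ?exprn_gt0 // => /ltW.
rewrite pE rmorphM rmorphXn /= ev1X mulr_gt0 ?exprn_gt0 //.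
by apply: near_gt0 q0p; apply: ev1_infml.
Qed.

End Infinitesimal.

Lemma cut_above (F : realFieldType) (a : F) (B : seq F) :
  (forall b, b \in B -> a < b) ->
  exists2 k, a < k & forall b, b \in B -> k < b.
Proof.
elim: B => [_|b B IH h]; first by exists (a + 1) => //; rewrite ltrDl.
have [|k ak kB] := IH; first by move=> x xB; apply: h; rewrite inE xB orbT.
have ab : a < b by apply: h; rewrite mem_head.
exists (Num.min k ((a + b) / 2)) => [|x]; first by rewrite lt_min ak; lra.
rewrite inE => /orP[/eqP->|/kB kx]; rewrite gt_min ?kx //.
by apply/orP; right; lra.
Qed.

(** Elimination of one unknown from finitely many strict inequalities; over the rationals it yields
    the exponents of the curve in [slope]. *)
Lemma cut_between (F : realFieldType) (A B : seq F) :
  (forall a b, a \in A -> b \in B -> a < b) ->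
  exists k, (forall a, a \in A -> a < k) /\ (forall b, b \in B -> k < b).
Proof.
elim: A => [_|a A IH h].
  have [k0 hk0] : exists k0, forall b, b \in B -> k0 < b.
    elim: B => [|b B [k0 hk]]; first by exists 0.
    exists (Num.min k0 (b - 1)) => x; rewrite inE gt_min.
    by move=> /orP[/eqP->|/hk ->//]; apply/orP; right; lra.
  by exists k0.
have [|k [Ak kB]] := IH; first by move=> x y xA; apply: h; rewrite inE xA orbT.
have [ak|ka] := ltP a k.
  by exists k; split=> // x; rewrite inE => /orP[/eqP->|/Ak].
have [b bB|k' ak' kB'] := @cut_above _ a B; first by apply: h; rewrite ?mem_head.
exists k'; split=> // x; rewrite inE => /orP[/eqP->//|/Ak xk].
exact: lt_trans xk (le_lt_trans ka ak').
Qed.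

Lemma seq_argmax (F : realFieldType) (T : eqType) (f : T -> F) (s : seq T) :
  s != [::] -> exists2 x, x \in s & forall y, y \in s -> f y <= f x.
Proof.
elim: s => // a [|b s] IH _.
  by exists a; rewrite ?mem_head // => y; rewrite inE => /eqP->.
have [//|x xs h] := IH.
have [fxa|fax] := leP (f x) (f a).
  exists a; rewrite ?mem_head // => y; rewrite inE => /orP[/eqP->//|/h].
  by move=> /le_trans; apply.
exists x; first by rewrite inE xs orbT.
by move=> y; rewrite inE => /orP[/eqP->|/h //]; apply: ltW.
Qed.

(** * Points at which one monomial dominates *)

Section Dominant.
Variables (R : realType) (L : realFieldType) (iota : {rmorphism R -> L}).
Variables (t z : L) (t0 : 0 < t) (z0 : 0 < z).
Hypotheses (it : infml iota t) (iz : infml iota z).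

Lemma infml_exprz (k : int) : infml iota (t ^ k) -> 0 < k.
Proof.
move=> h; rewrite ltNge; apply/negP => k0.
have kE : k = - `|k|%N%:Z by lia.
have := infml_lt1 h; rewrite kE -exprnN gtr0_norm ?invr_gt0 ?exprn_gt0 //.
rewrite invf_lt1 ?exprn_gt0 // ltNge; apply/negP; rewrite negbK.
apply: exprn_ile1; first exact: ltW.
by apply: le_trans (ler_norm t) (ltW (infml_lt1 it)).
Qed.

Let mon (m : nat * nat) := t ^+ m.1 * z ^+ m.2.

Hypothesis nocmp : forall p q, (0 < p)%N -> (0 < q)%N ->
  ~ appr iota (z ^+ q / t ^+ p).

Lemma mon_gt0 m : 0 < mon m. Proof. by rewrite mulr_gt0 ?exprn_gt0. Qed.

Lemma mon_ratio m m' : mon m / mon m' =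
  t ^ (m.1%:Z - m'.1%:Z) * z ^ (m.2%:Z - m'.2%:Z).
Proof.
rewrite /mon !expfzDr ?gt_eqF // -!exprnN -!exprnP invfM; ring.
Qed.

(** If the exponent differences have the same sign, the ratio or its inverse is infinitesimal;
    opposite signs are the case excluded by [nocmp]. *)
Lemma not_appr_mon m m' : m != m' -> ~ appr iota (mon m / mon m').
Proof.
wlog le : m m' / (m'.2 <= m.2)%N.
  move=> W; have [|le] := leqP m'.2 m.2; first exact: W.
  rewrite eq_sym => ne ha; apply: (W m' m (ltnW le) ne).
  by rewrite -[_ / _]invrK invf_div; apply: apprV.
rewrite mon_ratio; move: m m' le => [i j] [i' j'] /= le ne.
have [jj|jj] := eqVneq j j'.
  subst j'; rewrite subrr expr0z mulr1 => ha.
  have [d|d|d] := ltngtP i i'; last by rewrite d eqxx in ne.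
    apply: (@appr_not_infml _ _ iota (t ^+ (i' - i))).
      rewrite -[_ ^+ _]invrK; apply: apprV.
      by rewrite exprnN (_ : - _ = i%:Z - i'%:Z) //; lia.
    by apply: infmlX => //; lia.
  apply: (@appr_not_infml _ _ iota (t ^+ (i - i'))); last first.
    by apply: infmlX => //; lia.
  by rewrite exprnP (_ : Posz _ = i%:Z - i'%:Z) //; lia.
have jE : j%:Z - j'%:Z = (j - j')%N%:Z by lia.
have jp : (0 < j - j')%N by lia.
rewrite jE; have [d|d] := ltnP i i'; last first.
  have -> : i%:Z - i'%:Z = (i - i')%N%:Z by lia.
  move=> /appr_not_infml; apply; rewrite mulrC; apply: infmlM; first exact: infmlX.
  exact/finiteX/infml_finite.
have -> : i%:Z - i'%:Z = - (i' - i)%N%:Z by lia.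
rewrite -exprnN mulrC; apply: nocmp => //; lia.
Qed.

(* The real curve [s |-> (s^q, s^p)] has the same dominant monomial as [(t, z)]. *)
Lemma slope (S : seq (nat * nat)) (m0 : nat * nat) :
  (forall m, m \in S -> m != m0 -> infml iota (mon m / mon m0)) ->
  exists p q, [/\ (0 < p)%N, (0 < q)%N & forall m, m \in S -> m != m0 ->
    (q * m0.1 + p * m0.2 < q * m.1 + p * m.2)%N].
Proof.
move=> h.
pose al (m : nat * nat) : rat := (m.1%:R - m0.1%:R).
pose be (m : nat * nat) : rat := (m.2%:R - m0.2%:R).
(* The slope k = p / q must satisfy [al m + k * be m > 0] for every other monomial [m]. [A] collects
   the resulting lower bounds and [B] the upper bounds; the entry 0 forces k > 0. *)
pose A := 0 :: [seq - al m / be m | m <- S & (m0.2 < m.2)%N].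
pose B := [seq al m / - be m | m <- S & (m.2 < m0.2)%N].
(* Otherwise both exponents of [m] are at most those of [m0], and [mon m] is not smaller than
   [mon m0]. *)
have aux m : m \in S -> (m.2 < m0.2)%N -> (m0.1 < m.1)%N.
  move=> mS lt; rewrite ltnNge; apply/negP => le.
  have ne : m != m0 by apply: contraTneq lt => ->; rewrite ltnn.
  have := infml_lt1 (h m mS ne); rewrite gtr0_norm ?divr_gt0 ?mon_gt0 //.
  rewrite ltr_pdivrMr ?mon_gt0 // mul1r ltNge => /negP; apply.
  have le1 u : infml iota u -> u <= 1.
    by move=> /infml_lt1 iu; apply: le_trans (ler_norm u) (ltW iu).
  rewrite /mon; apply: ler_pM.
  - exact/exprn_ge0/ltW.
  - exact/exprn_ge0/ltW.
  - by apply: ler_wiXn2l => //; [apply: ltW|apply: le1].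
  - by apply: ler_wiXn2l; [apply: ltW|apply: le1|apply: ltnW].
have [a b|k [Ak kB]] := @cut_between _ A B.
  rewrite inE => /orP[/eqP->|/mapP[m1]].
    move=> /mapP[m]; rewrite mem_filter => /andP[lt mS] ->.
    rewrite divr_gt0 // ?oppr_gt0 ?subr_gt0 ?subr_lt0 ltr_nat //; exact: aux.
  rewrite mem_filter => /andP[lt1 m1S] -> /mapP[m2].
  rewrite mem_filter => /andP[lt2 m2S] ->.
  have ne1 : m1 != m0 by apply: contraTneq lt1 => ->; rewrite ltnn.
  have ne2 : m2 != m0 by apply: contraTneq lt2 => ->; rewrite ltnn.
  have i1 := h _ m1S ne1; have i2 := h _ m2S ne2.
  rewrite ltr_pdivlMr ?oppr_gt0 ?subr_lt0 ?ltr_nat //.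
  rewrite mulrAC ltr_pdivrMr ?subr_gt0 ?ltr_nat //.
  (* These powers of the two ratios cancel [z]. What remains is an infinitesimal power of [t], so
     its exponent is positive, which is the inequality between the two bounds. *)
  have : infml iota ((mon m1 / mon m0) ^+ (m0.2 - m2.2) *
                     (mon m2 / mon m0) ^+ (m1.2 - m0.2)).
    apply: infmlM; first by apply: infmlX => //; rewrite subn_gt0.
    exact/finiteX/infml_finite.
  have -> : (mon m1 / mon m0) ^+ (m0.2 - m2.2) *
            (mon m2 / mon m0) ^+ (m1.2 - m0.2) =
     t ^ ((m1.1%:Z - m0.1%:Z) * (m0.2 - m2.2)%N%:Z +
          (m2.1%:Z - m0.1%:Z) * (m1.2 - m0.2)%N%:Z).
    rewrite !mon_ratio !exprMn !exprnP !exprz_exp mulrACA.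
    rewrite -!expfzDr ?gt_eqF // [X in _ * z ^ X](_ : _ = 0); last first.
      rewrite -(subzn (ltnW lt1)) -(subzn (ltnW lt2)).
      by move: (_%:Z) (_%:Z) (_%:Z) => ? ? ?; ring.
    by rewrite expr0z mulr1.
  move=> /infml_exprz; rewrite /al /be -(ltr_int rat).
  rewrite intrD !intrM !intrB -!pmulrn.
  rewrite natrB 1?ltnW // natrB 1?ltnW //.
  move: (m0.1%:R) (m1.1%:R) (m2.1%:R) (m0.2%:R) (m1.2%:R) (m2.2%:R) => *.
  lra.
have k0 : 0 < k by apply: Ak; rewrite mem_head.
have kE : k = (`|numq k|%N)%:R / (`|denq k|%N)%:R.
  rewrite -[LHS]divq_num_den -[numq k]gez0_abs ?numq_ge0 ?ltW //.
  by rewrite -[X in _ / X%:~R]gez0_abs ?denq_ge0.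
have q0 : (0 < `|denq k|)%N by rewrite absz_gt0 denq_neq0.
exists `|numq k|%N, `|denq k|%N; split => //.
  by rewrite absz_gt0 numq_eq0 gt_eqF.
move: kE q0; set p := `|numq k|%N; set q := `|denq k|%N => kE q0 m mS ne.
have q0' : 0 < q%:R :> rat by rewrite ltr0n.
have pE : p%:R = k * q%:R by rewrite kE divfK // gt_eqF.
rewrite -(ltr_nat rat) !natrD !natrM pE.
suff : 0 < al m + k * be m.
  by move=> /(mulr_gt0 q0'); rewrite /al /be; lra.
have [lt|lt|e2] := ltngtP m.2 m0.2.
- have : k < al m / - be m by apply: kB; apply: map_f; rewrite mem_filter lt.
  by rewrite ltr_pdivlMr ?oppr_gt0 ?subr_lt0 ?ltr_nat //; lra.
- have : - al m / be m < k.
    apply: Ak; rewrite inE; apply/orP; right; apply/mapP; exists m => //.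
    by rewrite mem_filter lt.
  by rewrite ltr_pdivrMr ?subr_gt0 ?ltr_nat //; lra.
have := h _ mS ne; rewrite mon_ratio e2 subrr expr0z mulr1 => /infml_exprz hp.
by rewrite /be e2 subrr mulr0 addr0 /al subr_gt0 ltr_nat; lia.
Qed.

(** All other monomials are infinitesimal relative to the largest one, so its coefficient decides
    the sign. That coefficient is nonzero, and it is a limit of nonnegative values along the curve
    from [slope]. *)
Lemma dominant_gt0 g (d : R) : 0 < d -> supp g != [::] ->
  (forall a b : R, 0 < a < d -> `|b| < d -> 0 <= ev2 g a b) ->
  0 < ev iota t z g.
Proof.
move=> d0 /(seq_argmax mon)[m0 m0S max] pos.
have inf m : m \in supp g -> m != m0 -> infml iota (mon m / mon m0).
  move=> mS /not_appr_mon na; apply: contrapT => ni; apply: na.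
  apply: appr_neq_infml ni; first by rewrite divr_gt0 ?mon_gt0.
  by rewrite ler_pdivrMr ?mon_gt0 // mul1r max.
pose a m := g`_m.2`_m.1.
have [p [q [p0 q0 wt]]] := slope inf.
have a0 : 0 < a m0.
  rewrite lt_def; move: (m0S); rewrite {1}(surjective_pairing m0) mem_supp => -> /=.
  pose w (m : nat * nat) := (q * m.1 + p * m.2)%N.
  (* [H] is [g] along the curve (s^q, s^p) divided by the lowest power of s; its constant term is
     the coefficient sought. *)
  pose H := \sum_(m <- supp g) (a m)%:P * 'X^(w m - w m0).
  have HE s : ev2 g (s ^+ q) (s ^+ p) = s ^+ w m0 * H.[s].
    rewrite ev2E ev_supp horner_sum mulr_sumr; apply: eq_big_seq => m mS.
    rewrite !hornerE /= -/(a m) -!exprM -mulrA -exprD -/(w m).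
    rewrite mulrAC -exprD mulrC; congr (_ ^+ _ * _).
    have [->|ne] := eqVneq m m0; first by rewrite subnn addn0.
    by rewrite subnKC // ltnW // wt.
  have -> : a m0 = H.[0].
    rewrite horner_sum (bigD1_seq m0) ?supp_uniq //= big1_seq ?addr0.
      by rewrite !hornerE subnn expr0 mulr1.
    move=> m /andP[ne mS]; rewrite !hornerE expr0n.
    by rewrite subn_eq0 leqNgt wt // mulr0.
  apply: (@poly_lim0 _ _ (Num.min 1 d)); first by rewrite lt_min ltr01.
  move=> s; rewrite lt_min => /and3P[s0 s1 sd].
  have sn n : (0 < n)%N -> 0 < s ^+ n < d.
    move=> n0; rewrite exprn_gt0 //=; apply: le_lt_trans sd.
    by apply: ler_iXnr => //; apply: ltW.
  rewrite -(pmulr_rge0 _ (exprn_gt0 (w m0) s0)) -HE; apply: pos; first exact: sn.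
  by have /andP[h1 h2] := sn p p0; rewrite gtr0_norm.
rewrite ev_supp (bigD1_seq m0) ?supp_uniq //= -mulrA -/(mon m0).
rewrite -(pmulr_lgt0 _ (_ : 0 < (mon m0)^-1)); last by rewrite invr_gt0 mon_gt0.
apply: (@near_gt0 _ _ iota (a m0) _ _ a0).
rewrite mulrDl mulfK ?gt_eqF ?mon_gt0 //.
have addKC (x y : L) : x + y - x = y by ring.
rewrite addKC mulr_suml.
apply: infml_sum => m mS ne; rewrite -(mulrA (iota _)) -mulrA mulrC.
by apply: infmlM (inf m mS ne) (finite_iota _ _).
Qed.

End Dominant.

(* Multiplicity of a nonzero root versus the spread of the exponents. *)
Lemma shifted_coef (R : idomainType) (T : eqType) (s : seq T) (a : T -> R)
    (w : T -> nat) (m0 : T) (M : nat) (c : R) :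
  uniq s -> m0 \in s -> c != 0 -> a m0 != 0 ->
  (forall m, m \in s -> w m0 <= w m <= w m0 + M)%N ->
  (forall m, m \in s -> w m = w m0 -> m = m0) ->
  exists2 i, (i <= M)%N &
    (\sum_(m <- s) (a m)%:P * ('X + c%:P) ^+ w m)`_i != 0.
Proof.
move=> us m0s c0 a0 hw inj.
pose Phi := \sum_(m <- s) (a m)%:P * 'X^(w m - w m0).
have Phi0 : Phi.[0] != 0.
  rewrite horner_sum (bigD1_seq m0) //= big1_seq ?addr0.
    by rewrite !hornerE subnn expr0 mulr1.
  move=> m /andP[ne ms]; rewrite !hornerE expr0n subn_eq0.
  case: leqP => [le|_]; rewrite ?mulr0 //; case/eqP: ne; apply: inj => //.
  by apply/eqP; rewrite eqn_leq le; case/andP: (hw m ms).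
have PhiS : (size Phi <= M.+1)%N.
  apply: leq_trans (size_sum _ _ _) _; apply/bigmax_leqP_seq => m ms _.
  apply: leq_trans (size_polyMleq _ _) _; rewrite size_polyXn.
  have := size_polyC_leq1 (a m); move: (size _) => S; have := hw m ms; lia.
(* The index is the multiplicity of [c] as a root of [Phi], hence at most its degree. After the
   shift, the coefficient there is [c ^+ w m0] times the value of the cofactor at [c]. *)
have [i [Q]] := multiplicity_XsubC Phi c.
have -> : Phi != 0 by apply: contraNneq Phi0 => ->; rewrite horner0.
move=> /= Qc PhiE; exists i.
  have Q0 : Q != 0 by apply: contraNneq Qc => ->; rewrite rootE horner0.
  move: PhiS; rewrite PhiE size_Mmonic ?monic_exp ?monicXsubC //.
  rewrite size_exp_XsubC; have : (0 < size Q)%N by rewrite size_poly_gt0.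
  move: (size Q) => S; lia.
have -> : \sum_(m <- s) (a m)%:P * ('X + c%:P) ^+ w m =
    'X^i * (('X + c%:P) ^+ w m0 * (Q \Po ('X + c%:P))).
  rewrite mulrCA [X in _ = _ * X](_ : _ = Phi \Po ('X + c%:P)); last first.
    rewrite PhiE rmorphM rmorphXn rmorphB /= comp_polyX comp_polyC addrK.
    by rewrite mulrC.
  rewrite raddf_sum mulr_sumr; apply: eq_big_seq => m ms /=.
  rewrite rmorphM rmorphXn /= comp_polyC comp_polyX mulrCA -exprD subnKC //.
  by case/andP: (hw m ms).
rewrite coefXnM ltnn subnn -horner_coef0 !hornerE horner_comp !hornerE.
by rewrite mulf_neq0 ?expf_neq0 // add0r.
Qed.

(** * Toric substitutions and descent *)

Section Toric.
Variables (R : realType) (L : realFieldType) (iota : {rmorphism R -> L}).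

(** Positivity on one side of the line a = 0 near the origin, with a quantified margin. Toric
    substitutions preserve the shape, and [N] is the second component of the induction measure. *)
Definition bounded_below (g : {poly {poly R}}) (N : nat) :=
  exists e d : R, [/\ 0 < e, 0 < d & forall a b : R, 0 < a < d -> `|b| < d ->
    e * a ^+ N <= ev2 g a b].

(* [g(X^q (Y + c)^al, X^p (Y + c)^be) / X^k] *)
Definition toric (q p al be k : nat) (c : R) (g : {poly {poly R}}) :=
  \sum_(m <- supp g) cst g`_m.2`_m.1 *
    varx R ^+ (q * m.1 + p * m.2 - k) * ('X + cst c) ^+ (al * m.1 + be * m.2).

Lemma ev_toric (A : comNzRingType) (io : {rmorphism R -> A}) q p al be k c g u v :
  (forall m, m \in supp g -> (k <= q * m.1 + p * m.2)%N) ->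
  ev io (u ^+ q * (v + io c) ^+ al) (u ^+ p * (v + io c) ^+ be) g =
  u ^+ k * ev io u v (toric q p al be k c g).
Proof.
move=> hk; rewrite ev_supp rmorph_sum mulr_sumr; apply: eq_big_seq => m ms.
rewrite !rmorphM !rmorphXn rmorphD /= !evcst evX evY.
rewrite !exprMn -!exprM exprD.
have E : u ^+ (q * m.1) * u ^+ (p * m.2) =
         u ^+ (q * m.1 + p * m.2 - k) * u ^+ k.
  by rewrite -!exprD subnK ?hk.
move: E; set U1 := u ^+ (q * m.1); set U2 := u ^+ (p * m.2).
set V1 := _ ^+ (al * m.1); set V2 := _ ^+ (be * m.2).
set U3 := u ^+ (_ - k); set U4 := u ^+ k => E.
rewrite [LHS](_ : _ = io g`_m.2`_m.1 * (U1 * U2) * V1 * V2); last by ring.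
by rewrite E; ring.
Qed.


Lemma ev2_y0 (g : {poly {poly R}}) a : ev2 g a 0 = (g`_0).[a].
Proof. by rewrite /ev2 polyC0 horner_coef0. Qed.

Lemma bounded_below_gt0 g N :
  bounded_below g N -> g`_0`_0 = 0 -> (0 < N)%N.
Proof.
move=> [e [d [e0 d0 h]]]; case: N h => // h g00.
have : e <= (g`_0).[0].
  apply: (poly_lim0 d0) => s sd; rewrite -ev2_y0 -[e]mulr1 -(expr0 s).
  by apply: h; rewrite ?normr0.
by rewrite horner_coef0 g00 leNgt e0.
Qed.

(** Near the origin [b + c] stays between [c / 2] and [3 c / 2], so its powers cost only constants,
    while small [a] keeps the substituted point inside the old domain. *)
Lemma toric_bounded (g : {poly {poly R}}) N p q al be k c :
  0 < c -> (0 < p)%N -> (0 < q)%N ->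
  (forall m, m \in supp g -> (k <= q * m.1 + p * m.2)%N) ->
  bounded_below g N -> bounded_below (toric q p al be k c g) (q * N - k).
Proof.
move=> c0 p0 q0 min [eps [d [eps0 d0 h]]].
pose C : R := c + c / 2.
have C0 : 0 < C by rewrite /C; lra.
have C1 : 0 < C ^+ al + C ^+ be + 1.
  by rewrite !addr_gt0 ?exprn_gt0.
exists (eps * ((c / 2) ^+ al) ^+ N).
exists (Num.min (Num.min 1 (c / 2)) (d / (C ^+ al + C ^+ be + 1))); split.
- by rewrite mulr_gt0 ?exprn_gt0 //; lra.
- by rewrite !lt_min ltr01 divr_gt0 // divr_gt0.
move=> a b; rewrite !lt_min => /andP[a0 /andP[/andP[a1 ac] ad]].
move=> /andP[/andP[_ bc] _].
have cb0 : c / 2 <= b + c by have := ler_norm (- b); rewrite normrN; lra.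
have cbC : b + c <= C by have := ler_norm b; rewrite /C; lra.
have cbp : 0 < b + c by lra.
rewrite ltr_pdivlMr // in ad.
have small x j : (0 < j)%N -> x < C ^+ al + C ^+ be + 1 -> 0 < x ->
    0 < a ^+ j * x < d.
  move=> j0 xC x0; rewrite mulr_gt0 ?exprn_gt0 //=; apply: lt_trans ad.
  apply: le_lt_trans (_ : a * x < _); last by rewrite ltr_pM2l.
  by apply: ler_wpM2r; [apply: ltW|apply: ler_iXnr => //; apply: ltW].
have leC j : (b + c) ^+ j <= C ^+ j.
  by apply: lerXn2r; rewrite ?nnegrE //; apply: ltW.
have [Ca Cb] : 0 < C ^+ al /\ 0 < C ^+ be by rewrite !exprn_gt0.
have sa := small ((b + c) ^+ al) q q0 _ (exprn_gt0 _ cbp).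
have sb := small ((b + c) ^+ be) p p0 _ (exprn_gt0 _ cbp).
have {}sa := sa ltac:(have := leC al; lra).
have /andP[sb1 sb2] := sb ltac:(have := leC be; lra).
have := h _ (a ^+ p * (b + c) ^+ be) sa; rewrite (gtr0_norm sb1) => /(_ sb2).
rewrite !ev2E; have /= -> := @ev_toric R idfun q p al be k c g a b min.
set G := ev _ _ _ _ => hG.
rewrite -(ler_pM2l (exprn_gt0 k a0)); apply: le_trans hG.
have -> : (a ^+ q * (b + c) ^+ al) ^+ N = a ^+ (q * N) * ((b + c) ^+ al) ^+ N.
  by rewrite exprMn (exprM a).
rewrite mulrCA -mulrA ler_pM2l // mulrC -exprD.
apply: ler_pM.
- exact/exprn_ge0/ltW.
- by rewrite !exprn_ge0 //; lra.
(* If [q * N < k] the subtraction truncates; this only raises the total exponent of [a], and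
   [a <= 1]. *)
- by apply: ler_wiXn2l; [apply: ltW|apply: ltW|rewrite -leq_subLR].
apply: lerXn2r; rewrite ?nnegrE ?exprn_ge0 ?(ltW cbp) //; try lra.
by apply: lerXn2r; rewrite ?nnegrE //; lra.
Qed.

(** Setting x = 0 leaves the edge of minimal weight in the Newton polygon. On it the Bezout relation
    gives [q * e m = al * k + m.2], and [m.2 <= n] because the monomial y^n has weight at least [k].
    So the exponents of ['X + c] are distinct and spread over at most [n %/ q]. *)
Lemma toric_coef (g : {poly {poly R}}) n p q al be c m0
    (w := fun m : nat * nat => (q * m.1 + p * m.2)%N) :
  0 < c -> (0 < p)%N -> (0 < q)%N -> (be * q = al * p + 1)%N ->
  g`_n`_0 != 0 -> m0 \in supp g ->
  (forall m, m \in supp g -> (w m0 <= w m)%N) ->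
  exists2 i, (i <= n %/ q)%N & (toric q p al be (w m0) c g)`_i`_0 != 0.
Proof.
move=> c0 p0 q0 bez gn m0S; set k := w m0 => min.
set g' := toric _ _ _ _ _ _ _.
have nS : (0, n)%N \in supp g by rewrite mem_supp.
pose s := [seq m <- supp g | w m == k].
pose e (m : nat * nat) := (al * m.1 + be * m.2)%N.
have eE m : m \in s -> (q * e m = al * k + m.2)%N.
  rewrite mem_filter /w => /andP[/eqP <- _]; rewrite /e.
  have -> : (q * (al * m.1 + be * m.2) = al * (q * m.1) + be * q * m.2)%N by ring.
  by rewrite bez; ring.
have le_n m : m \in s -> (m.2 <= n)%N.
  rewrite mem_filter => /andP[/eqP wE _]; have := min _ nS.
  rewrite -wE /w /= muln0 add0n => h; rewrite -(leq_pmul2l p0).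
  by apply: leq_trans h; apply: leq_addl.
have [m1 m1s min1] : exists2 m1, m1 \in s & forall m, m \in s -> (e m1 <= e m)%N.
  have m0s : m0 \in s by rewrite mem_filter eqxx.
  have ex : exists k, has (fun m => e m == k) s.
    by exists (e m0); apply/hasP; exists m0.
  case: (ex_minnP ex) => k' /hasP[m1 m1s /eqP wk] mink; exists m1 => //.
  by move=> m mS; rewrite wk; apply: mink; apply/hasP; exists m.
have inS m : m \in s -> m \in supp g by rewrite mem_filter => /andP[].
have [||||||i le_i nz] := @shifted_coef _ _ s (fun m => g`_m.2`_m.1) e m1 (n %/ q) c.
- by rewrite filter_uniq ?supp_uniq.
- exact: m1s.
- by rewrite gt_eqF.
- by have := inS _ m1s; rewrite {1}[m1]surjective_pairing mem_supp.
- move=> m ms; rewrite min1 //= -leq_subLR leq_divRL // mulnC mulnBr !eE //.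
  by rewrite subnDl (leq_trans (leq_subr _ _)) ?le_n.
- move=> m ms em; have := eE _ ms; rewrite em eE // => /addnI j2.
  move: ms (m1s); rewrite !mem_filter /w -j2 => /andP[/eqP <- _] /andP[+ _].
  rewrite eqn_add2r eqn_pmul2l // => /eqP j1.
  by rewrite [m]surjective_pairing -j1 -j2 -surjective_pairing.
exists i => //; rewrite -horner_coef0 -[_.[0]]/(horner_eval 0 _) -coef_map.
have -> : map_poly (horner_eval 0) g' =
   \sum_(m <- s) (g`_m.2`_m.1)%:P * ('X + c%:P) ^+ e m.
  rewrite rmorph_sum /s [RHS]big_filter [RHS]big_mkcond; apply: eq_big_seq => m ms.
  rewrite !rmorphM !rmorphXn rmorphD /= !map_polyC map_polyX /=.
  rewrite /horner_eval !hornerE polyC0 expr0n subn_eq0 eqn_leq min // andbT.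
  by case: leqP => _; rewrite ?mulr1 ?mulr0 ?mul0r.
exact: nz.
Qed.

Lemma toric_step t z (g : {poly {poly R}}) n N p q :
  0 < t -> infml iota t -> 0 < z -> (0 < p)%N -> (0 < q)%N ->
  appr iota (z ^+ q / t ^+ p) -> bounded_below g N -> g`_n`_0 != 0 ->
  g`_0`_0 = 0 ->
  exists g' u v m N', [/\ 0 < u, infml iota u /\ infml iota v,
    bounded_below g' N' /\ g'`_m`_0 != 0,
    (m < n)%N \/ m = n /\ (N' < N)%N &
    (0 < ev iota u v g' -> 0 < ev iota t z g)].
Proof.
move=> t0 it z0; wlog cop : p q / coprime p q.
  move=> W p0 q0; have d0 : (0 < gcdn p q)%N by rewrite gcdn_gt0 p0.
  have -> : z ^+ q / t ^+ p =
      (z ^+ (q %/ gcdn p q) / t ^+ (p %/ gcdn p q)) ^+ gcdn p q.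
    by rewrite expr_div_n -!exprM !divnK ?dvdn_gcdl ?dvdn_gcdr.
  move=> /appr_root ap; apply: W.
  - apply/eqP/eqP; rewrite -(eqn_pmul2r d0) mul1n; apply/eqP.
    have dp := divnK (dvdn_gcdl p q); have dq := divnK (dvdn_gcdr p q).
    by rewrite -[RHS](congr2 gcdn dp dq) -muln_gcdl.
  - by rewrite divn_gt0 // dvdn_leq ?dvdn_gcdl.
  - by rewrite divn_gt0 // dvdn_leq ?dvdn_gcdr.
  - by apply: ap => //; rewrite divr_gt0 ?exprn_gt0.
move=> p0 q0; set ze := z ^+ q / t ^+ p => aze bd gn g00.
have ze0 : 0 < ze by rewrite divr_gt0 ?exprn_gt0.
have [c izc] := standard_part (appr_finite aze).
have c0 : 0 < c.
  case: aze => r r0 /andP[rze _]; apply: lt_le_trans r0 _.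
  rewrite leNgt; apply/negP => cr.
  have := izc (r - c); rewrite subr_gt0 => /(_ cr); rewrite rmorphB /=.
  by have := ler_norm (ze - iota c); lra.
case: (egcdnP p q0) => be al; rewrite gcdnC (eqP cop) => bez _.
(* The relation [be * q = al * p + 1] inverts the monomial map: [t = u ^+ q * ze ^+ al] and
   [z = u ^+ p * ze ^+ be]. *)
pose u := t ^+ be / z ^+ al.
have u0 : 0 < u by rewrite divr_gt0 ?exprn_gt0.
have tE : t = u ^+ q * ze ^+ al.
  rewrite /u /ze !expr_div_n -!exprM bez addn1 exprS [(q * al)%N]mulnC [(p * al)%N]mulnC.
  by field; rewrite !expf_neq0 ?gt_eqF.
have zE : z = u ^+ p * ze ^+ be.
  rewrite /u /ze !expr_div_n -!exprM [(q * be)%N]mulnC bez addn1 exprS.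
  rewrite [(p * be)%N]mulnC [(al * p)%N]mulnC.
  by field; rewrite !expf_neq0 ?gt_eqF.
have iu : infml iota u.
  move=> r r0; rewrite gtr0_norm // ltNge; apply/negP => ru.
  have : infml iota (u ^+ q).
    rewrite [u ^+ q](_ : _ = t * (ze^-1) ^+ al).
      by apply: infmlM => //; apply/finiteX/appr_finite/apprV.
    by rewrite tE exprVn mulfK // expf_neq0 // gt_eqF.
  move=> /(_ (r ^+ q)); rewrite exprn_gt0 // => /(_ isT).
  rewrite gtr0_norm ?exprn_gt0 // rmorphXn /= ltNge => /negP; apply.
  by apply: lerXn2r; rewrite ?nnegrE ?(ltW u0) // ltW ?iota_gt0.
pose v := ze - iota c.
have zeE : ze = v + iota c by rewrite /v subrK.
pose w (m : nat * nat) := (q * m.1 + p * m.2)%N.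
have n0 : (0 < n)%N by rewrite lt0n; apply: contraNneq gn => ->; rewrite g00.
have nS : (0, n)%N \in supp g by rewrite mem_supp.
have [m0 m0S min] : exists2 m0, m0 \in supp g & forall m, m \in supp g -> (w m0 <= w m)%N.
  have ex : exists k, has (fun m => w m == k) (supp g).
    by exists (w (0, n)%N); apply/hasP; exists (0, n)%N.
  case: (ex_minnP ex) => k /hasP[m0 m0S /eqP wk] mink; exists m0 => //.
  by move=> m mS; rewrite wk; apply: mink; apply/hasP; exists m.
set k := w m0 in min.
have evE := @ev_toric _ _ q p al be k c g _ _ min.
pose g' := toric q p al be k c g.
have [i le_i nz'] := toric_coef c0 p0 q0 bez gn m0S min.
have bd' : bounded_below g' (q * N - k) by apply: toric_bounded.
exists g', u, v, i, (q * N - k)%N; split => //.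
  (* A ramified step ([1 < q]) lowers [n]. For [q = 1] with [n] unchanged, the exponent [N] drops by
     [k], which is positive because [g] has no constant term. *)
  have [q1|q1] := ltnP 1 q.
    by left; apply: leq_ltn_trans le_i _; apply: ltn_Pdiv.
  have {q1} qE : q = 1%N by apply/eqP; rewrite eqn_leq q1 q0.
  rewrite qE divn1 in le_i; rewrite leq_eqVlt in le_i.
  case/orP: le_i => [/eqP ->|]; [right|by left]; split => //.
  have N0 := bounded_below_gt0 bd g00.
  suff k1 : (0 < k)%N by rewrite qE mul1n ltn_subrL k1.
  rewrite lt0n; apply: contraTneq m0S => k0; rewrite [m0]surjective_pairing.
  move/eqP: k0; rewrite addn_eq0 !muln_eq0 !eqn0Ngt p0 q0 /=.
  by rewrite -!eqn0Ngt => /andP[/eqP-> /eqP->]; rewrite mem_supp g00 eqxx.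
by move=> h; rewrite tE zE zeE evE mulr_gt0 // exprn_gt0.
Qed.

Lemma coef_compNX (g : {poly {poly R}}) n : (g \Po - 'X)`_n = (-1) ^+ n * g`_n.
Proof.
rewrite -[- 'X]scaleN1r comp_polyE (_ : \sum_(i < _) _ = \poly_(i < size g) ((-1) ^+ i * g`_i)).
  by rewrite coef_poly; case: ltnP => // h; rewrite (nth_default _ h) mulr0.
rewrite poly_def; apply: eq_bigr => i _.
by rewrite exprZn scalerA mulrC.
Qed.

Lemma ev_compNX (A : comNzRingType) (io : {rmorphism R -> A}) a b
    (g : {poly {poly R}}) : ev io a b (g \Po - 'X) = ev io a (- b) g.
Proof. by rewrite ev_comp evN evY. Qed.

Lemma bounded_below_opp (g : {poly {poly R}}) N :
  bounded_below g N -> bounded_below (g \Po - 'X) N.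
Proof.
move=> [e [d [e0 d0 h]]]; exists e, d; split => // a b ad bd.
have := h a (- b) ad; rewrite normrN => /(_ bd).
by rewrite (ev2E g) (ev2E (g \Po _)) ev_compNX.
Qed.

(* Puiseux-style induction: if some [z^q / t^p] is close to a positive real [c], the
   toric substitution lowers [(n, N)]; otherwise no two monomials of [g] are comparable
   at [(t, z)], and the sign of the dominant one is seen on a real curve. *)
Lemma transfer t z (g : {poly {poly R}}) n N :
  0 < t -> infml iota t -> infml iota z -> bounded_below g N ->
  g`_n`_0 != 0 -> 0 < ev iota t z g.
Proof.
elim/ltn_ind: n N t z g => n IHn; elim/ltn_ind => N IHN t z g t0 it iz bd gn.
have fd : exists2 d : R, 0 < d & forall a b : R, 0 < a < d -> `|b| < d ->
    0 < ev2 g a b.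
  case: bd => e [d [e0 d0 h]]; exists d => // a b ad bd.
  by apply: lt_le_trans (h a b ad bd); case/andP: ad => a0 _; rewrite mulr_gt0 ?exprn_gt0.
have [d d0 pos] := fd.
have g0pos s : 0 < s < d -> 0 < (g`_0).[s].
  by move=> sd; rewrite -ev2_y0; apply: pos; rewrite ?normr0.
have [g00|g00] := eqVneq g`_0`_0 0; last first.
  have : 0 <= (g`_0).[0].
    by apply: (poly_lim0 d0) => s /g0pos /ltW.
  rewrite horner_coef0 le0r (negPf g00) /= => g00'.
  apply: (@near_gt0 _ _ iota (g`_0`_0)) => //.
  have -> : ev iota t z g - iota g`_0`_0 =
     (ev1 iota t g`_0 - iota (g`_0).[0]) + z * ev iota t z (\poly_(i < (size g).-1) g`_i.+1).
    rewrite horner_coef0 addrAC; congr (_ - _).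
    have {1}-> : g = (g`_0)%:P + 'X * \poly_(i < (size g).-1) g`_i.+1.
      apply/polyP => i; rewrite coefD coefC coefXM coef_poly.
      case: i => [|i] /=; rewrite ?addr0 // add0r; case: ltnP => // h.
      by rewrite nth_default //; move: h; case: (size g).
    by rewrite evD evM evC evY.
  apply: infmlD; first exact: ev1_infml.
  apply: infmlM => //; rewrite ev_supp; apply: finite_sum => m.
  apply: finiteM; last exact/finiteX/infml_finite.
  by apply: finiteM; [apply: finite_iota|apply/finiteX/infml_finite].
wlog z0 : z g iz bd gn pos g0pos g00 {fd} / 0 <= z.
  move=> W; have [z0|z0] := leP 0 z; first exact: (W z g).
  have -> : ev iota t z g = ev iota t (- z) (g \Po - 'X).
    by rewrite ev_compNX opprK.
  apply: W; rewrite ?coef_compNX.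
  - exact: infmlN.
  - exact: bounded_below_opp.
  - by rewrite -[(-1) ^+ n]signr_odd mulr_sign; case: (odd n); rewrite ?coefN ?oppr_eq0.
  - move=> a b ad bd'; rewrite ev2E ev_compNX -ev2E.
    by apply: pos; rewrite ?normrN.
  - by move=> s; rewrite expr0 mul1r; apply: g0pos.
  - by rewrite expr0 mul1r.
  - by rewrite oppr_ge0 ltW.
rewrite le0r in z0; case/orP: z0 => [/eqP->|z0].
  rewrite /ev /horner_morph /= horner_coef0 coef_map.
  exact: ev1_gt0 g0pos.
have [[p [q [p0 q0 ap]]]|nap] := pselect (exists p q, [/\ (0 < p)%N, (0 < q)%N
    & appr iota (z ^+ q / t ^+ p)]).
  have [g' [u [v [m [N' [u0 [iu iv] [bd' gm] lex concl]]]]]] :=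
    toric_step t0 it z0 p0 q0 ap bd gn g00.
  apply: concl; case: lex => [mn|[mn N'N]]; first exact: (IHn m mn N').
  by rewrite mn in gm; apply: (IHN N').
apply: (@dominant_gt0 _ _ iota t z t0 z0 it iz _ g d d0).
- by move=> p q p0 q0 ap; apply: nap; exists p, q.
- have : (0, n)%N \in supp g by rewrite mem_supp.
  by case: (supp g).
by move=> a b ad bd'; apply/ltW/pos.
Qed.

End Toric.

(** * Orderings of a field *)

Section Orderings.
Variable K : fieldType.
Implicit Types (P Q : set K) (x y : K).

Definition precone P := [/\ forall x y, P x -> P y -> P (x + y),
  forall x y, P x -> P y -> P (x * y), forall x, P (x ^+ 2) & ~ P (-1)].

Definition ordering Q := [/\ precone Q, forall x, Q x \/ Q (- x) &
  forall x, Q x -> Q (- x) -> x = 0].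

Lemma precone0 P : precone P -> P 0.
Proof. by move=> [_ _ PX _]; rewrite -[0](mulr0 0) -expr2; apply: PX. Qed.

Lemma precone1 P : precone P -> P 1.
Proof. by move=> [_ _ PX _]; rewrite -[1](mulr1 1) -expr2; apply: PX. Qed.

Lemma precone_div P x y : precone P -> P x -> P y -> P (x / y).
Proof.
move=> cP Px Py; have [->|y0] := eqVneq y 0.
  by rewrite invr0 mulr0; apply: precone0.
case: cP => _ PM PX _.
have -> : x / y = x * (y * y^-1 ^+ 2) by rewrite expr2 mulVKf.
by apply: (PM) => //; apply: PM.
Qed.

(* Adjoining an element [a] with [-a] outside [P] keeps -1 out. *)
Lemma precone_adjoin P a : precone P -> ~ P (- a) ->
  precone [set x | exists2 p : K * K, P p.1 /\ P p.2 & x = p.1 + a * p.2]%classic.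
Proof.
move=> cP Pa; case: (cP) => PD PM PX PN1.
have P0 := precone0 cP.
split.
- move=> _ _ [[p q] [/= Pp Pq] ->] [[r s] [/= Pr Ps] ->].
  by exists (p + r, q + s) => /=; [split; apply: (PD)|ring].
- move=> _ _ [[p q] [/= Pp Pq] ->] [[r s] [/= Pr Ps] ->].
  exists (p * r + a ^+ 2 * (q * s), p * s + q * r) => /=; last by ring.
  split; apply: (PD); try exact: PM.
  by apply: (PM); [apply: PX|apply: (PM)].
- by move=> x; exists (x ^+ 2, 0) => /=; [split => //; apply: PX|rewrite mulr0 addr0].
move=> [[p q] [/= Pp Pq] e].
have E : - a * q = 1 + p by rewrite -[1]opprK e; ring.
have [q0|q0] := eqVneq q 0.
  by apply: PN1; rewrite e q0 mulr0 addr0.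
apply: Pa; rewrite -(mulfK q0 (- a)) E; apply: precone_div => //.
by apply: PD => //; apply: precone1.
Qed.

(** First [- f] is adjoined; a maximal precone above the result is total, since otherwise it could
    be enlarged by [precone_adjoin]. *)
Lemma exists_ordering P f : precone P -> ~ P f ->
  exists2 Q, ordering Q & (P `<=` Q)%classic /\ Q (- f).
Proof.
move=> cP Pf.
have := precone_adjoin cP (a := - f); rewrite opprK => /(_ Pf).
set P0 := (X in precone X) => cP0.
have PP0 : (P `<=` P0)%classic.
  move=> x Px; exists (x, 0); last by rewrite /= mulr0 addr0.
  by split => //=; apply: precone0.
have P0f : P0 (- f).
  exists (0, 1) => /=; last by rewrite add0r mulr1.
  by split; [apply: precone0|apply: precone1].
have [A [cA maxA]] : exists A : set K, precone (A `|` P0)%classic /\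
    forall B, (A `<` B)%classic -> ~ precone (B `|` P0)%classic.
  (* The condition is imposed on the union of [A] with [P0], so that the empty chain is bounded too:
     there the union is [P0]. *)
  apply: (Zorn_bigcup (P := fun A => precone (A `|` P0)%classic)) => F FP tot.
  case: (cP0) => PD PM PX PN.
  have [[X0 FX0]|nF] := pselect (exists X, F X); last first.
    have -> : (\bigcup_(X in F) X `|` P0)%classic = P0 => //.
    apply/seteqP; split => x; last by right.
    by move=> [[X FX _]|//]; case: nF; exists X.
  have lift x : (\bigcup_(X in F) X `|` P0)%classic x ->
      exists2 X, F X & (X `|` P0)%classic x.
    by move=> [[X FX Xx]|Px]; [exists X => //; left|exists X0 => //; right].
  have low X x : F X -> (X `|` P0)%classic x ->
      (\bigcup_(X in F) X `|` P0)%classic x.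
    by move=> FX [Xx|]; [left; exists X|right].
  have two x y : (\bigcup_(X in F) X `|` P0)%classic x ->
      (\bigcup_(X in F) X `|` P0)%classic y ->
      exists2 X, F X & (X `|` P0)%classic x /\ (X `|` P0)%classic y.
    move=> /lift[X FX hx] /lift[Y FY hy]; have [XY|YX] := tot X Y FX FY.
      by exists Y => //; split => //; case: hx; [left; apply: XY|right].
    by exists X => //; split => //; case: hy; [left; apply: YX|right].
  split.
  - move=> x y hx hy; have [X FX [Xx Xy]] := two _ _ hx hy.
    by apply: (low X) => //; case: (FP X FX) => h _ _ _; apply: h.
  - move=> x y hx hy; have [X FX [Xx Xy]] := two _ _ hx hy.
    by apply: (low X) => //; case: (FP X FX) => _ h _ _; apply: h.
  - by move=> x; right; apply: PX.
  by move=> /lift[X FX h]; case: (FP X FX).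
set Q := (A `|` P0)%classic in cA.
exists Q; last by split; [move=> x Px; right; apply: PP0|right].
have tot x : Q x \/ Q (- x).
  have [Qx|nQx] := pselect (Q (- x)); [by right|left].
  have cB := precone_adjoin cA nQx; move: cB.
  set B := (X in precone X) => cB.
  have QB : (Q `<=` B)%classic.
    move=> y Qy; exists (y, 0); last by rewrite /= mulr0 addr0.
    by split => //=; apply: precone0.
  have Bx : B x.
    exists (0, 1) => /=; last by rewrite add0r mulr1.
    by split; [apply: precone0|apply: precone1].
  apply: contrapT => nx; apply: (maxA B).
    split; first by move=> y Ay; apply: QB; left.
    by move=> BA; apply: nx; left; apply: BA.
  have -> : (B `|` P0)%classic = B => //.
  by apply/seteqP; split => [y [//|Py]|y By]; [apply: QB; right|left].
split => // x Qx QNx; apply/eqP; apply: contrapT => /negP x0.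
case: (cA) => _ QM QX; apply.
have -> : -1 = (- x) / x by rewrite mulNr divff.
exact: precone_div.
Qed.

End Orderings.

(** A copy of [K] indexed by the proof [h], so that the order structure attached to it can depend on
    the ordering. *)
Definition ordered_field (K : fieldType) (Q : set K) (h : ordering Q) : Type := K.

Section OrderedField.
Variables (K : fieldType) (Q : set K) (h : ordering Q).
Local Notation L := (ordered_field h).
HB.instance Definition _ := GRing.Field.on L.

Let Rle (x y : L) := `[< Q (y - x) >].
Let Rlt (x y : L) := (y != x) && Rle x y.
Let norm (x : L) : L := if Rle 0 x then x else - x.

Let le0_add x y : Rle 0 x -> Rle 0 y -> Rle 0 (x + y).
Proof.
rewrite /Rle !subr0 => /asboolP hx /asboolP hy; apply/asboolP.
by have [[QD _ _ _] _ _] := h; apply: QD.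
Qed.

Let le0_mul x y : Rle 0 x -> Rle 0 y -> Rle 0 (x * y).
Proof.
rewrite /Rle !subr0 => /asboolP hx /asboolP hy; apply/asboolP.
by have [[_ QM _ _] _ _] := h; apply: QM.
Qed.

Let le0_anti x : Rle 0 x -> Rle x 0 -> x = 0.
Proof.
rewrite /Rle subr0 sub0r => /asboolP hx /asboolP hy.
by have [_ _ anti] := h; apply: anti.
Qed.

Let sub_ge0 x y : Rle 0 (y - x) = Rle x y.
Proof. by rewrite /Rle subr0. Qed.

Let le0_total x : Rle 0 x || Rle x 0.
Proof.
rewrite /Rle subr0 sub0r; have [_ /(_ x) [] hx _] := h.
  by apply/orP; left; apply/asboolP.
by apply/orP; right; apply/asboolP.
Qed.

Let normN x : norm (- x) = norm x.
Proof.
rewrite /norm; have := le0_total x; have := @le0_anti x.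
rewrite -(sub_ge0 x 0) sub0r; case: ifP => hN; case: ifP => hx //=.
- by move=> /(_ isT isT) ->; rewrite oppr0.
- by rewrite opprK.
Qed.

Let ge0_norm x : Rle 0 x -> norm x = x.
Proof. by rewrite /norm => ->. Qed.

Let lt_def x y : Rlt x y = (y != x) && Rle x y.
Proof. by []. Qed.

HB.instance Definition _ := Num.IntegralDomain_isLeReal.Build L
  le0_add le0_mul le0_anti sub_ge0 le0_total normN ge0_norm lt_def.

Lemma ordered_field_ge0 (x : L) : (0 <= x) = `[< Q x >].
Proof. by rewrite -[LHS]/(Rle 0 x) /Rle subr0. Qed.

End OrderedField.

(** * Transfer on a strip *)

Lemma ev_subst (R A : comNzRingType) (iota : {rmorphism R -> A}) a b P Q
    (g : {poly {poly R}}) :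
  ev iota a b (ev (polyC \o polyC) P Q g) = ev iota (ev iota a b P) (ev iota a b Q) g.
Proof.
rewrite (ev_supp _ P Q) [RHS]ev_supp ev_sum.
by apply: eq_bigr => m _; rewrite !evM !evXn -(evcst _ a b).
Qed.

Lemma ev_reverse (R : comNzRingType) (K : fieldType) (iota : {rmorphism R -> K})
    (a z : K) (F : {poly {poly R}}) n : z != 0 -> (size F <= n.+1)%N ->
  ev iota a z F = z ^+ n * ev iota a z^-1 (\poly_(i < n.+1) F`_(n - i)).
Proof.
move=> z0 sF.
have {1}-> : F = \poly_(i < n.+1) F`_i.
  apply/polyP => i; rewrite coef_poly; case: ltnP => // le.
  by rewrite nth_default // (leq_trans sF).
rewrite !poly_def !ev_sum mulr_sumr (reindex_inj rev_ord_inj) /=.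
apply: eq_bigr => i _; rewrite subSS -!mul_polyC !evM !evC mulrCA; congr (_ * _).
rewrite !evXn !evY.
have lin : (i <= n)%N by rewrite -ltnS.
have -> : z ^+ n = z ^+ (n - i) * z ^+ i by rewrite -exprD subnK.
by rewrite exprVn mulfK // expf_neq0.
Qed.

Section GlobalTransfer.
Variables (R : realType) (L : realFieldType) (iota : {rmorphism R -> L}).
Implicit Type g F : {poly {poly R}}.

(** [transfer] needs a coefficient that survives at x = 0. If there is none, x divides [g], and
    dividing by it lowers [N]. *)
Lemma transfer0 t z g N :
  0 < t -> infml iota t -> infml iota z -> bounded_below g N ->
  0 < ev iota t z g.
Proof.
move=> t0 it iz; elim: N g => [|N IH] g bd.
  have [g00|g00] := eqVneq g`_0`_0 0; last exact: transfer t0 it iz bd g00.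
  by have := bounded_below_gt0 bd g00.
have [[n gn]|ng] := pselect (exists n, g`_n`_0 != 0); first exact: transfer t0 it iz bd gn.
have gn n : g`_n`_0 = 0 by apply/eqP/negPn/negP => gn; apply: ng; exists n.
pose g1 := map_poly (drop_poly 1) g.
have gE : g = varx R * g1.
  apply/polyP => n; rewrite /varx mul_polyC coefZ coef_map /=.
  apply/polyP => i; rewrite coefXM coef_drop_poly; case: i => [|i] /=.
    exact: gn.
  by rewrite addn1.
rewrite gE evM evX mulr_gt0 //; apply: IH.
have [e [d [e0 d0 h]]] := bd; exists e, d; split => // a b ad bd'.
have := h a b ad bd'; rewrite gE (ev2E g1) ev2E evM evX exprSr mulrA.
by rewrite [a * _]mulrC ler_pM2r //; case/andP: ad.
Qed.

Lemma poly_lower_bound (v : {poly R}) (d : R) : v != 0 -> 0 < d ->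
  (forall a, 0 < a < d -> 0 <= v.[a]) ->
  exists N, exists e, exists2 d', 0 < e /\ 0 < d' &
    forall a, 0 < a < d' -> e * a ^+ N <= v.[a].
Proof.
move=> v0 d0 h; have [m [q]] := multiplicity_XsubC v 0.
rewrite v0 /= subr0 => q0 vE.
have qp : 0 < q.[0].
  rewrite lt_def; move: q0; rewrite rootE => -> /=.
  apply: (poly_lim0 d0) => s sd; have := h s sd; case/andP: sd => s0 _.
  by rewrite vE !hornerE pmulr_lge0 ?exprn_gt0.
have e0 : 0 < q.[0] / 2 by lra.
have [d' d'0 near] := poly_near0 q e0.
exists m, (q.[0] / 2), d' => // a /andP[a0 ad]; rewrite vE !hornerE.
rewrite ler_pM2r ?exprn_gt0 //.
have := near a; rewrite gtr0_norm // => /(_ ad).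
by have := ler_norm (- (q.[a] - q.[0])); rewrite normrN; lra.
Qed.

Variables (c d : R) (x : L).
Hypotheses (cx : iota c <= x) (xd : x <= iota d).
Hypothesis xtr : forall r : R, x != iota r.

(** Translate the standard parts of [x] and [z] to the origin. The lower bound [v] depends on the
    first variable alone, so near the origin it is at least a multiple of a power of that
    variable. *)
Lemma transfer_finite z F (v : {poly R}) : v != 0 ->
  (forall a b : R, c <= a <= d -> 0 <= v.[a] <= ev2 F a b) ->
  finite iota z -> 0 < ev iota x z F.
Proof.
move=> v0 h fz.
have fx : finite iota x.
  exists (Num.max `|c| `|d|); rewrite ler_norml -rmorphN; apply/andP; split.
    apply: le_trans cx; rewrite iota_le lerNl le_max.
    by rewrite -normrN ler_norm.
  by apply: (le_trans xd); rewrite iota_le le_max ler_norm orbT.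
have [x0 ix] := standard_part fx; have [z0 iz] := standard_part fz.
have cx0 : c <= x0.
  rewrite leNgt; apply/negP => lt; have := ix (c - x0).
  rewrite subr_gt0 => /(_ lt); have := ler_norm (x - iota x0).
  by rewrite rmorphB /=; have := cx; lra.
have x0d : x0 <= d.
  rewrite leNgt; apply/negP => lt; have := ix (x0 - d).
  rewrite subr_gt0 => /(_ lt); have := ler_norm (- (x - iota x0)).
  by rewrite normrN rmorphB /=; have := xd; lra.
(* [x] is not real, so it lies strictly on one side of its standard part [x0]. The sign [sg] records
   the side, and [[c, d]] extends beyond [x0] in that direction. *)
have [sg [sg0 [t t0 xE]] [dl dl0 side]] : exists2 sg : R, sg != 0 /\
    exists2 t : L, 0 < t & x = iota x0 + iota sg * t &
    exists2 dl : R, 0 < dl & forall a : R, 0 < a < dl -> c <= x0 + sg * a <= d.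
  have [lt|lt] := ltP (iota x0) x.
    exists 1.
      split; first exact: oner_neq0.
      by exists (x - iota x0); rewrite ?subr_gt0 // rmorph1 mul1r addrC subrK.
    exists (d - x0) => [|a]; last by lra.
    by rewrite subr_gt0 -(iota_lt iota) (lt_le_trans lt).
  have {}lt : x < iota x0 by rewrite lt_def eq_sym xtr.
  exists (- 1).
    split; first by rewrite oppr_eq0 oner_neq0.
    exists (iota x0 - x); rewrite ?subr_gt0 // rmorphN rmorph1 mulN1r opprB.
    by rewrite addrC subrK.
  exists (x0 - c) => [|a]; last by lra.
  by rewrite subr_gt0 -(iota_lt iota) (le_lt_trans cx).
have it : infml iota t.
  have -> : t = (x - iota x0) * iota sg^-1.
    by rewrite xE fmorphV addrAC subrr add0r mulrAC mulfV ?mul1r ?fmorph_eq0.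
  by apply: infmlM => //; apply: finite_iota.
pose P := cst x0 + cst sg * varx R; pose Q : {poly {poly R}} := cst z0 + 'X.
pose g := ev (polyC \o polyC) P Q F.
pose v1 := v \Po (x0%:P + sg *: 'X).
have evP (A : comNzRingType) (io : {rmorphism R -> A}) (a b : A) : ev io a b P = io x0 + io sg * a.
  by rewrite evD evM !evcst evX.
have evQ (A : comNzRingType) (io : {rmorphism R -> A}) (a b : A) : ev io a b Q = io z0 + b.
  by rewrite evD evcst evY.
have v10 : v1 != 0.
  apply: contraNneq v0 => e; have -> : v = v1 \Po (sg^-1 *: ('X - x0%:P)).
    rewrite /v1 -comp_polyA comp_polyD comp_polyC comp_polyZ comp_polyX.
    by rewrite scalerA mulfV // scale1r addrC subrK comp_polyXr.
  by rewrite e comp_poly0.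
have v1E a : v1.[a] = v.[x0 + sg * a] by rewrite horner_comp !hornerE.
have [|N [e [d' [e0 d'0] hN]]] := @poly_lower_bound v1 dl v10 dl0.
  by move=> a ad; rewrite v1E; case/andP: (h _ 0 (side a ad)).
have -> : ev iota x z F = ev iota t (z - iota z0) g.
  by rewrite ev_subst evP evQ -xE addrC subrK.
apply: (@transfer0 _ _ _ N) => //.
exists e, (Num.min dl d'); split; rewrite ?lt_min ?dl0 //.
move=> a b /andP[a0]; rewrite !lt_min => /andP[al ad'] _.
have ad : 0 < a < dl by rewrite a0.
apply: le_trans (_ : v1.[a] <= _); first by apply: hN; rewrite a0.
by rewrite ev2E ev_subst evP evQ v1E -ev2E /=; case/andP: (h _ (z0 + b) (side a ad)).
Qed.

(** For infinite [z] the reversed polynomial is evaluated at the infinitesimal [z^-1]; the factor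
    [z ^+ D.*2] lost by the reversal is positive because its exponent is even. *)
Lemma transfer_global z F (v : {poly R}) D : v != 0 -> (size F <= D.*2.+1)%N ->
  (forall a b : R, c <= a <= d -> 0 <= v.[a] <= ev2 F a b) ->
  (forall a b : R, c <= a <= d ->
     v.[a] <= ev2 (\poly_(i < D.*2.+1) F`_(D.*2 - i)) a b) ->
  0 < ev iota x z F.
Proof.
move=> v0 sF h1 h2; have [fz|nfz] := pselect (finite iota z).
  exact: transfer_finite h1 fz.
have z0 : z != 0.
  apply: contra_notN nfz => /eqP->; rewrite -(rmorph0 iota).
  exact: finite_iota.
have iz : infml iota z^-1.
  move=> r r0; rewrite ltNge; apply: contra_notN nfz => h; exists r^-1.
  rewrite fmorphV -[`|z|]invrK lef_pV2 ?posrE ?iota_gt0 ?invr_gt0 ?normr_gt0 //.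
  by rewrite -normfV.
rewrite (ev_reverse _ _ z0 sF) pmulr_rgt0.
  apply: (@transfer_finite _ _ v) => // [a b ad|]; last exact: infml_finite.
  by rewrite h2 // andbT; case/andP: (h1 a b ad).
by rewrite -muln2 exprM exprn_even_gt0 //= expf_neq0.
Qed.

End GlobalTransfer.

(** * Certificates on a strip *)

Local Notation "x %:F" := (@FracField.tofrac _ x).

Lemma fraction_repr (D : idomainType) (u : {fraction D}) :
  exists n d : D, d != 0 /\ u * d%:F = n%:F.
Proof.
elim/generic_quotient.quotW: u => r; exists \n_r, \d_r; split; first exact: denom_ratioP.
have -> : \pi_(FracField.type D)%qT r = (\n_r)%:F / (\d_r)%:F.
  unlock FracField.tofrac.
  rewrite -[_^-1]FracField.pi_inv -[RHS]FracField.pi_mul.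
  by rewrite /FracField.mulf /FracField.invf !numden_Ratio ?oner_neq0 ?denom_ratioP //
   mulr1 mul1r Ratio_numden.
by rewrite divfK // tofrac_eq0 denom_ratioP.
Qed.

Section Sos.
Variable R : comNzRingType.
Implicit Types p q : {poly {poly R}}.

Lemma sos0 : is_sos (0 : {poly {poly R}}).
Proof. by exists [::]; rewrite big_nil. Qed.

Lemma sos_sqr p : is_sos (p ^+ 2).
Proof. by exists [:: p]; rewrite big_seq1. Qed.

Lemma sosD p q : is_sos p -> is_sos q -> is_sos (p + q).
Proof. by move=> [l ->] [m ->]; exists (l ++ m); rewrite big_cat. Qed.

Lemma sosM p q : is_sos p -> is_sos q -> is_sos (p * q).
Proof.
move=> [l ->] [m ->]; exists [seq x * y | x <- l, y <- m].
rewrite big_allpairs_dep mulr_suml; apply: eq_bigr => x _.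
by rewrite mulr_sumr; apply: eq_bigr => y _; rewrite exprMn.
Qed.

End Sos.

Lemma poly_vanish (R : realType) (p : {poly R}) (c d : R) : c < d ->
  (forall x, c < x < d -> p.[x] = 0) -> p = 0.
Proof.
move=> cd h; apply: contraTeq (leqnn (size p)) => p0.
pose rs := mkseq (fun i => c + (d - c) / i.+2%:R) (size p).
rewrite -ltnNge -{2}(size_mkseq (fun i => c + (d - c) / i.+2%:R) (size p)).
rewrite ltnNge; apply/negP => _.
have : (size rs < size p)%N.
  apply: max_poly_roots => //.
    apply/allP => _ /mapP[i _ ->]; rewrite rootE h //.
    have i2 : 1 < i.+2%:R :> R by rewrite ltr1n.
    have i0 : 0 < i.+2%:R :> R by rewrite ltr0n.
    rewrite ltrDl divr_gt0 ?subr_gt0 //= -ltrBrDl ltr_pdivrMr //.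
    by rewrite ltr_pMr // subr_gt0.
  apply/mkseq_uniqP => i j _ _ /addrI /mulfI e.
  have /e /invr_inj /eqP : d - c != 0 by rewrite subr_eq0 gt_eqF.
  by rewrite eqr_nat => /eqP [].
by rewrite size_mkseq ltnn.
Qed.

Section Fibre.
Variable R : comNzRingType.

Definition fibre (x : R) : {poly {poly R}} -> {poly R} :=
  map_poly (horner_eval x).
HB.instance Definition _ x := GRing.RMorphism.on (fibre x).

Lemma fibreE x y F : (fibre x F).[y] = ev2 F x y.
Proof.
have {1}-> : y = horner_eval x y%:P by rewrite /horner_eval hornerC.
by rewrite horner_map.
Qed.

Lemma coef_fibre x F i : (fibre x F)`_i = (F`_i).[x].
Proof. by rewrite coef_map. Qed.

End Fibre.

Lemma bipoly_vanish (R : realType) (F : {poly {poly R}}) (c d e f : R) : c < d ->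
  e < f -> (forall x y, c < x < d -> e < y < f -> ev2 F x y = 0) -> F = 0.
Proof.
move=> cd ef h; apply/polyP => i; rewrite coef0; apply: (poly_vanish cd) => x xcd.
rewrite -coef_fibre (_ : fibre x F = 0) ?coef0 //.
by apply: (poly_vanish ef) => y yef; rewrite fibreE h.
Qed.

Definition itv_poly (R : comNzRingType) (c d : R) : {poly R} :=
  ('X - c%:P) * (d%:P - 'X).

Lemma itv_polyE (R : comNzRingType) (c d x : R) :
  (itv_poly c d).[x] = (x - c) * (d - x).
Proof. by rewrite !hornerE. Qed.

Section RationalCertificate.
Variable R : realType.
Implicit Types (F : {poly {poly R}}) (c d : R).

Lemma sos_ge0 F x y : is_sos F -> 0 <= ev2 F x y.
Proof.
move=> [l ->]; rewrite ev2E ev_sum; apply: sumr_ge0 => g _.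
by rewrite evXn sqr_ge0.
Qed.

Definition itv_cone c d : set {poly {poly R}} :=
  [set F | exists s0 s1, [/\ is_sos s0, is_sos s1 & F = s0 + (itv_poly c d)%:P * s1]]%classic.

Lemma itv_coneD c d F G : itv_cone c d F -> itv_cone c d G -> itv_cone c d (F + G).
Proof.
move=> [s0 [s1 [h0 h1 ->]]] [r0 [r1 [k0 k1 ->]]].
exists (s0 + r0), (s1 + r1); split; [exact: sosD|exact: sosD|ring].
Qed.

Lemma itv_coneM c d F G : itv_cone c d F -> itv_cone c d G -> itv_cone c d (F * G).
Proof.
move=> [s0 [s1 [h0 h1 ->]]] [r0 [r1 [k0 k1 ->]]].
exists (s0 * r0 + (itv_poly c d)%:P ^+ 2 * (s1 * r1)), (s0 * r1 + s1 * r0).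
split; last by ring.
  apply: sosD; first exact: sosM.
  by apply: sosM; [apply: sos_sqr|apply: sosM].
by apply: sosD; apply: sosM.
Qed.

Lemma itv_cone_sqr c d F : itv_cone c d (F ^+ 2).
Proof.
exists (F ^+ 2), 0; split; [exact: sos_sqr|exact: sos0|].
by rewrite mulr0 addr0.
Qed.

Lemma itv_cone_ge0 c d F x y : itv_cone c d F -> c <= x <= d -> 0 <= ev2 F x y.
Proof.
move=> [s0 [s1 [h0 h1 ->]]] /andP[cx xd]; rewrite ev2E evD evM -!ev2E.
apply: addr_ge0; first exact: sos_ge0.
apply: mulr_ge0; last exact: sos_ge0.
by rewrite /ev2 hornerC itv_polyE mulr_ge0 // subr_ge0.
Qed.

(** The precone of R(x, z) generated by (x - c)(d - x). Denominators enter only through squares, so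
    membership can be tested inside the polynomial ring. *)
Definition frac_cone c d : set {fraction {poly {poly R}}} :=
  [set u | exists q s, [/\ q != 0, itv_cone c d s & u * q%:F ^+ 2 = s%:F]]%classic.

Lemma frac_cone_precone c d : c < d -> precone (frac_cone c d).
Proof.
move=> cd; split.
- move=> u v [q [s [q0 ms us]]] [r [t [r0 mt vt]]].
  exists (q * r), (s * r ^+ 2 + t * q ^+ 2); split; first by rewrite mulf_neq0.
    by apply: itv_coneD; apply: itv_coneM => //; apply: itv_cone_sqr.
  by rewrite tofracD (tofracM s) (tofracM t) !tofracXn (tofracM q) -us -vt; ring.
- move=> u v [q [s [q0 ms us]]] [r [t [r0 mt vt]]].
  exists (q * r), (s * t); split; first by rewrite mulf_neq0.
    exact: itv_coneM.
  by rewrite (tofracM q) (tofracM s) -us -vt; ring.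
- move=> u; have [n [q [q0 uq]]] := fraction_repr u.
  exists q, (n ^+ 2); split => //; first exact: itv_cone_sqr.
  by rewrite -exprMn uq expr2 -tofracM -expr2.
move=> [q [s [q0 ms]]]; rewrite mulN1r => /eqP.
rewrite -tofracXn -tofracN tofrac_eq => /eqP qs; case/eqP: q0.
apply: (bipoly_vanish cd ltr01) => x y /andP[cx xd] _; apply/eqP.
have xI : c <= x <= d by rewrite !ltW.
have := itv_cone_ge0 y ms xI.
rewrite -qs !ev2E evN evXn -!ev2E oppr_ge0 => h.
by rewrite -sqrf_eq0 eq_le h sqr_ge0.
Qed.

(** If the conclusion fails, some ordering of R(x, z) contains [frac_cone c d] and [- F]. The
    variables are then a point of an ordered extension at which [F] evaluates to itself, and
    [transfer_global] makes it positive there. *)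
Lemma rational_certificate c d F (v : {poly R}) D : c < d ->
  v != 0 -> (size F <= D.*2.+1)%N ->
  (forall a b : R, c <= a <= d -> 0 <= v.[a] <= ev2 F a b) ->
  (forall a b : R, c <= a <= d ->
     v.[a] <= ev2 (\poly_(i < D.*2.+1) F`_(D.*2 - i)) a b) ->
  exists2 q, q != 0 & itv_cone c d (q ^+ 2 * F).
Proof.
move=> cd v0 sF h1 h2; apply: contrapT => no.
have cP := frac_cone_precone cd.
have nF : ~ frac_cone c d F%:F.
  move=> [q [s [q0 ms]]]; rewrite -tofracXn -tofracM => /eqP.
  rewrite tofrac_eq => /eqP e; apply: no; exists q => //.
  by rewrite mulrC e.
have [Q oQ [PQ QF]] := exists_ordering cP nF.
pose L : realFieldType := ordered_field oQ.
pose iota : {rmorphism R -> L} :=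
  (@FracField.tofrac {poly {poly R}} : {rmorphism _ -> L}) \o (polyC \o polyC).
pose x : L := (varx R)%:F.
pose z : L := ('X : {poly {poly R}})%:F.
have evF G : ev iota x z G = G%:F :> L.
  rewrite {2}(supp_sum G) (raddf_sum (@FracField.tofrac _)) ev_supp.
  apply: eq_bigr => m _; apply: esym; apply: etrans (tofracM _ _) _.
  congr (_ * _); last exact: tofracXn.
  by apply: etrans (tofracM _ _) _; congr (_ * _); apply: tofracXn.
have N0 : 0 <= ev iota x z (itv_poly c d)%:P.
  rewrite evF ordered_field_ge0; apply/asboolP/PQ.
  exists 1, (itv_poly c d)%:P; split; rewrite ?oner_neq0 //.
    exists 0, 1; split; first exact: sos0.
      by rewrite -(expr1n _ 2); apply: sos_sqr.
    by rewrite add0r mulr1.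
  by rewrite tofrac1 expr1n mulr1.
have NE : ev iota x z (itv_poly c d)%:P = (x - iota c) * (iota d - x).
  have -> : (itv_poly c d)%:P = (varx R - cst c) * (cst d - varx R).
    by rewrite /itv_poly /varx /cst polyCM !polyCB.
  by rewrite evM !evB !evcst !evX.
rewrite NE in N0.
have cdL : iota c < iota d by rewrite iota_lt.
have cx : iota c <= x by nra.
have xd : x <= iota d by nra.
have xtr r : x != iota r.
  rewrite -subr_eq0 -[_ - _]/((varx R)%:F - (cst r)%:F) -tofracB tofrac_eq0.
  by rewrite /varx /cst -polyCB polyC_eq0 polyXsubC_eq0.
have := transfer_global (iota := iota) cx xd xtr z v0 sF h1 h2.
rewrite evF; apply/negP; rewrite -leNgt -oppr_ge0.
by rewrite ordered_field_ge0; apply/asboolP.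
Qed.

End RationalCertificate.

(** * The Cassels-Pfister theorem for diagonal forms over a domain *)

Section CasselsPfister.
Variables (S : idomainType) (m : nat) (W : 'I_m -> S).

Let phi (g : 'I_m -> {poly S}) := \sum_i (W i)%:P * g i ^+ 2.
Let bil (g h : 'I_m -> {poly S}) := \sum_i (W i)%:P * (g i * h i).

Hypothesis anisotropic : forall r, phi r = 0 -> forall i, r i = 0.

Let phi_lin a b g h :
  phi (fun i => a * g i + b * h i) =
  a ^+ 2 * phi g + 2%:R * (a * b) * bil g h + b ^+ 2 * phi h.
Proof.
rewrite /phi /bil !mulr_sumr -!big_split /=; apply: eq_bigr => i _; ring.
Qed.

Let bil_lin a b g h k :
  bil k (fun i => a * g i + b * h i) = a * bil k g + b * bil k h.
Proof.
rewrite /bil !mulr_sumr -!big_split /=; apply: eq_bigr => i _; ring.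
Qed.

Let bilxx g : bil g g = phi g.
Proof. by apply: eq_bigr => i _; rewrite expr2. Qed.

Let bilC g h : bil g h = bil h g.
Proof. by apply: eq_bigr => i _; rewrite [g i * _]mulrC. Qed.

(** The coefficients form only a domain (R[x] in the application), so dividing by [q] costs a power
    of its leading coefficient. The largest exponent needed gives one factor [l] for all [i]. *)
Lemma pseudo_division (q : {poly S}) (g : 'I_m -> {poly S}) : q != 0 ->
  exists l : S, exists c r : 'I_m -> {poly S}, [/\ l != 0,
    forall i, l%:P * g i = q * c i + r i & forall i, (size (r i) < size q)%N].
Proof.
move=> q0; have lq : lead_coef q != 0 by rewrite lead_coef_eq0.
pose K := (\max_i scalp (g i) q)%N.
pose u i := lead_coef q ^+ (K - scalp (g i) q).
exists (lead_coef q ^+ K), (fun i => (u i)%:P * (g i %/ q)),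
  (fun i => (u i)%:P * (g i %% q)).
split=> [|i|i]; first exact: expf_neq0.
  have le : (scalp (g i) q <= K)%N by apply: leq_bigmax.
  rewrite -(subnK le) exprD -/(u i) polyCM -mulrA mul_polyC.
  rewrite [_%:P * g i]mul_polyC (Pdiv.Idomain.divp_eq (g i) q).
  by rewrite mul_polyC scalerDr -!mul_polyC; ring.
by rewrite mul_polyC size_scale ?expf_neq0 // ltn_modp.
Qed.

(* Cassels's reflection: the line through [g / q] and its polynomial part [c / l] meets
   the quadric [phi = f] in a second point, of smaller denominator. *)
Lemma cassels_pfister (f q : {poly S}) g : q != 0 -> q ^+ 2 * f = phi g ->
  exists h : S, exists2 g', h != 0 & h%:P ^+ 2 * f = phi g'.
Proof.
have [n] := ubnP (size q); elim: n q g => // n IH q g sq q0 fg.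
have [sq1|sq1] := leqP (size q) 1.
  exists q`_0, g; last by rewrite -size1_polyC.
  by rewrite -polyC_eq0 -size1_polyC.
have [l [c [r [l0 lg sr]]]] := pseudo_division g q0.
have rE i : r i = l%:P * g i + (- q) * c i by rewrite lg; ring.
have phir : phi r = l%:P ^+ 2 * phi g + 2%:R * (l%:P * - q) * bil g c + (- q) ^+ 2 * phi c.
  by rewrite -phi_lin; apply: eq_bigr => i _; rewrite rE.
have bilr : bil c r = l%:P * bil g c - q * phi c.
  rewrite (bilC g) -bilxx -mulNr -bil_lin; apply: eq_bigr => i _.
  by rewrite rE.
(* [Q] is the quotient of [phi r] by [q]. Since every [r i] is shorter than [q], so is [Q], and
   [l%:P * Q] becomes the new denominator. *)
pose Q := l%:P ^+ 2 * q * f - 2%:R * l%:P * bil g c + q * phi c.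
have phirQ : phi r = q * Q by rewrite phir -fg /Q; ring.
have [Q0|Q0] := eqVneq Q 0.
  have r0 : forall i, r i = 0 by apply: anisotropic; rewrite phirQ Q0 mulr0.
  exists l, c => //; apply: (mulfI (_ : q ^+ 2 != 0)); first exact: expf_neq0.
  rewrite mulrCA fg /phi !mulr_sumr; apply: eq_bigr => i _.
  have e : l%:P * g i = q * c i by rewrite lg r0 addr0.
  by rewrite mulrCA -exprMn e exprMn; ring.
(* Numerator of the second intersection point: starting from [c], the coefficient of the direction
   [r] is fixed by requiring the value of the form to be [f] again. *)
pose a := phi c - l%:P ^+ 2 * f.
apply: (IH (l%:P * Q) (fun i => Q * c i + a * r i)).
- rewrite mul_polyC size_scale //.
  have : (size (q * Q)%R <= (size q).-1 + (size q).-1 - 1)%N.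
    rewrite -phirQ; apply: leq_trans (size_sum _ _ _) _.
    apply/bigmax_leqP => i _; rewrite mul_polyC.
    apply: leq_trans (size_scale_leq _ _) _.
    have [->|ri0] := eqVneq (r i) 0; first by rewrite expr0n size_poly0.
    rewrite expr2 size_mul //; have := sr i; move: (size _) (size _); lia.
  by rewrite size_mul //; move: sq sq1; move: (size q) (size Q); lia.
- by rewrite mulf_neq0 ?polyC_eq0.
rewrite phi_lin bilr phirQ /a /Q; ring.
Qed.

End CasselsPfister.

Section EvenPart.
Variable S : comNzRingType.
Implicit Types p q : {poly S}.

Lemma even_poly_comp p : even_poly (p \Po 'X^2) = p.
Proof.
apply/polyP => i; rewrite coef_even_poly coef_comp_poly_Xn // -muln2.
by rewrite dvdn_mull // mulnK.
Qed.

Lemma odd_poly_comp p : odd_poly (p \Po 'X^2) = 0.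
Proof.
apply/polyP => i; rewrite coef_odd_poly coef_comp_poly_Xn // coef0.
by rewrite dvdn2 /= odd_double.
Qed.

(** The cross term of a square is odd. With y = z^2 this turns a square in z into e^2 + y o^2. *)
Lemma even_poly_sqr p :
  even_poly (p ^+ 2) = even_poly p ^+ 2 + 'X * odd_poly p ^+ 2.
Proof.
have -> : p ^+ 2 = (even_poly p ^+ 2 + 'X * odd_poly p ^+ 2) \Po 'X^2 +
    ((even_poly p * odd_poly p + even_poly p * odd_poly p) \Po 'X^2) * 'X.
  rewrite -{1}(poly_even_odd p) !comp_polyD !comp_polyM !comp_polyX.
  by move: (_ \Po _) (_ \Po _) => e o; ring.
by rewrite even_polyD even_polyMX odd_poly_comp mul0r addr0 even_poly_comp.
Qed.

End EvenPart.

(** * Sums of e^2 + y o^2 and certificates over one interval *)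

Section QuadSums.
Variable R : realType.
Implicit Types (F : {poly {poly R}}) (c d x y : R).
Implicit Type l : seq ({poly {poly R}} * {poly {poly R}}).

(** The preordering of the half-line y >= 0 over R[x]; a pair holds the even and odd parts of a
    polynomial in z, where y = z^2. *)
Definition qsum l : {poly {poly R}} :=
  \sum_(p <- l) (p.1 ^+ 2 + 'X * p.2 ^+ 2).

Lemma qsum_cons p l : qsum (p :: l) = p.1 ^+ 2 + 'X * p.2 ^+ 2 + qsum l.
Proof. by rewrite /qsum big_cons. Qed.

Lemma ev2_qsum l x y :
  ev2 (qsum l) x y = \sum_(p <- l) (ev2 p.1 x y ^+ 2 + y * ev2 p.2 x y ^+ 2).
Proof.
rewrite ev2E ev_sum; apply: eq_bigr => p _.
by rewrite evD evXn evM evXn evY -!ev2E.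
Qed.

Lemma qsum_ge0 l x y : 0 <= y -> 0 <= ev2 (qsum l) x y.
Proof.
move=> y0; rewrite ev2_qsum; apply: sumr_ge0 => p _.
by apply: addr_ge0; [apply: sqr_ge0|apply: mulr_ge0 => //; apply: sqr_ge0].
Qed.

Lemma fibre0_dvd x F : fibre x F = 0 -> exists G, F = ('X - x%:P)%:P * G.
Proof.
move=> F0; exists (map_poly (fun p => p %/ ('X - x%:P)) F).
apply/polyP => i; rewrite coefCM coef_map_id0 ?div0p // mulrC divpK //.
by rewrite dvdp_XsubCl rootE -coef_fibre F0 coef0.
Qed.

(** All terms are nonnegative for y > 0, so each of them vanishes on the fibre, and every squared
    entry is divisible by ['X - x%:P]. *)
Lemma qsum_dvd l x :
  (forall y, 0 < y < 1 -> ev2 (qsum l) x y = 0) ->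
  exists l', qsum l = ('X - x%:P)%:P ^+ 2 * qsum l'.
Proof.
elim: l => [_|p l IH h]; first by exists [::]; rewrite /qsum !big_nil mulr0.
have qE := qsum_cons p l.
have hp y : 0 < y < 1 ->
    [/\ ev2 p.1 x y = 0, ev2 p.2 x y = 0 & ev2 (qsum l) x y = 0].
  move=> yy; have := h y yy; case/andP: yy => y0 _.
  rewrite qE ev2E !evD evXn evM evXn evY -!ev2E.
  have := qsum_ge0 l x (ltW y0).
  have := sqr_ge0 (ev2 p.1 x y).
  have : 0 <= y * ev2 p.2 x y ^+ 2 by apply: mulr_ge0; [apply: ltW|apply: sqr_ge0].
  move=> h1 h2 h3 h4.
  have e1 : ev2 p.1 x y ^+ 2 = 0 by lra.
  have e2 : y * ev2 p.2 x y ^+ 2 = 0 by lra.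
  split; [by apply/eqP; rewrite -sqrf_eq0 e1| |lra].
  by move/eqP: e2; rewrite mulf_eq0 gt_eqF //= sqrf_eq0 => /eqP.
have [l' el] : exists l', qsum l = ('X - x%:P)%:P ^+ 2 * qsum l'.
  by apply: IH => y /hp[].
have [|G1 e1] := @fibre0_dvd x p.1.
  by apply: (poly_vanish ltr01) => y /hp[e _ _]; rewrite fibreE.
have [|G2 e2] := @fibre0_dvd x p.2.
  by apply: (poly_vanish ltr01) => y /hp[_ e _]; rewrite fibreE.
by exists ((G1, G2) :: l'); rewrite qE qsum_cons el e1 e2 /=; ring.
Qed.

Lemma even_poly_sum (I : Type) (r : seq I) (P : pred I) (F : I -> {poly {poly R}}) :
  even_poly (\sum_(i <- r | P i) F i) = \sum_(i <- r | P i) even_poly (F i).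
Proof.
by elim/big_rec2: _ => [|i ? ? _ <-]; rewrite ?even_polyD // even_polyC.
Qed.

Lemma local_certificate (f : {poly {poly R}}) (w : {poly R}) (eps c d : R) D :
  c < d -> 0 < eps -> w != 0 -> (size f <= D.+1)%N ->
  (forall x y, c <= x <= d -> 0 <= y ->
     eps * w.[x] ^+ 2 * (\sum_(i < D.+1) y ^+ i) <= ev2 f x y) ->
  exists h l0 l1, h != 0 /\
    h%:P ^+ 2 * f = qsum l0 + (itv_poly c d)%:P * qsum l1.
Proof.
move=> cd eps0 w0 sf hf.
pose F := f \Po 'X^2; pose v := eps *: w ^+ 2.
have v0 : v != 0 by rewrite scaler_eq0 gt_eqF //= expf_neq0.
have vE x : v.[x] = eps * w.[x] ^+ 2 by rewrite !hornerE.
have v_ge0 x : 0 <= v.[x] by rewrite vE mulr_ge0 ?sqr_ge0 // ltW.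
have sum_ge y j : 0 <= y -> (j < D.+1)%N -> y ^+ j <= \sum_(i < D.+1) y ^+ i.
  move=> y0 jD; rewrite (bigD1 (Ordinal jD)) //= lerDl.
  by apply: sumr_ge0 => i _; rewrite exprn_ge0.
have FE x z : ev2 F x z = ev2 f x (z ^+ 2) by rewrite !ev2E ev_comp evXn evY.
have sF : (size F <= D.*2.+1)%N.
  apply: leq_trans (size_comp_poly_leq _ _) _; rewrite size_polyXn ltnS -muln2.
  by rewrite leq_mul2r /= -subn1 leq_subLR add1n.
have h1 (a b : R) : c <= a <= d -> 0 <= v.[a] <= ev2 F a b.
  move=> ad; rewrite v_ge0 FE; apply: le_trans (hf _ _ ad (sqr_ge0 b)).
  rewrite -vE ler_peMr // -(expr0 (b ^+ 2)).
  by apply: (sum_ge _ 0%N) => //; apply: sqr_ge0.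
pose rF := \poly_(i < D.*2.+1) F`_(D.*2 - i).
have h2' (a b : R) : c <= a <= d -> b != 0 -> v.[a] <= ev2 rF a b.
  move=> ad b0; have bi0 : b^-1 != 0 by rewrite invr_eq0.
  have := ev_reverse idfun a bi0 sF; rewrite -!ev2E invrK -/rF => e.
  have -> : ev2 rF a b = (b ^+ 2) ^+ D * ev2 f a (b^-1 ^+ 2).
    by rewrite -FE e mulrA -exprM mul2n -exprMn divff // expr1n mul1r.
  have b2 : 0 < (b ^+ 2) ^+ D by rewrite exprn_gt0 // exprn_even_gt0.
  rewrite -ler_pdivrMl //; apply: le_trans (hf _ _ ad (sqr_ge0 _)).
  rewrite -vE mulrC ler_wpM2l // -!exprVn.
  by apply: (sum_ge _ D) => //; apply: sqr_ge0.
have h2 (a b : R) : c <= a <= d -> v.[a] <= ev2 rF a b.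
  move=> ad; have [->|] := eqVneq b 0; last exact: h2'.
  rewrite -fibreE; apply: (poly_lim0 ltr01) => s /andP[s0 _].
  by rewrite fibreE h2' ?gt_eqF.
have [q q0 [s0 [s1 [[l0 ->] [l1 ->] e]]]] := rational_certificate cd v0 sF h1 h2.
(* The certificate becomes a diagonal form with weights 1 and [itv_poly c d]. Both are positive
   inside the interval, which makes the form anisotropic. *)
pose l : seq ({poly R} * {poly {poly R}}) :=
  [seq (1, g) | g <- l0] ++ [seq (itv_poly c d, g) | g <- l1].
pose W (i : 'I_(size l)) := (nth (0, 0) l i).1.
pose G (i : 'I_(size l)) := (nth (0, 0) l i).2.
have sumE (k : {poly {poly R}} -> {poly {poly R}}) :
    \sum_i (W i)%:P * k (G i) =
    \sum_(g <- l0) k g + (itv_poly c d)%:P * \sum_(g <- l1) k g.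
  transitivity (\sum_(p <- l) p.1%:P * k p.2).
    by rewrite (big_nth (0, 0)) big_mkord.
  rewrite big_cat !big_map /= mulr_sumr; congr (_ + _).
  by apply: eq_bigr => g _; rewrite mul1r.
have Wpos i x : c < x < d -> 0 < (W i).[x].
  move=> /andP[cx xd]; rewrite /W.
  have : nth (0, 0) l i \in l by apply: mem_nth.
  rewrite mem_cat => /orP[] /mapP[g _ ->] /=; first by rewrite hornerC.
  by rewrite itv_polyE mulr_gt0 // subr_gt0.
have an (r : 'I_(size l) -> {poly {poly R}}) :
    \sum_i (W i)%:P * r i ^+ 2 = 0 -> forall i, r i = 0.
  move=> r0 i; apply: (bipoly_vanish cd ltr01) => x y xcd _; apply/eqP.
  have ge j : 0 <= (W j).[x] * ev2 (r j) x y ^+ 2.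
    by apply: mulr_ge0; [apply/ltW/Wpos|apply: sqr_ge0].
  have : ev2 (\sum_i (W i)%:P * r i ^+ 2) x y =
      \sum_j (W j).[x] * ev2 (r j) x y ^+ 2.
    rewrite ev2E ev_sum; apply: eq_bigr => j _.
    by rewrite evM evXn -!ev2E {1}/ev2 hornerC.
  rewrite r0 ev2E raddf0 => /esym/eqP; rewrite psumr_eq0 // => /allP /(_ i).
  rewrite mem_index_enum.
  by move=> /(_ isT) /=; rewrite mulf_eq0 sqrf_eq0 gt_eqF // Wpos.
have e' : q ^+ 2 * F = \sum_i (W i)%:P * G i ^+ 2.
  by rewrite e; apply: esym; apply: (sumE (fun g => g ^+ 2)).
have [h [G' h0 eh]] := cassels_pfister an q0 e'.
have {}eh : h%:P ^+ 2 * f =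
    \sum_i (W i)%:P * (even_poly (G' i) ^+ 2 + 'X * odd_poly (G' i) ^+ 2).
  (* Since [h] is free of z, taking even parts in z returns from [F] to [f]. *)
  have <- : even_poly (h%:P ^+ 2 * F) = h%:P ^+ 2 * f.
    by rewrite -rmorphXn /= mul_polyC even_polyZ even_poly_comp mul_polyC.
  rewrite eh even_poly_sum; apply: eq_bigr => i _.
  by rewrite mul_polyC even_polyZ even_poly_sqr -mul_polyC.
pose EO i := (even_poly (G' i), odd_poly (G' i)).
pose inl (i : 'I_(size l)) := (i < size l0)%N.
exists h, [seq EO i | i <- enum 'I_(size l) & inl i],
  [seq EO i | i <- enum 'I_(size l) & ~~ inl i]; split => //.
rewrite eh (bigID inl) /= /qsum !big_map !big_filter !big_enum_cond /= mulr_sumr.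
congr (_ + _); apply: eq_bigr => i hi.
  rewrite /W nth_cat size_map -/(inl i) hi (nth_map 0) //= mul1r //.
rewrite /W nth_cat size_map -/(inl i) (negPf hi) (nth_map 0) //.
have sl : (size l0 + size l1 = size l)%N by rewrite size_cat !size_map.
by rewrite ltn_subLR ?sl ?ltn_ord // leqNgt.
Qed.

End QuadSums.

(** * Removing zeros of the denominator and bounding degrees *)

Section ClearDenominators.
Variable R : realType.
Implicit Types (f : {poly {poly R}}) (c d x y : R).

(** If [h] vanishes at [x0], both nonnegative summands vanish on that fibre, so [qsum_dvd] cancels a
    square of ['X - x0%:P] throughout. *)
Lemma certificate_at f (h : {poly R}) l0 l1 c d x0 : c < d -> c <= x0 <= d -> h != 0 ->
  h%:P ^+ 2 * f = qsum l0 + (itv_poly c d)%:P * qsum l1 ->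
  exists h' l0' l1', h'.[x0] != 0 /\
    h'%:P ^+ 2 * f = qsum l0' + (itv_poly c d)%:P * qsum l1'.
Proof.
move=> cd /andP[cx xd].
have [n] := ubnP (size h); elim: n h l0 l1 => // n IH h l0 l1 sh h0 e.
have [hx|hx] := eqVneq h.[x0] 0; last by exists h, l0, l1.
have /factor_theorem[g hE] : root h x0 by apply/eqP.
set t := 'X - x0%:P in hE.
have tx : t.[x0] = 0 by rewrite !hornerE subrr.
have t0 : t%:P != 0 :> {poly {poly R}} by rewrite polyC_eq0 polyXsubC_eq0.
have g0 : g != 0 by apply: contraNneq h0; rewrite hE => ->; rewrite mul0r.
have ev2C (p : {poly R}) y : ev2 p%:P x0 y = p.[x0] by rewrite /ev2 hornerC.
suff [m0 [m1 [e0 e1]]] : exists m0 m1,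
    qsum l0 = t%:P ^+ 2 * qsum m0 /\ qsum l1 = t%:P ^+ 2 * qsum m1.
  apply: (IH g m0 m1) => //.
    by move: sh; rewrite hE size_Mmonic ?monicXsubC // size_XsubC addn2.
  apply: (mulfI (_ : t%:P ^+ 2 != 0)); first exact: expf_neq0.
  move: e; rewrite e0 e1 hE polyCM => e.
  have -> : t%:P ^+ 2 * (g%:P ^+ 2 * f) = (g%:P * t%:P) ^+ 2 * f by ring.
  by rewrite e; ring.
have tot y : ev2 (qsum l0) x0 y + (x0 - c) * (d - x0) * ev2 (qsum l1) x0 y = 0.
  have := congr1 (fun F => ev2 F x0 y) e.
  rewrite !ev2E evD evM evXn (evM _ _ _ _ (qsum l1)) -!ev2E !ev2C itv_polyE hx.
  by rewrite expr0n mul0r => <-.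
have ge0 : 0 <= (x0 - c) * (d - x0) by rewrite mulr_ge0 // subr_ge0.
have [m0 e0] : exists m0, qsum l0 = t%:P ^+ 2 * qsum m0.
  apply: qsum_dvd => y /andP[/ltW y0 _]; have := tot y.
  have := qsum_ge0 l0 x0 y0.
  have := mulr_ge0 ge0 (qsum_ge0 l1 x0 y0); lra.
exists m0; suff [m1 e1] : exists m1, qsum l1 = t%:P ^+ 2 * qsum m1 by exists m1.
apply: qsum_dvd => y yy.
(* At an endpoint the weight itself has a simple zero and hides the second sum; one factor [t] must
   be cancelled before that sum is seen to vanish. *)
have [n0|n0] := eqVneq ((x0 - c) * (d - x0)) 0; last first.
  have := tot y; rewrite e0 ev2E evM evXn -!ev2E ev2C tx expr0n mul0r add0r.
  by move/eqP; rewrite mulf_eq0 (negPf n0) => /eqP.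
have [nu nx nE] : exists2 nu, nu.[x0] != 0 & itv_poly c d = t * nu.
  move/eqP: n0; rewrite mulf_eq0 !subr_eq0 => /orP[]/eqP xe.
    exists (d%:P - 'X); last by rewrite /itv_poly /t xe.
    by rewrite !hornerE subr_eq0 xe gt_eqF.
  exists (c%:P - 'X); last by rewrite /itv_poly /t -xe; ring.
  by rewrite !hornerE subr_eq0 -xe lt_eqF.
have : t%:P * (g%:P ^+ 2 * f) = t%:P * qsum m0 + nu%:P * qsum l1.
  apply: (mulfI t0); move: e; rewrite e0 hE nE !polyCM => e.
  have -> : t%:P * (t%:P * (g%:P ^+ 2 * f)) = (g%:P * t%:P) ^+ 2 * f by ring.
  by rewrite e; ring.
move=> /(congr1 (fun F => ev2 F x0 y)).
rewrite !ev2E evD !(evM _ _ _ t%:P) (evM _ _ _ nu%:P) -!ev2E !ev2C tx !mul0r add0r.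
by move=> /esym/eqP; rewrite mulf_eq0 (negPf nx) => /eqP.
Qed.

Lemma coef_top_ge0 (p : {poly R}) n : (size p <= n.+1)%N ->
  (forall y, 0 <= y -> 0 <= p.[y]) -> 0 <= p`_n.
Proof.
move=> sp h; rewrite leNgt; apply/negP => pn.
have sE : size p = n.+1.
  apply/eqP; rewrite eqn_leq sp ltnNge; apply: contraTN pn => le.
  by rewrite nth_default // ltxx.
have [|B hB] := @poly_pinfty_gt_lc _ (- p).
  by rewrite lead_coefN lead_coefE sE oppr_gt0.
have := hB (Num.max B 0); rewrite le_max lexx => /(_ isT).
rewrite hornerN lead_coefN lead_coefE sE /=.
have := h (Num.max B 0); rewrite le_max lexx orbT => /(_ isT); lra.
Qed.

(** Top coefficients in y are nonnegative on [[c, d]] and cannot cancel. Hence the summands of a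
    certificate have y-degree at most that of [f]. *)
Lemma size_add_nonneg (F G : {poly {poly R}}) (c d : R) : c < d ->
  (forall x y, c <= x <= d -> 0 <= y -> 0 <= ev2 F x y) ->
  (forall x y, c <= x <= d -> 0 <= y -> 0 <= ev2 G x y) ->
  (size F <= size (F + G)%R)%N.
Proof.
move=> cd hF hG; rewrite leqNgt; apply/negP => lt.
have F0 : F != 0 by rewrite -size_poly_gt0; apply: leq_trans lt.
set n := (size F).-1; have sF : size F = n.+1 by rewrite prednK // size_poly_gt0.
have sFG : (size (F + G)%R <= n)%N by move: lt; rewrite sF.
have sG : (size G <= n.+1)%N.
  rewrite -[G](addKr F) addrC; apply: leq_trans (size_polyD _ _) _.
  by rewrite geq_max size_polyN sF leqnn andbT ltnW.
have e : G`_n = - F`_n.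
  by apply/eqP; rewrite -addr_eq0 addrC -coefD nth_default.
suff : F`_n = 0.
  by move/eqP; rewrite -[F`_n]/(lead_coef F) lead_coef_eq0 (negPf F0).
apply: (poly_vanish cd) => x /andP[cx xd].
have xI : c <= x <= d by rewrite !ltW.
have top (H : {poly {poly R}}) : (size H <= n.+1)%N ->
    (forall x y, c <= x <= d -> 0 <= y -> 0 <= ev2 H x y) -> 0 <= (H`_n).[x].
  move=> sH hH; rewrite -coef_fibre; apply: coef_top_ge0.
    by apply: leq_trans (size_poly _ _) sH.
  by move=> y y0; rewrite fibreE hH.
have := top F; rewrite sF leqnn => /(_ isT hF).
have := top G sG hG; rewrite e hornerN; lra.
Qed.

End ClearDenominators.

(** * Univariate cones *)

(** Closure properties only, so that the arguments also apply to the pull-back of a preordering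
    along a ring morphism. *)
Definition is_cone (A : comNzRingType) (C : A -> Prop) :=
  [/\ forall x y, C x -> C y -> C (x + y), forall x y, C x -> C y -> C (x * y)
    & forall x, C (x ^+ 2)].

Section UnivariateCones.
Variable R : realType.
Implicit Types (p q : {poly R}) (C : {poly R} -> Prop).

Lemma complex_factor p (a b : R) : b != 0 ->
  root (map_poly (real_complex R) p) (a +i* b)%C ->
  exists q, p = q * (('X - a%:P) ^+ 2 + (b ^+ 2)%:P).
Proof.
move=> b0; set z := (_ +i* _)%C => rz.
set m := ('X - a%:P) ^+ 2 + (b ^+ 2)%:P.
have m_monic : m \is monic.
  rewrite /m monicE lead_coefDl; first by rewrite -monicE monic_exp ?monicXsubC.
  by rewrite size_exp_XsubC (leq_ltn_trans (size_polyC_leq1 _)).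
have sm : size m = 3%N.
  rewrite /m size_polyDl; first by rewrite size_exp_XsubC.
  by rewrite size_exp_XsubC (leq_ltn_trans (size_polyC_leq1 _)).
exists (p %/ m).
have zE : z = real_complex R a + real_complex R b * 'i%C.
  by simpc.
have mz : (map_poly (real_complex R) m).[z] = 0.
  rewrite /m rmorphD rmorphXn rmorphB /= map_polyX !map_polyC /= !hornerE.
  rewrite {1}zE addrAC subrr add0r exprMn sqr_i rmorphXn /=.
  by rewrite mulrN1 addrC subrr.
set r := p %% m.
have sr : (size r <= 2)%N by rewrite -ltnS -sm ltn_modp -size_poly_gt0 sm.
have pE : p = p %/ m * m + r by exact: divp_eq.
have rE : r = r`_1 *: 'X + (r`_0)%:P.
  apply/polyP => i; rewrite coefD coefZ coefX coefC.
  case: i => [|[|i]]; rewrite ?mulr0 ?mulr1 ?add0r ?addr0 //=.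
  by rewrite nth_default // (leq_trans sr).
have rz0 : (map_poly (real_complex R) r).[z] = 0.
  move: rz; rewrite rootE {1}pE rmorphD rmorphM /= hornerD hornerM mz mulr0 add0r.
  by move/eqP.
have : real_complex R r`_1 * z + real_complex R r`_0 = 0.
  rewrite -rz0 [in RHS]rE rmorphD /= map_polyZ map_polyX map_polyC /=.
  by rewrite !hornerE.
rewrite zE => /eqP; rewrite eq_complex /= !(mul0r, mulr0, subr0, addr0, add0r, mulr1).
move=> /andP[/eqP e0]; rewrite mulf_eq0 (negPf b0) orbF => /eqP r1.
have r0 : r`_0 = 0 by move: e0; rewrite r1 mul0r add0r.
have {}r0 : r = 0 by rewrite rE r1 scale0r add0r r0.
by rewrite {1}pE r0 addr0.
Qed.

Lemma cone_const C c : is_cone C -> 0 <= c -> C c%:P.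
Proof. by move=> [_ _ Csq] c0; rewrite -(sqr_sqrtr c0) rmorphXn; apply: Csq. Qed.

(** A nonreal root [a + i b] splits off [(X - a)^2 + b^2], a positive sum of two squares; a
    nonnegative constant is left in the end. *)
Lemma rootless_cone C p y : is_cone C -> (forall x, ~~ root p x) -> 0 <= p.[y] -> C p.
Proof.
move=> cC; have [CD CM Csq] := cC.
have [n] := ubnP (size p); elim: n p => // n IH p sp nr py.
have [/size1_polyC pC|sp1] := leqP (size p) 1.
  have py0 : 0 <= p`_0 by move: py; rewrite {1}pC hornerC.
  by rewrite pC; apply: cone_const.
have [[a b] rz] : exists z, root (map_poly (real_complex R) p) z.
  by apply/closed_rootP; rewrite size_map_poly neq_ltn sp1 orbT.
have b0 : b != 0.
  apply: contraNneq (nr a) => b0; move: rz; rewrite b0.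
  rewrite -[(a +i* 0)%C]/(real_complex R a) rootE horner_map fmorph_eq0.
  by rewrite rootE.
have [q pE] := complex_factor b0 rz.
set m := (_ + _) in pE.
have mpos x : 0 < m.[x].
  rewrite /m !hornerE; have := sqr_ge0 (x - a).
  have : 0 < b ^+ 2 by rewrite exprn_even_gt0.
  lra.
have Cm : C m by apply: CD; rewrite ?rmorphXn; apply: Csq.
rewrite pE; apply: CM => //; apply: IH.
- have m0 : m != 0 by apply: contraTneq (mpos 0) => ->; rewrite horner0 ltxx.
  have q0 : q != 0.
    by apply: contraNneq (nr 0) => q0; rewrite pE q0 mul0r root0.
  have sm : (1 < size m)%N.
    rewrite ltnNge; apply/negP => /size1_polyC mC.
    move: (congr1 (fun m => m.[a + 1] - m.[a]) mC); rewrite !hornerE /m; lra.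
  move: sp; rewrite pE size_mul //; move: sm; move: (size _) (size _); lia.
- by move=> x; apply: contra (nr x); rewrite pE rootM => ->.
by move: py; rewrite pE hornerM pmulr_lge0.
Qed.

Lemma poly_right_limit p x d e : 0 < d ->
  (forall s, 0 < s < d -> e <= p.[x + s]) -> e <= p.[x].
Proof.
move=> d0 h; have := @poly_lim0 _ (p \Po (x%:P + 'X)) d e d0.
rewrite horner_comp !hornerE; apply => s sd.
by rewrite horner_comp !hornerE h.
Qed.

Lemma poly_left_limit p x d e : 0 < d ->
  (forall s, 0 < s < d -> e <= p.[x - s]) -> e <= p.[x].
Proof.
move=> d0 h; have := @poly_lim0 _ (p \Po (x%:P - 'X)) d e d0.
rewrite horner_comp !hornerE subr0; apply => s sd.
by rewrite horner_comp !hornerE h.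
Qed.

(* Off the finitely many zeros of [p] divide, at a zero pass to the limit. *)
Lemma sqr_mul_ge0 p q : p != 0 ->
  (forall y, 0 <= y -> 0 <= (p ^+ 2 * q).[y]) -> forall y, 0 <= y -> 0 <= q.[y].
Proof.
move=> p0 h y y0; have [m [r]] := multiplicity_XsubC (p \Po (y%:P + 'X)) 0.
have -> /= : p \Po (y%:P + 'X) != 0.
  rewrite -size_poly_eq0 size_comp_poly2 ?size_poly_eq0 //.
  by rewrite addrC -[y%:P]opprK -polyCN size_XsubC.
rewrite rootE => r0 pE.
have rp : 0 < `|r.[0]| by rewrite normr_gt0.
have [d d0 near] := poly_near0 r rp.
apply: (@poly_right_limit _ _ d) => // s /andP[s0 sd].
have := near s; rewrite gtr0_norm // => /(_ sd) rs.
have rs0 : r.[s] != 0.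
  by apply: contraTneq rs => ->; rewrite sub0r normrN ltxx.
have ps : p.[y + s] != 0.
  have := congr1 (horner ^~ s) pE; rewrite horner_comp !hornerE subr0 => ->.
  by rewrite mulf_neq0 // expf_neq0 // gt_eqF.
have := h (y + s) (addr_ge0 y0 (ltW s0)).
by rewrite hornerM horner_exp pmulr_rge0 // exprn_even_gt0.
Qed.

(** A root [r <= 0] contributes [X + (- r)], which is in [C]. At a root [r > 0] the sign cannot
    change, so [(X - r)^2] splits off. *)
Lemma halfline_cone C p : is_cone C -> C 'X ->
  (forall y, 0 <= y -> 0 <= p.[y]) -> C p.
Proof.
move=> cC CX; have [CD CM Csq] := cC.
have [n] := ubnP (size p); elim: n p => // n IH p sp h.
have [->|p0] := eqVneq p 0.
  by rewrite -(mulr0 (0 : {poly R})) -expr2; apply: Csq.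
have [[r rp]|nr] := pselect (exists r, root p r); last first.
  apply: (@rootless_cone _ _ 0) => //; last exact: h.
  by move=> x; apply/negP => rx; apply: nr; exists x.
have /factor_theorem[k kE] := rp.
have k0 : k != 0 by apply: contraNneq p0; rewrite kE => ->; rewrite mul0r.
have sk : (size k < n)%N.
  by move: sp; rewrite kE size_Mmonic ?monicXsubC // size_XsubC addn2.
have [r0|r0] := leP r 0.
  rewrite kE; apply: (CM).
    apply: IH => // y; rewrite le0r => /orP[/eqP->|y0]; last first.
      have := h y (ltW y0); rewrite kE !hornerE pmulr_lge0 //; lra.
    apply: (poly_right_limit ltr01) => s /andP[s0 _]; rewrite add0r.
    have := h s (ltW s0); rewrite kE !hornerE pmulr_lge0 //; lra.
  by rewrite -polyCN; apply: CD => //; apply: cone_const; rewrite ?oppr_ge0.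
have kr : k.[r] = 0.
  apply/eqP; rewrite eq_le; apply/andP; split; last first.
    apply: (poly_right_limit ltr01) => s /andP[s0 _].
    have := h (r + s); rewrite kE !hornerE addrAC subrr add0r pmulr_lge0 //.
    by apply; apply/ltW/addr_gt0.
  rewrite -oppr_ge0 -hornerN; apply: (poly_left_limit r0) => s /andP[s0 sr].
  have := h (r - s); rewrite kE !hornerE addrAC subrr add0r mulrN -mulNr.
  by rewrite pmulr_lge0 //; apply; rewrite subr_ge0 ltW.
have /factor_theorem[g gE] : root k r by apply/eqP.
have pE : p = ('X - r%:P) ^+ 2 * g by rewrite kE gE expr2 mulrC mulrA mulrAC -mulrA mulrC.
rewrite pE; apply: CM; first exact: Csq.
apply: IH.
  move: sk; rewrite gE size_Mmonic ?monicXsubC //.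
    by rewrite size_XsubC addn2 => /ltnW.
  by apply: contraNneq k0; rewrite gE => ->; rewrite mul0r.
apply: (@sqr_mul_ge0 ('X - r%:P)); first by rewrite polyXsubC_eq0.
by rewrite -pE.
Qed.

End UnivariateCones.

(** * Inverses, square roots and quotients modulo powers of x - x0 *)

Section Jets.
Variable R : realType.
Implicit Types (v h : {poly R}) (x : R).

Lemma dvdp_XsubC_exp_coprime h x n : h.[x] != 0 -> coprimep (('X - x%:P) ^+ n) h.
Proof.
by move=> hx; apply: coprimep_expl; rewrite coprimep_sym coprimep_XsubC rootE.
Qed.

Lemma inverse_mod h x n : h.[x] != 0 ->
  exists k, ('X - x%:P) ^+ n %| k * h - 1.
Proof.
move=> /(dvdp_XsubC_exp_coprime n) /Bezout_eq1_coprimepP[[u k] /= e].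
by exists k; rewrite -e opprD addrCA subrr addr0 dvdpNr dvdp_mulIr.
Qed.

(** Newton iteration: as [e] does not vanish at [x], the correction [r.[x] / (2 e.[x])] removes the
    lowest term of the error. *)
Lemma sqrt_mod v x n : 0 < v.[x] -> exists e, ('X - x%:P) ^+ n %| v - e ^+ 2.
Proof.
move=> vx; suff [e [ex]] : exists e, e.[x] != 0 /\ ('X - x%:P) ^+ n.+1 %| v - e ^+ 2.
  by move=> h; exists e; apply: dvdp_trans h; rewrite dvdp_exp2l.
elim: n => [|n [e [ex]]].
  exists (Num.sqrt v.[x])%:P; rewrite hornerC gt_eqF ?sqrtr_gt0 //; split => //.
  by rewrite expr1 dvdp_XsubCl rootE !hornerE sqr_sqrtr ?subrr // ltW.
set t := 'X - x%:P; rewrite dvdp_eq; set r := _ %/ _ => /eqP e2.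
have tx : t.[x] = 0 by rewrite !hornerE subrr.
pose s := r.[x] / (2%:R * e.[x]).
have t1x : (t ^+ n.+1).[x] = 0 by rewrite horner_exp tx expr0n.
exists (e + t ^+ n.+1 * s%:P); split.
  by rewrite hornerD hornerM t1x mul0r addr0.
have -> : v - (e + t ^+ n.+1 * s%:P) ^+ 2 =
    t ^+ n.+1 * (r - 2%:R * e * s%:P - t ^+ n.+1 * s%:P ^+ 2).
  rewrite [RHS](_ : _ = r * t ^+ n.+1 - 2%:R * e * (t ^+ n.+1 * s%:P) -
    (t ^+ n.+1 * s%:P) ^+ 2); last by ring.
  by rewrite -e2; ring.
rewrite exprSr; apply: dvdp_mul => //; rewrite dvdp_XsubCl rootE.
rewrite 2!hornerD 2!hornerN (hornerM (t ^+ _)) t1x mul0r subr0 2!hornerM.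
rewrite !hornerC hornerMn hornerC /s; apply/eqP; field.
by rewrite ex.
Qed.

(** Since v1 / v2 = v1 v2 / v2^2, a root of the product and an inverse of [v2] suffice. *)
Lemma ratio_mod v1 v2 x n : 0 < v1.[x] * v2.[x] ->
  exists e, ('X - x%:P) ^+ n %| v1 - v2 * e ^+ 2.
Proof.
move=> v12; have v2x : v2.[x] != 0 by apply: contraTneq v12 => ->; rewrite mulr0 ltxx.
have [k hk] := inverse_mod n v2x.
have [|e he] := @sqrt_mod (v1 * v2) x n; first by rewrite hornerM.
exists (k * e).
have -> : v1 - v2 * (k * e) ^+ 2 =
    v2 * k ^+ 2 * (v1 * v2 - e ^+ 2) - (k * v2 - 1) * (v1 * (k * v2 + 1)) by ring.
by apply: dvdp_sub; [apply: dvdp_mull|apply: dvdp_mulr].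
Qed.

End Jets.

(** * Univariate polynomials positive on a union of intervals *)

Section NaturalGenerators.
Variables (R : realType) (k : nat) (a b : nat -> R).
Hypotheses (k0 : (0 < k)%N) (ab : forall i, (i < k)%N -> a i <= b i)
  (ba : forall i, (i.+1 < k)%N -> b i < a i.+1).

Lemma endpoints_mono i j : (i <= j)%N -> (j < k)%N -> b i <= b j /\ a i <= a j.
Proof.
move=> ij; rewrite -(subnKC ij); elim: (j - i)%N => [|n IH]; first by rewrite addn0.
rewrite addnS => lt; have [h1 h2] := IH (ltnW lt).
have h3 := ba lt; have h4 := ab lt; have h5 := ab (ltnW lt).
by split; lra.
Qed.

Lemma gap_cases x : ~ in_U k a b x ->
  [\/ x < a 0%N, b k.-1 < x | exists2 i, (i.+1 < k)%N & b i < x < a i.+1].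
Proof.
move=> xU; have [xa|ax] := ltP x (a 0%N); first by constructor 1.
have [bx|xb] := ltP (b k.-1) x; [by constructor 2|constructor 3].
have ex : exists i, x <= b i by exists k.-1.
case: (ex_minnP ex) => i xi mini.
have ik : (i < k)%N by rewrite -(prednK k0) ltnS; apply: mini.
have xai : x < a i.
  by rewrite ltNge; apply/negP => h; apply: xU; exists i; rewrite ?h.
case: i => [|i] in xi mini ik xai *; first by move: xai; rewrite ltNge ax.
exists i => //; rewrite xai andbT ltNge; apply/negP => /mini.
by rewrite ltnn.
Qed.

Lemma gap_sides i x : (i.+1 < k)%N -> in_U k a b x -> x <= b i \/ a i.+1 <= x.
Proof.
move=> ik [j jk /andP[aj jb]]; have [ji|ij] := leqP j i.
  by left; have [h _] := endpoints_mono ji (ltnW ik); apply: le_trans h.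
by right; have [_ h] := endpoints_mono ij jk; apply: le_trans h _.
Qed.

Variable C : {poly R} -> Prop.
Hypotheses (cC : is_cone C) (Cl : C ('X - (a 0%N)%:P)) (Cr : C ((b k.-1)%:P - 'X))
  (Cg : forall i, (i.+1 < k)%N -> C (('X - (a i.+1)%:P) * ('X - (b i)%:P))).

(** Starting from the generator with roots at both ends of the gap, one root at a time is moved
    towards the other: if w lies between u and v, then (X - w)(X - v) is a convex combination of (X
    - u)(X - v) and (X - v)^2. *)
Lemma gap_pair_cone i r s : (i.+1 < k)%N -> b i <= r <= a i.+1 -> b i <= s <= a i.+1 ->
  C (('X - r%:P) * ('X - s%:P)).
Proof.
move=> ik; have [CD CM Csq] := cC; have bai := ba ik.
have conv u v w l : 0 <= l <= 1 -> w = l * u + (1 - l) * v ->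
    C (('X - u%:P) * ('X - v%:P)) -> C (('X - w%:P) * ('X - v%:P)).
  move=> /andP[l0 l1] -> Cuv.
  have -> : ('X - (l * u + (1 - l) * v)%:P) * ('X - v%:P) =
      l%:P * (('X - u%:P) * ('X - v%:P)) + (1 - l)%:P * ('X - v%:P) ^+ 2.
    by rewrite !(polyCD, polyCM, polyCN, polyC1); ring.
  apply: CD; apply: CM => //; apply: cone_const => //; by rewrite subr_ge0.
wlog rs : r s / r <= s.
  move=> W hr hs; have [/W|/ltW sr] := leP r s; first exact.
  by rewrite mulrC; apply: W.
move=> /andP[br ra] /andP[bs sa].
have C1 : C (('X - s%:P) * ('X - (b i)%:P)).
  apply: (conv (a i.+1) (b i) s ((s - b i) / (a i.+1 - b i))); last exact: Cg.
    by rewrite divr_ge0 ?ler_pdivrMr ?mul1r; lra.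
  by field; lra.
have [rs'|sr] := ltP r s; last first.
  by have -> : r = s by [lra]; rewrite -expr2; apply: Csq.
apply: (conv (b i) s r ((s - r) / (s - b i))); last by rewrite mulrC.
  by rewrite divr_ge0 ?ler_pdivrMr ?mul1r; lra.
by field; lra.
Qed.

(** A root left or right of U gives a linear factor that is an end generator plus a constant. For a
    root in a gap, the cofactor has opposite signs at the ends of the gap, hence a second root
    there, and the quotient by the pair stays positive on U. *)
Lemma natural_pos p : (forall x, in_U k a b x -> 0 < p.[x]) -> C p.
Proof.
have [CD CM Csq] := cC.
have U0 : in_U k a b (a 0%N) by exists 0%N; rewrite ?lexx ?ab.
have [n] := ubnP (size p); elim/ltn_ind: n p => n IH p sp pU.
have p0 : p != 0 by apply: contraTneq (pU _ U0) => ->; rewrite horner0 ltxx.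
have [[r rp]|nr] := pselect (exists r, root p r); last first.
  apply: (@rootless_cone _ _ _ (a 0%N)) => //; last exact/ltW/pU.
  by move=> x; apply/negP => rx; apply: nr; exists x.
have rU : ~ in_U k a b r by move=> /pU; move: rp; rewrite rootE => /eqP->; rewrite ltxx.
have /factor_theorem[g gE] := rp.
have sg : (size g < size p)%N.
  rewrite gE size_Mmonic ?monicXsubC ?size_XsubC ?addn2 //=.
  by apply: contraNneq p0; rewrite gE => ->; rewrite mul0r.
have {}IH (q : {poly R}) : (size q < size p)%N -> (forall x, in_U k a b x -> 0 < q.[x]) -> C q.
  by move=> sq; apply: (IH (size p)).
have a0x x : in_U k a b x -> a 0%N <= x.
  move=> [j jk /andP[aj _]]; apply: le_trans aj.
  by have [] := endpoints_mono (leq0n j) jk.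
have xbk x : in_U k a b x -> x <= b k.-1.
  move=> [j jk /andP[_ jb]]; apply: (le_trans jb).
  have jk' : (j <= k.-1)%N by rewrite -ltnS prednK.
  by have [] := endpoints_mono jk' _; rewrite ?prednK.
case: (gap_cases rU) => [ra|br|[i ik /andP[br ra]]].
- rewrite gE; apply: CM; last first.
    have -> : 'X - r%:P = ('X - (a 0%N)%:P) + (a 0%N - r)%:P.
      by rewrite polyCB; ring.
    by apply: CD => //; apply: cone_const => //; rewrite subr_ge0 ltW.
  apply: IH => // x xU; have := pU x xU; rewrite gE !hornerE pmulr_lgt0 //.
  by have := a0x x xU; lra.
- have -> : p = (- g) * (((b k.-1)%:P - 'X) + (r - b k.-1)%:P).
    by rewrite gE polyCB; ring.
  apply: CM.
    apply: IH; first by rewrite size_polyN.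
    move=> x xU; have := pU x xU; rewrite gE !hornerE.
    by have := xbk x xU; nra.
  by apply: CD => //; apply: cone_const => //; rewrite subr_ge0 ltW.
have Ub : in_U k a b (b i) by exists i; rewrite ?lexx ?andbT ?ab // ltnW.
have Ua : in_U k a b (a i.+1) by exists i.+1; rewrite ?lexx ?ab.
have gb : g.[b i] < 0.
  by have := pU _ Ub; rewrite gE !hornerE nmulr_lgt0 //; lra.
have ga : 0 < g.[a i.+1].
  by have := pU _ Ua; rewrite gE !hornerE pmulr_lgt0 //; lra.
have [||s] := @poly_ivtoo _ g (b i) (a i.+1); [exact/ltW/ba|by rewrite nmulr_rlt0|].
rewrite in_itv /= => /andP[bs sa] /factor_theorem[q qE].
have pE : p = q * (('X - r%:P) * ('X - s%:P)) by rewrite gE qE; ring.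
rewrite pE; apply: CM; last by apply: (gap_pair_cone ik); rewrite !ltW.
apply: IH.
  apply: leq_ltn_trans sg; rewrite qE size_Mmonic ?monicXsubC //.
    by rewrite size_XsubC addn2 leqnSn.
  by apply: contraNneq p0 => q0; rewrite pE q0 mul0r.
move=> x xU; have := pU x xU; rewrite pE (hornerM q) pmulr_lgt0 // !hornerE.
have bai := ba ik; case: (gap_sides ik xU) => h.
  have h1 : x - r < 0 by lra.
  have h2 : x - s < 0 by lra.
  by rewrite nmulr_rgt0.
have h1 : 0 < x - r by lra.
have h2 : 0 < x - s by lra.
by rewrite mulr_gt0.
Qed.

End NaturalGenerators.

(** * Gluing local certificates *)

(* De Casteljau's recursion for the Bernstein sum of [phi 0, ..., phi n] at [X]. *)
Fixpoint bernstein (A : comNzRingType) (X : A) (n : nat) (phi : nat -> A) : A :=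
  if n is n'.+1 then
    X * bernstein X n' (fun j => phi j.+1) + (1 - X) * bernstein X n' phi
  else phi 0%N.

(** * Bernstein sums and their second moment *)

Section Bernstein.
Variables (R : realFieldType) (x : R).
Hypothesis x01 : 0 <= x <= 1.

Lemma bernstein_le n phi psi : (forall j, phi j <= psi j) ->
  bernstein x n phi <= bernstein x n psi.
Proof.
case/andP: x01 => x0 x1; elim: n phi psi => [|n IH] phi psi h /=; first exact: h.
by apply: lerD; apply: ler_wpM2l; rewrite ?subr_ge0 //; apply: IH.
Qed.

Lemma bernstein_affine n (al be : R) phi :
  bernstein x n (fun j => al + be * phi j) = al + be * bernstein x n phi.
Proof. by elim: n phi => [|n IH] phi //=; rewrite !IH; ring. Qed.

(** The second moment of the binomial distribution; the free shift [c] is what lets the recursion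
    close. *)
Lemma bernstein_variance n c :
  bernstein x n (fun j => (j%:R - n%:R * x + c) ^+ 2) = n%:R * (x * (1 - x)) + c ^+ 2.
Proof.
elim: n c => [|n IH] c /=; first by rewrite !mul0r subrr !add0r.
have e1 : bernstein x n (fun j => (j.+1%:R - n.+1%:R * x + c) ^+ 2) =
          bernstein x n (fun j => (j%:R - n%:R * x + (1 - x + c)) ^+ 2).
  by congr bernstein; apply/funext => j; rewrite -!natr1; ring.
have e2 : bernstein x n (fun j => (j%:R - n.+1%:R * x + c) ^+ 2) =
          bernstein x n (fun j => (j%:R - n%:R * x + (c - x)) ^+ 2).
  by congr bernstein; apply/funext => j; rewrite -!natr1; ring.
by rewrite e1 e2 !IH -natr1; ring.
Qed.

End Bernstein.

Lemma coef_bernstein (A : comNzRingType) (X : A) n (phi : nat -> {poly A}) i :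
  (bernstein X%:P n phi)`_i = bernstein X n (fun j => (phi j)`_i).
Proof.
elim: n phi => [|n IH] phi //=.
by rewrite -polyC1 -polyCB coefD !coefCM !IH.
Qed.

Lemma horner_bernstein (R : comNzRingType) (X : {poly R}) n phi x :
  (bernstein X n phi).[x] = bernstein X.[x] n (fun j => (phi j).[x]).
Proof. by elim: n phi => [|n IH] phi //=; rewrite !hornerE !IH. Qed.

Lemma bernstein0 (A : comNzRingType) (X : A) n : bernstein X n (fun=> 0) = 0.
Proof. by elim: n => [|n IH] //=; rewrite IH !mulr0 addr0. Qed.

Section Cones.
Variables (A : comNzRingType) (C : A -> Prop) (cC : is_cone C).

Lemma cone0 : C 0.
Proof. by have [_ _ h] := cC; rewrite -(mulr0 0) -expr2; apply: h. Qed.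

Lemma cone1 : C 1.
Proof. by have [_ _ h] := cC; rewrite -(mulr1 1) -expr2; apply: h. Qed.

Lemma cone_sum (I : Type) (r : seq I) (P : pred I) (F : I -> A) :
  (forall i, P i -> C (F i)) -> C (\sum_(i <- r | P i) F i).
Proof.
by move=> h; elim/big_ind: _ => //; [apply: cone0|have [h' _ _] := cC; apply: h'].
Qed.

Lemma coneXn x n : C x -> C (x ^+ n).
Proof.
move=> Cx; elim: n => [|n IH]; first exact: cone1.
by rewrite exprS; have [_ h _] := cC; apply: h.
Qed.

Lemma cone_bernstein (X : A) n phi : C X -> C (1 - X) -> (forall j, C (phi j)) ->
  C (bernstein X n phi).
Proof.
move=> CX CX'; have [CD CM _] := cC.
by elim: n phi => [|n IH] phi h //=; apply: CD; apply: CM => //; apply: IH.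
Qed.

End Cones.

(** * Polynomials bounded below without degeneration *)

Section StrictPositivity.
Variables (R : realType) (U : R -> Prop) (T : {poly {poly R}} -> Prop).
Hypotheses (cT : is_cone T) (TY : T 'X).
Hypothesis posT : forall p : {poly R}, (forall x, U x -> 0 < p.[x]) -> T p%:P.
Variables (A B : R).
Hypotheses (AB : A < B) (UAB : forall x, U x -> A < x < B).
Hypothesis Unear : forall x : R, exists2 x', U x' &
  forall u, U u -> `|x' - u| <= 2%:R * `|x - u|.

Definition geom D : {poly {poly R}} := \sum_(i < D.+1) 'X^i.

Lemma ev2_geom D x y : ev2 (geom D) x y = \sum_(i < D.+1) y ^+ i.
Proof. by rewrite ev2E ev_sum; apply: eq_bigr => i _; rewrite evXn evY. Qed.

Lemma coef_geom D i : (geom D)`_i = (i < D.+1)%:R.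
Proof.
rewrite /geom -[\sum_(_ < _) _](_ : \poly_(i < D.+1) 1 = _).
  by rewrite coef_poly; case: ltnP.
by rewrite poly_def; apply: eq_bigr => j _; rewrite scale1r.
Qed.

Lemma size_geom D : (size (geom D) <= D.+1)%N.
Proof. by apply/leq_sizeP => j; rewrite leqNgt coef_geom => /negPf->. Qed.

(** Every coefficient in y is [e] plus something smaller than [e], hence positive on U, and y
    belongs to [T]. *)
Lemma small_perturbation D (r : {poly {poly R}}) e : (size r <= D.+1)%N ->
  (forall x i, U x -> `|(r`_i).[x]| < e) -> T (e%:P%:P * geom D + r).
Proof.
move=> sr hr.
have -> : e%:P%:P * geom D + r = \sum_(i < D.+1) (e%:P + r`_i)%:P * 'X^i.
  transitivity (\poly_(i < D.+1) (e%:P + r`_i)).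
    apply/polyP => i; rewrite coefD coefCM coef_geom coef_poly.
    by case: ltnP => h; rewrite ?mulr1 // mulr0 add0r nth_default // (leq_trans sr).
  by rewrite poly_def; apply: eq_bigr => i _; rewrite mul_polyC.
have [_ TM _] := cT; apply: cone_sum => // i _; apply: TM; last exact: coneXn.
apply: posT => x Ux; rewrite !hornerE; have := hr x i Ux.
by have := ler_norm (- (r`_i).[x]); rewrite normrN; lra.
Qed.

Lemma lift_nonneg (p : {poly R}) : (forall y, 0 <= y -> 0 <= p.[y]) ->
  T (map_poly polyC p).
Proof.
have [TD TM Tsq] := cT.
apply: (@halfline_cone _ (fun p => T (map_poly polyC p))); last by rewrite map_polyX.
split=> [u v|u v|u]; rewrite ?rmorphD ?rmorphM ?rmorphXn /=.
- exact: TD.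
- exact: TM.
- exact: Tsq.
Qed.

Lemma lipschitz_coefs (f : {poly {poly R}}) : exists2 K, 0 <= K &
  forall i x y, A <= x <= B -> A <= y <= B ->
    `|(f`_i).[x] - (f`_i).[y]| <= K * `|x - y|.
Proof.
suff [K K0 hK] : exists2 K, 0 <= K & forall i x y, (i < size f)%N ->
    A <= x <= B -> A <= y <= B -> `|(f`_i).[x] - (f`_i).[y]| <= K * `|x - y|.
  exists K => // i x y hx hy; have [lt|le] := ltnP i (size f); first exact: hK.
  by rewrite (nth_default _ le) !horner0 subrr normr0 mulr_ge0.
elim: (size f) => [|n [K K0 hK]]; first by exists 0.
have [K' K'1 hK'] := poly_lipshitz f`_n A B.
have K'0 : 0 <= K' by apply: le_trans K'1.
exists (K + K') => [|i x y]; first exact: addr_ge0.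
rewrite ltnS leq_eqVlt mulrDl => /orP[/eqP->|lt] hx hy.
  by apply: le_trans (hK' y x _ _) _; rewrite ?in_itv // lerDr mulr_ge0.
by apply: le_trans (hK i x y lt hx hy) _; rewrite lerDl mulr_ge0.
Qed.

(** Half of the margin is kept as [(e / 2)] times [geom D]; it absorbs the coefficientwise error of
    the Bernstein approximation. The sampled fibres are taken at points of U, where they are
    nonnegative on the half-line. *)
Lemma strict_positivity D (f : {poly {poly R}}) e : 0 < e -> (size f <= D.+1)%N ->
  (forall x y, U x -> 0 <= y -> e * (\sum_(i < D.+1) y ^+ i) <= ev2 f x y) -> T f.
Proof.
move=> e0 sf hf; have [TD TM Tsq] := cT.
pose g := f - (e / 2)%:P%:P * geom D.
have sg : (size g <= D.+1)%N.
  apply: leq_trans (size_polyD _ _) _; rewrite geq_max sf size_polyN.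
  rewrite mul_polyC; apply: leq_trans (size_scale_leq _ _) (size_geom D).
have g_ge0 x y : U x -> 0 <= y -> 0 <= ev2 g x y.
  move=> Ux y0; rewrite ev2E evB evM -!ev2E {2}/ev2 !hornerC ev2_geom.
  have := hf x y Ux y0.
  have : 0 <= \sum_(i < D.+1) y ^+ i by apply: sumr_ge0 => i _; apply: exprn_ge0.
  nra.
have [K K0 lip] := lipschitz_coefs g.
have [near nearP] : exists near : R -> R, forall x, U (near x) /\
    forall u, U u -> `|near x - u| <= 2%:R * `|x - u|.
  exists (fun x => xget 0 [set x' | U x' /\
    forall u, U u -> `|x' - u| <= 2%:R * `|x - u|]%classic) => x.
  case: xgetP => [y _ //|no]; have [x' Ux' hx'] := Unear x.
  by case: (no x').
pose W := B - A; have W0 : 0 < W by rewrite subr_gt0.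
(* From 2 K u <= e / 8 + (8 / e) (K u)^2: the linear Lipschitz error is traded for a quadratic one,
   which [bernstein_variance] can sum. *)
pose c := 8%:R * K ^+ 2 / e.
have e_ge0 := ltW e0.
have c0 : 0 <= c by rewrite /c divr_ge0 // mulr_ge0 // exprn_ge0.
have cW0 : 0 <= c * W ^+ 2 by rewrite mulr_ge0 // exprn_ge0 // ltW.
(* Large enough for the quadratic part to sum to at most e / 8. The total error e / 4 is then below
   e / 2. *)
pose n := (Num.bound (8%:R * (c * W ^+ 2) / e)).+1.
have n0 : 0 < n%:R :> R by rewrite ltr0n.
have nP : c * W ^+ 2 / n%:R <= e / 8%:R.
  have h := archi_boundP (_ : 0 <= 8%:R * (c * W ^+ 2) / e).
  have {}h := h ltac:(by rewrite divr_ge0 // mulr_ge0).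
  rewrite ler_pdivrMr //; move: h; rewrite ltr_pdivrMr // => h.
  have : (Num.bound (8%:R * (c * W ^+ 2) / e))%:R <= n%:R :> R.
    by rewrite ler_nat /n leqnSn.
  by nra.
pose node j : R := A + W * (j%:R / n%:R).
pose X : {poly R} := W^-1 *: ('X - A%:P).
pose phi j := map_poly polyC (fibre (near (node j)) g).
pose b := bernstein X%:P n phi.
have Tb : T b.
  have XE x : X.[x] = (x - A) / W by rewrite !hornerE mulrC.
  apply: cone_bernstein => //.
  - apply: posT => x /UAB/andP[Ax xB]; rewrite XE divr_gt0 // subr_gt0 //.
  - rewrite -polyC1 -polyCB; apply: posT => x /UAB/andP[Ax xB].
    by rewrite hornerD hornerN XE hornerC subr_gt0 ltr_pdivrMr // /W; lra.
  by move=> j; apply: lift_nonneg => y y0; rewrite fibreE g_ge0 //; case: (nearP (node j)).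
have -> : f = b + ((e / 2)%:P%:P * geom D + (g - b)) by rewrite /g; ring.
apply: TD => //; apply: small_perturbation.
  apply: leq_trans (size_polyD _ _) _; rewrite geq_max sg size_polyN.
  apply/leq_sizeP => i iD; rewrite coef_bernstein -[RHS](bernstein0 X n).
  congr bernstein; apply/funext => j; rewrite coef_map /= coef_fibre.
  by rewrite nth_default ?horner0 ?polyC0 // (leq_trans sg).
move=> x i Ux; have /andP[Ax xB] := UAB Ux.
rewrite coefB hornerD hornerN coef_bernstein horner_bernstein.
set x1 := X.[x]; have x1E : x1 = (x - A) / W by rewrite /x1 !hornerE mulrC.
have x1I : 0 <= x1 <= 1.
  by rewrite x1E divr_ge0 ?ler_pdivrMr ?mul1r /W; lra.
have phiE : (fun j => ((phi j)`_i).[x]) = (fun j => (g`_i).[near (node j)]).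
  by apply/funext => j; rewrite coef_map /= coef_fibre hornerC.
rewrite phiE; set ps := fun j => _.
pose q j := (j%:R - n%:R * x1 + 0) ^+ 2.
have W2 : 0 < W ^+ 2 by rewrite exprn_gt0.
have dist j : `|ps j - (g`_i).[x]| <= e / 8%:R + c * (W / n%:R) ^+ 2 * q j.
  have [Un hn] := nearP (node j); have /andP[nA nB] := UAB Un.
  have nodeE : node j - x = W / n%:R * (j%:R - n%:R * x1 + 0).
    by rewrite /node x1E; field; rewrite !gt_eqF.
  have l := lip i (near (node j)) x.
  have {l} l : `|ps j - (g`_i).[x]| <= K * `|near (node j) - x|.
    by apply: l; rewrite !ltW.
  have h := hn x Ux; set u := `|node j - x| in h.
  have u0 : 0 <= u by apply: normr_ge0.
  have uE : (W / n%:R) ^+ 2 * q j = u ^+ 2.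
    by rewrite /u real_normK ?num_real // nodeE /q [RHS]exprMn.
  rewrite -mulrA uE; apply: (le_trans l).
  have : K * `|near (node j) - x| <= 2%:R * (K * u).
    by rewrite mulrCA; apply: ler_wpM2l.
  have -> : c * u ^+ 2 = 8%:R / e * (K * u) ^+ 2 by rewrite /c; field; rewrite gt_eqF.
  set w := K * u => h'; apply: (le_trans h').
  rewrite -subr_ge0 (_ : _ - _ = 8%:R / e * (w - e / 8%:R) ^+ 2).
    by apply: mulr_ge0; [rewrite divr_ge0|apply: sqr_ge0].
  by field; rewrite gt_eqF.
have var : c * (W / n%:R) ^+ 2 * bernstein x1 n q <= e / 8%:R.
  rewrite /q bernstein_variance expr0n addr0; apply: le_trans nP.
  have -> : c * (W / n%:R) ^+ 2 * (n%:R * (x1 * (1 - x1))) =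
      c * W ^+ 2 / n%:R * (x1 * (1 - x1)) by field; rewrite gt_eqF.
  rewrite ler_piMr //; last by case/andP: x1I => ? ?; nra.
  by rewrite divr_ge0.
have up : bernstein x1 n ps <= ((g`_i).[x] + e / 8%:R) +
    c * (W / n%:R) ^+ 2 * bernstein x1 n q.
  rewrite -bernstein_affine; apply: bernstein_le => // j.
  by have := ler_norm (ps j - (g`_i).[x]); have := dist j; lra.
have lo : ((g`_i).[x] - e / 8%:R) + - (c * (W / n%:R) ^+ 2) * bernstein x1 n q <=
    bernstein x1 n ps.
  rewrite -bernstein_affine; apply: bernstein_le => // j.
  have := ler_norm (- (ps j - (g`_i).[x])); rewrite normrN; have := dist j; lra.
rewrite ltr_norml; move: var up lo; rewrite mulNr.
by move: (c * _ * bernstein _ _ _) (bernstein x1 n ps) => V b' *; lra.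
Qed.

End StrictPositivity.

Lemma dvd_coefs (F : fieldType) (m : {poly F}) (f : {poly {poly F}}) :
  (forall i, m %| f`_i) -> exists r, f = m%:P * r.
Proof.
move=> h; exists (map_poly (fun p => p %/ m) f).
by apply/polyP => i; rewrite coefCM coef_map_id0 ?div0p // mulrC divpK.
Qed.

(** * Jets in the cone, peak polynomials and gluing *)

Section Gluing.
Variables (R : realType) (U : R -> Prop) (T : {poly {poly R}} -> Prop).
Hypotheses (cT : is_cone T) (TY : T 'X).
Hypothesis posT : forall p : {poly R}, (forall x, U x -> 0 < p.[x]) -> T p%:P.
Variables (A B : R).
Hypotheses (AB : A < B) (UAB : forall x, U x -> A < x < B).
Hypothesis Unear : forall x : R, exists2 x', U x' &
  forall u, U u -> `|x' - u| <= 2%:R * `|x - u|.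
Hypothesis Ucompact : forall p : {poly R}, (forall x, U x -> 0 < p.[x]) ->
  exists2 e : R, 0 < e & forall x, U x -> e <= p.[x].

(** Modulo powers of X - x0 both X - x0 and its negative then come from [T], so every jet vanishing
    at [x0] can be reached. *)
Definition isolated_at (x0 : R) := exists v1 v2 : {poly R},
  [/\ 0 < v1.[x0], v2.[x0] < 0, T (('X - x0%:P) * v1)%:P & T (('X - x0%:P) * v2)%:P].

(** [itv_poly c d] need not belong to [T], since it is negative on other components of U; only its
    jets at [x0] are required. *)
Definition thick_at (x0 : R) := exists c d : R, [/\ c < d, c <= x0 <= d,
  forall x, c <= x <= d -> U x & forall M, exists2 g : {poly R}, T g%:P &
    ('X - x0%:P) ^+ M %| itv_poly c d - g].

Hypothesis Uloc : forall x0, U x0 -> isolated_at x0 \/ thick_at x0.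

Definition lower_bound (f : {poly {poly R}}) (w : {poly R}) D :=
  exists2 e : R, 0 < e & forall x y : R, U x -> 0 <= y ->
    e * w.[x] ^+ 2 * (\sum_(i < D.+1) y ^+ i) <= ev2 f x y.

Lemma T_qsum l : T (qsum l).
Proof.
have [TD TM Tsq] := cT; apply: cone_sum => // p _.
by apply: TD => //; apply: TM.
Qed.

Lemma geom_ge0 D (y : R) : 0 <= y -> 0 <= \sum_(i < D.+1) y ^+ i.
Proof. by move=> y0; apply: sumr_ge0 => i _; apply: exprn_ge0. Qed.

Lemma isolated_jet x0 (u : {poly R}) M : isolated_at x0 ->
  exists g : {poly R}, T g%:P /\ ('X - x0%:P) ^+ M %| ('X - x0%:P) * u - g.
Proof.
have [TD TM Tsq] := cT; move=> [v1 [v2 [v1p v2n T1 T2]]].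
set t := 'X - x0%:P.
have [|e1 h1] := @ratio_mod _ 1 v1 x0 M; first by rewrite hornerC mul1r.
have [|e2 h2] := @ratio_mod _ (-1) v2 x0 M.
  by rewrite hornerN hornerC mulN1r oppr_gt0.
(* The identity u = ((u + 1) / 2)^2 - ((u - 1) / 2)^2 splits t u into t times a square and - t times
   a square, one for each available sign. *)
pose up := 2%:R^-1%:P * (u + 1); pose um := 2%:R^-1%:P * (u - 1).
have uE : u = up ^+ 2 - um ^+ 2.
  rewrite /up /um; have e : 2%:R^-1%:P + 2%:R^-1%:P = 1 :> {poly R}.
    by rewrite -polyCD -polyC1; congr (_%:P); field.
  rewrite [RHS](_ : _ = (2%:R^-1%:P + 2%:R^-1%:P) ^+ 2 * u); last by ring.
  by rewrite e expr1n mul1r.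
exists (t * v1 * (e1 * up) ^+ 2 + t * v2 * (e2 * um) ^+ 2); split.
  by rewrite polyCD (polyCM (t * v1)) (polyCM (t * v2)) !rmorphXn; apply: TD; apply: TM.
have -> : t * u - (t * v1 * (e1 * up) ^+ 2 + t * v2 * (e2 * um) ^+ 2) =
    (1 - v1 * e1 ^+ 2) * (t * up ^+ 2) + (-1 - v2 * e2 ^+ 2) * (t * um ^+ 2).
  by rewrite {1}uE; ring.
by apply: dvdp_add; apply: dvdp_mulr.
Qed.

(** The bound on [size p] is as important as the jet: it keeps the remainder at y-degree at most
    [D], where 1 + y + ... + y^D dominates it. *)
Lemma jet x0 (f : {poly {poly R}}) w D M : U x0 -> w != 0 ->
  (size f <= D.+1)%N -> lower_bound f w D ->
  exists p r, [/\ T p, (size p <= D.+1)%N & f - p = (('X - x0%:P) ^+ M)%:P * r].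
Proof.
have [TD TM Tsq] := cT; move=> Ux0 w0 sf [e e0 hf].
have f_ge0 x y : U x -> 0 <= y -> 0 <= ev2 f x y.
  move=> Ux y0; apply: le_trans (hf x y Ux y0).
  apply: mulr_ge0; last exact: geom_ge0.
  by apply: mulr_ge0; [apply: ltW|apply: sqr_ge0].
set t := 'X - x0%:P.
case: (Uloc Ux0) => [iso|[c [d [cd xI cdU loc]]]].
  have /choice[G hG] u := isolated_jet u M iso.
  pose q i := (f`_i - (f`_i).[x0]%:P) %/ t.
  (* The fibre at [x0] is nonnegative on the half-line and lifts to [T]; the rest of each
     coefficient vanishes at [x0], so [G] supplies its jet. *)
  pose p := map_poly polyC (fibre x0 f) + \sum_(i < D.+1) (G (q i))%:P * 'X^i.
  have pc i : p`_i = (f`_i).[x0]%:P + (if (i < D.+1)%N then G (q i) else 0).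
    have sE : \sum_(i < D.+1) (G (q i))%:P * 'X^i = \poly_(i < D.+1) G (q i).
      by rewrite poly_def; apply: eq_bigr => j _; rewrite mul_polyC.
    by rewrite /p sE coefD coef_map /= coef_fibre coef_poly.
  have [|r rE] := @dvd_coefs _ (t ^+ M) (f - p).
    move=> i; rewrite coefB pc; case: ifP => iD; last first.
      have iD' : (D.+1 <= i)%N by rewrite leqNgt iD.
      by rewrite nth_default ?horner0 ?addr0 ?subr0 ?dvdp0 // (leq_trans sf).
    have qE : f`_i - (f`_i).[x0]%:P = t * q i.
      rewrite mulrC divpK // dvdp_XsubCl rootE.
      by rewrite hornerD hornerN hornerC subrr.
    by rewrite opprD addrA qE; case: (hG (q i)).
  exists p, r; split => //.
    apply: TD; first by apply: (lift_nonneg cT) => // y y0; rewrite fibreE f_ge0.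
    apply: cone_sum => // i _; apply: TM; last exact: coneXn.
    by case: (hG (q i)).
  apply/leq_sizeP => i iD; rewrite pc ltnNge iD /= addr0.
  by rewrite nth_default ?horner0 ?polyC0 // (leq_trans sf).
have hf' x y : c <= x <= d -> 0 <= y ->
    e * w.[x] ^+ 2 * (\sum_(i < D.+1) y ^+ i) <= ev2 f x y.
  by move=> /cdU; apply: hf.
have [h [l0 [l1 [h0 hE]]]] := local_certificate cd e0 w0 sf hf'.
have {h h0 l0 l1 hE} [h [l0 [l1 [hx hE]]]] := certificate_at cd xI h0 hE.
have h0 : h != 0 by apply: contraNneq hx => ->; rewrite horner0.
have [k hk] := inverse_mod M hx.
have [g Tg hg] := loc M.
have n0 : itv_poly c d != 0.
  rewrite mulf_neq0 ?polyXsubC_eq0 //.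
  by rewrite -oppr_eq0 opprB polyXsubC_eq0.
have q_ge0 l x y : c <= x <= d -> 0 <= y -> 0 <= ev2 (qsum l) x y.
  by move=> _; apply: qsum_ge0.
have nq_ge0 l x y : c <= x <= d -> 0 <= y ->
    0 <= ev2 ((itv_poly c d)%:P * qsum l) x y.
  move=> /andP[cx xd] y0; rewrite ev2E evM -!ev2E mulr_ge0 ?qsum_ge0 //.
  by rewrite /ev2 hornerC itv_polyE mulr_ge0 // subr_ge0.
have sh : size (h%:P ^+ 2 * f) = size f.
  by rewrite -rmorphXn /= mul_polyC size_scale // expf_neq0.
have s0 : (size (qsum l0) <= D.+1)%N.
  have := size_add_nonneg cd (q_ge0 l0) (nq_ge0 l1).
  by rewrite -hE sh => /leq_trans; apply.
have s1 : (size (qsum l1) <= D.+1)%N.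
  have := size_add_nonneg cd (nq_ge0 l1) (q_ge0 l0).
  by rewrite addrC -hE sh mul_polyC size_scale // => /leq_trans; apply.
(* In the certificate for [h%:P ^+ 2 * f], divide by [h] through its inverse [k] modulo t^M and
   replace the interval weight by its representative [g] in [T]. *)
exists (k%:P ^+ 2 * (qsum l0 + g%:P * qsum l1)).
have [|r rE] := @dvd_coefs _ (t ^+ M) (f - k%:P ^+ 2 * (qsum l0 + g%:P * qsum l1)).
  have -> : f - k%:P ^+ 2 * (qsum l0 + g%:P * qsum l1) =
     ((- (k * h - 1)) * (k * h + 1))%:P * f +
     (k ^+ 2 * (itv_poly c d - g))%:P * qsum l1.
    rewrite (_ : _%:P * f = f - k%:P ^+ 2 * (h%:P ^+ 2 * f)).
      by rewrite hE (polyCM (k ^+ 2)) polyCB rmorphXn; ring.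
    by rewrite !(polyCM, polyCD, polyCN, polyC1); ring.
  move=> i; rewrite coefD !coefCM; apply: dvdp_add; apply: dvdp_mulr.
    by apply: dvdp_mulr; rewrite dvdpNr.
  exact: dvdp_mull.
exists r; split => //.
  apply: (TM) => //; apply: TD; first exact: T_qsum.
  by apply: TM => //; apply: T_qsum.
rewrite -rmorphXn /= mul_polyC; apply: leq_trans (size_scale_leq _ _) _.
apply: leq_trans (size_polyD _ _) _; rewrite geq_max s0 mul_polyC.
exact: leq_trans (size_scale_leq _ _) s1.
Qed.

Lemma U_bound (p : {poly R}) : exists2 K, 0 < K & forall x, U x -> `|p.[x]| <= K.
Proof.
have [K hK] := poly_itv_bound p A B; exists (`|K| + 1) => [|x /UAB /andP[Ax xB]].
  by rewrite ltr_wpDl.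
have h : `|p.[x]| <= K by apply: hK; rewrite !ltW.
by apply: le_trans h _; apply: le_trans (ler_norm K) _; rewrite lerDl.
Qed.

Lemma coefs_bound (r : {poly {poly R}}) :
  exists2 K, 0 < K & forall x i, U x -> `|(r`_i).[x]| <= K.
Proof.
suff [K K0 hK] : exists2 K, 0 < K & forall x i, U x -> (i < size r)%N ->
    `|(r`_i).[x]| <= K.
  exists K => // x i Ux; have [lt|le] := ltnP i (size r); first exact: hK.
  by rewrite (nth_default _ le) horner0 normr0 ltW.
elim: (size r) => [|n [K K0 hK]]; first by exists 1.
have [K' K'0 hK'] := U_bound r`_n.
exists (K + K') => [|x i Ux]; first exact: addr_gt0.
rewrite ltnS leq_eqVlt => /orP[/eqP->|lt].
  by apply: le_trans (hK' x Ux) _; rewrite lerDr ltW.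
by apply: le_trans (hK x i Ux lt) _; rewrite lerDl ltW.
Qed.

Lemma ev2_le_geom (r : {poly {poly R}}) D K x y : (size r <= D.+1)%N -> 0 <= y ->
  (forall i, `|(r`_i).[x]| <= K) -> `|ev2 r x y| <= K * \sum_(i < D.+1) y ^+ i.
Proof.
move=> sr y0 hK; rewrite -fibreE (@horner_coef_wide _ D.+1); last first.
  exact: leq_trans (size_poly _ _) sr.
rewrite mulr_sumr; apply: le_trans (ler_norm_sum _ _ _) _.
apply: ler_sum => i _; rewrite coef_fibre normrM.
rewrite (ger0_norm (exprn_ge0 i y0)); apply: ler_wpM2r => //.
exact: exprn_ge0.
Qed.

Lemma bernoulli_decay (u : R) n : 0 <= u <= 1 -> (1 - u) ^+ n * (1 + n%:R * u) <= 1.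
Proof.
move=> /andP[u0 u1]; elim: n => [|n IH]; first by rewrite expr0 mul0r addr0 mulr1.
apply: le_trans IH; rewrite exprSr -mulrA; apply: ler_wpM2l.
  by apply: exprn_ge0; lra.
have n0 : 0 <= n%:R :> R by [].
by rewrite -natr1; nra.
Qed.

(* With [tau = (X - x0)^2N], the weight [s = v (1 - kappa tau)^2L] is 1 at [x0]
   and small elsewhere on [U]; [m = (1 - s) / tau]. *)
Lemma peak_polynomial (x0 : R) (w1 : {poly R}) N (e : R) :
  U x0 -> w1.[x0] != 0 -> (0 < N)%N -> 0 < e ->
  exists h m : {poly R},
    [/\ 1 - (w1 * h) ^+ 2 = ('X - x0%:P) ^+ N.*2 * m,
        forall x, U x -> 0 <= m.[x] &
        forall x, U x -> `|x - x0| * h.[x] ^+ 2 <= e].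
Proof.
move=> Ux0 w1x N0 e0; set t := 'X - x0%:P; set tau := t ^+ N.*2.
(* [g] inverts [w1] to order 2N at [x0], so the weight can carry the factor [w1 ^+ 2] and still be 1
   modulo [tau]. That factor is what later compares the error with the bound in [w1]. *)
have [g /dvdpP[q0 gE]] := inverse_mod N.*2 w1x.
pose q := q0 * (g * w1 + 1).
have vE : (w1 * g) ^+ 2 = 1 + tau * q.
  rewrite [LHS](_ : _ = 1 + (g * w1 - 1) * (g * w1 + 1)); last by ring.
  by rewrite gE /q /tau /t; ring.
have [Kt Kt0 hKt] := U_bound tau; have [Kq Kq0 hKq] := U_bound q.
have [Kg Kg0 hKg] := U_bound g; have [Kl Kl0 hKl] := U_bound t.
pose ka := Kt^-1; have ka0 : 0 < ka by rewrite invr_gt0.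
have tauE x : tau.[x] = (x - x0) ^+ N.*2 by rewrite horner_exp !hornerE.
have tau_ge0 x : 0 <= tau.[x] by rewrite tauE -muln2 exprM sqr_ge0.
have u01 x : U x -> 0 <= ka * tau.[x] <= 1.
  move=> Ux; rewrite mulr_ge0 ?(ltW ka0) //= mulrC ler_pdivrMr // mul1r.
  by apply: le_trans (ler_norm _) (hKt x Ux).
pose eta := e / Kg ^+ 2; have eta0 : 0 < eta by rewrite divr_gt0 ?exprn_gt0.
(* The first summand gives [L1], which makes [m] nonnegative: the geometric sum in [kL] outweighs
   [q]. The second gives [L2], which makes [h] small away from [x0]. *)
pose L := (Num.bound (Kq / ka) + Num.bound (Kl / (ka * eta ^+ N.*2 * eta))).+1.
have Lle n : (n <= L)%N -> n%:R <= L.*2%:R :> R.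
  by move=> h; rewrite ler_nat -addnn (leq_trans h) ?leq_addr.
have L1 : Kq <= L.*2%:R * ka.
  have h := archi_boundP (divr_ge0 (ltW Kq0) (ltW ka0)).
  rewrite ltr_pdivrMr // in h; apply/ltW.
  apply: lt_le_trans h _; apply: ler_wpM2r; first exact: ltW.
  by apply: Lle; rewrite /L leqW // leq_addr.
have L2 : Kl <= L.*2%:R * (ka * eta ^+ N.*2) * eta.
  have d0 : 0 < ka * eta ^+ N.*2 * eta by rewrite (mulr_gt0 (mulr_gt0 ka0 _)) // exprn_gt0.
  have h := archi_boundP (divr_ge0 (ltW Kl0) (ltW d0)).
  rewrite ltr_pdivrMr // in h; rewrite -mulrA; apply/ltW.
  apply: lt_le_trans h _; apply: ler_wpM2r; first exact: ltW.
  by apply: Lle; rewrite /L leqW // leq_addl.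
pose z : {poly R} := 1 - ka%:P * tau.
pose kL : {poly R} := ka%:P * \sum_(i < L.*2) z ^+ i.
have zE : z ^+ L.*2 = 1 - tau * kL.
  have := subrX1 z L.*2; rewrite /kL /z => h.
  by rewrite -[LHS](subrK 1) h; ring.
have zx x : z.[x] = 1 - ka * tau.[x] by rewrite hornerD hornerN hornerM !hornerC.
exists (g * z ^+ L), (kL - q * z ^+ L.*2).
have z01 x : U x -> 0 <= z.[x] <= 1 by move=> /u01; rewrite zx; lra.
split=> [|x Ux|x Ux].
- rewrite [(w1 * _) ^+ 2](_ : _ = (w1 * g) ^+ 2 * z ^+ L.*2).
    by rewrite vE zE; ring.
  by rewrite -muln2 exprM; ring.
- have /andP[z0 z1] := z01 x Ux.
  rewrite hornerD hornerN (hornerM q) horner_exp subr_ge0.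
  apply: le_trans (_ : Kq * z.[x] ^+ L.*2 <= _).
    apply: ler_wpM2r; first exact: exprn_ge0.
    by apply: le_trans (ler_norm _) (hKq x Ux).
  apply: le_trans (_ : L.*2%:R * ka * z.[x] ^+ L.*2 <= _).
    by apply: ler_wpM2r => //; apply: exprn_ge0.
  rewrite /kL hornerM hornerC horner_sum mulrAC mulrC; apply: ler_wpM2l.
    exact: ltW.
  rewrite mulr_natl -[X in _ *+ X]card_ord -sumr_const.
  apply: ler_sum => i _; rewrite horner_exp; apply: ler_wiXn2l => //.
  exact/ltnW/ltn_ord.
have /andP[z0 z1] := z01 x Ux.
have gx : g.[x] ^+ 2 <= Kg ^+ 2.
  rewrite -[g.[x] ^+ 2]real_normK ?num_real //.
  by apply: lerXn2r; rewrite ?nnegrE ?(ltW Kg0) // hKg.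
rewrite hornerM horner_exp exprMn -exprM muln2 mulrCA.
suff h : `|x - x0| * z.[x] ^+ L.*2 <= eta.
  apply: le_trans (_ : Kg ^+ 2 * eta <= _).
    by apply: ler_pM => //; [apply: sqr_ge0|apply: mulr_ge0 => //; apply: exprn_ge0].
  by rewrite /eta mulrC divfK // expf_neq0 // gt_eqF.
have zn0 : 0 <= z.[x] ^+ L.*2 by apply: exprn_ge0.
have zn1 : z.[x] ^+ L.*2 <= 1 by apply: exprn_ile1.
(* Close to [x0] the factor [|x - x0|] is small enough; elsewhere [tau] is at least [eta ^+ N.*2],
   and the power of [z] decays by [bernoulli_decay]. *)
have [small|big] := leP `|x - x0| eta.
  by apply: le_trans small; rewrite ler_piMr.
have tauB : eta ^+ N.*2 <= tau.[x].
  rewrite tauE -(ger0_norm (_ : 0 <= (x - x0) ^+ N.*2)); last by rewrite -tauE.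
  by rewrite normrX; apply: lerXn2r; rewrite ?nnegrE // ltW.
have dec := bernoulli_decay L.*2 (u01 x Ux); rewrite -zx in dec.
have xl : `|x - x0| <= Kl by have := hKl x Ux; rewrite !hornerE.
have L0 : 0 <= L.*2%:R :> R by [].
have c1 : L.*2%:R * (ka * eta ^+ N.*2) <= 1 + L.*2%:R * (ka * tau.[x]).
  apply: le_trans (_ : L.*2%:R * (ka * tau.[x]) <= _); last by rewrite lerDr.
  by apply: ler_wpM2l => //; apply: ler_wpM2l => //; apply: ltW.
apply: le_trans (_ : L.*2%:R * (ka * eta ^+ N.*2) * eta * z.[x] ^+ L.*2 <= _).
  by apply: ler_wpM2r => //; apply: le_trans L2.
rewrite mulrAC; apply: le_trans (_ : 1 * eta <= _); last by rewrite mul1r.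
apply: ler_wpM2r; first exact: ltW.
by apply: le_trans dec; rewrite mulrC; apply: ler_wpM2l.
Qed.

(* A zero [x0] of [w] of order [N] is peeled off: [f = s p + (X - x0)^2N f2] with [p]
   in [T] a jet of [f], [s] a peak at [x0], and [f2] again bounded below. *)
Lemma lower_bound_cone (f : {poly {poly R}}) (w : {poly R}) D : w != 0 ->
  (size f <= D.+1)%N -> lower_bound f w D -> T f.
Proof.
have [TD TM Tsq] := cT.
have [n] := ubnP (size w); elim: n w f => // n IH w f sw w0 sf lb.
have [[x0 [Ux0 wx0]]|nr] := pselect (exists x0, U x0 /\ w.[x0] = 0); last first.
  have [x Ux|eta eta0 heta] := @Ucompact (w ^+ 2).
    rewrite horner_exp exprn_even_gt0 //=.
    by apply/eqP => wx; apply: nr; exists x.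
  case: lb => e e0 hf.
  apply: (@strict_positivity _ U T cT TY posT A B AB UAB Unear D f (e * eta)) => //.
    exact: mulr_gt0.
  move=> x y Ux y0; apply: le_trans (hf x y Ux y0); apply: ler_wpM2r.
    exact: geom_ge0.
  by apply: ler_wpM2l; [apply: ltW|rewrite -horner_exp heta].
have [N [w1]] := multiplicity_XsubC w x0; rewrite w0 /= => w1x wE.
have N0 : (0 < N)%N.
  rewrite lt0n; apply: contraNneq w1x => N0.
  by move: wx0; rewrite wE N0 expr0 mulr1 rootE => ->.
have w1x' : w1.[x0] != 0 by rewrite -rootE.
have w10 : w1 != 0 by apply: contraNneq w1x' => ->; rewrite horner0.
case: lb => e e0 hf.
set t := 'X - x0%:P in wE.
(* Half of the lower bound is set aside. Divided by (x - x0)^2N it becomes the term in [w1 ^+ 2] of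
   [f2] that absorbs the error. *)
pose f' := f - (e / 2)%:P%:P * ((w ^+ 2)%:P * geom R D).
have size_wgeom (p : {poly R}) (c : R) :
    (size (c%:P%:P * (p%:P * geom R D))%R <= D.+1)%N.
  rewrite !mul_polyC; do 2!apply: leq_trans (size_scale_leq _ _) _.
  exact: size_geom.
have ev_wgeom (p : {poly R}) (c : R) x y :
    ev2 (c%:P%:P * (p%:P * geom R D)) x y = c * (p.[x] * \sum_(i < D.+1) y ^+ i).
  by rewrite ev2E !evM -!ev2E {1 2}/ev2 !hornerC ev2_geom.
have sf' : (size f' <= D.+1)%N.
  by apply: leq_trans (size_polyD _ _) _; rewrite geq_max sf size_polyN size_wgeom.
have hf' x y : U x -> 0 <= y ->
    e / 2 * w.[x] ^+ 2 * (\sum_(i < D.+1) y ^+ i) <= ev2 f' x y.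
  move=> Ux y0; rewrite ev2E evB -!ev2E ev_wgeom horner_exp.
  by have := hf x y Ux y0; lra.
have f'_ge0 x y : U x -> 0 <= y -> 0 <= ev2 f' x y.
  move=> Ux y0; apply: le_trans (hf' x y Ux y0).
  apply: mulr_ge0; last exact: geom_ge0.
  by apply: mulr_ge0; [rewrite divr_ge0 // ltW|apply: sqr_ge0].
have e2 : 0 < e / 2 by lra.
have lb' : lower_bound f' w D by exists (e / 2).
(* One order more than the factor (x - x0)^2N to be split off: the extra [t] in the error is what
   the peak polynomial makes small. *)
have [p [r [Tp sp fp]]] := jet (N.*2.+1) Ux0 w0 sf' lb'.
have sr : (size r <= D.+1)%N.
  have : (size (f' - p)%R <= D.+1)%N.
    by apply: leq_trans (size_polyD _ _) _; rewrite geq_max sf' size_polyN.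
  by rewrite fp mul_polyC size_scale // expf_neq0 // polyXsubC_eq0.
have [C C0 hC] := coefs_bound r.
(* [C] bounds the coefficients of [r], so the error costs at most e / 4 of the e / 2 set aside, and
   e / 4 remains for [w1]. *)
have e4 : 0 < e / 4%:R / C by rewrite !divr_gt0.
have [h [m [hm m0 hs]]] := peak_polynomial Ux0 w1x' N0 e4.
pose f2 := m%:P * f' + ((e / 2)%:P%:P * ((w1 ^+ 2)%:P * geom R D) +
  ((w1 * h) ^+ 2 * t)%:P * r).
have fE : f = ((w1 * h) ^+ 2)%:P * p + (t ^+ N.*2)%:P * f2.
  have sE : ((w1 * h) ^+ 2)%:P = 1 - (t ^+ N.*2)%:P * m%:P :> {poly {poly R}}.
    by rewrite -polyCM -hm polyCB opprB addrCA subrr addr0.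
  have wE2 : (w ^+ 2)%:P = (t ^+ N.*2)%:P * (w1 ^+ 2)%:P :> {poly {poly R}}.
    by rewrite -polyCM wE exprMn -exprM muln2 mulrC.
  have pE : p = f' - (t ^+ N.*2)%:P * t%:P * r.
    by rewrite -polyCM -exprSr -fp opprB addrCA subrr addr0.
  have -> : f = f' + (e / 2)%:P%:P * ((w ^+ 2)%:P * geom R D) by rewrite /f' subrK.
  rewrite /f2 (polyCM (_ ^+ 2)) pE wE2.
  rewrite [in RHS]mulrDr sE.
  move: (t ^+ N.*2)%:P m%:P t%:P (w1 ^+ 2)%:P (e / 2)%:P%:P (geom R D) => *.
  ring.
rewrite fE; apply: TD; apply: TM => //.
- by rewrite rmorphXn; apply: Tsq.
- by rewrite -muln2 exprM rmorphXn; apply: Tsq.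
apply: (IH w1) => //.
- have sE : size w = (size w1 + N)%N.
    by rewrite wE size_Mmonic ?monic_exp ?monicXsubC // size_exp_XsubC addnS.
  by rewrite -ltnS; apply: leq_trans sw; rewrite sE ltnS -[X in (X < _)%N]addn0 ltn_add2l.
- apply: leq_trans (size_polyD _ _) _; rewrite geq_max mul_polyC.
  rewrite (leq_trans (size_scale_leq _ _) sf') /=.
  apply: leq_trans (size_polyD _ _) _; rewrite geq_max size_wgeom mul_polyC.
  exact: leq_trans (size_scale_leq _ _) sr.
exists (e / 4%:R) => [|x y Ux y0]; first by rewrite divr_gt0.
rewrite ev2E !evD (evM _ _ _ m%:P) (evM _ _ _ (_ * t)%:P) -!ev2E ev_wgeom.
have ev2C (q : {poly R}) : ev2 q%:P x y = q.[x] by rewrite /ev2 hornerC.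
rewrite !ev2C (hornerM _ t) !horner_exp hornerM exprMn [t.[x]]hornerD hornerX hornerN hornerC.
have mf0 := mulr_ge0 (m0 x Ux) (f'_ge0 x y Ux y0).
have G0 := geom_ge0 D y0; have hr := ev2_le_geom sr y0 (hC x ^~ Ux).
have a0 := sqr_ge0 w1.[x]; have hx := hs x Ux.
move: mf0 G0 hr a0 hx; set mf := m.[x] * _; set G := \sum_(_ < _) _.
set a := w1.[x] ^+ 2; set b := h.[x] ^+ 2; set er := ev2 r x y => mf0 G0 hr a0 hx.
have b0 : 0 <= b by apply: sqr_ge0.
clearbody a b G mf er.
have err : `|a * b * (x - x0) * er| <= a * (e / 4%:R) * G.
  rewrite !normrM (ger0_norm a0) (ger0_norm b0).
  have -> : a * b * `|x - x0| * `|er| = a * ((`|x - x0| * b) * `|er|) by ring.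
  rewrite -[X in _ <= X]mulrA; apply: ler_wpM2l => //.
  have -> : e / 4%:R * G = e / 4%:R / C * (C * G) by field; rewrite gt_eqF.
  by apply: ler_pM => //; apply: mulr_ge0.
have := ler_norm (- (a * b * (x - x0) * er)); rewrite normrN.
move: err; move: (a * b * (x - x0) * er) (`|_|) => E F err hE.
have -> : e / 4%:R * a * G = a * (e / 4%:R) * G by ring.
have -> : e / 2%:R * (a * G) = a * (e / 4%:R) * G + a * (e / 4%:R) * G by field.
lra.
Qed.

End Gluing.

(** * Reduction to squarefree polynomials *)

Lemma poly_ge_critical (R : rcfType) (g : {poly R}) (Y mu : R) :
  mu <= g.[0] -> mu <= g.[Y] ->
  (forall s, 0 < s < Y -> g^`().[s] = 0 -> mu <= g.[s]) ->
  forall y, 0 <= y <= Y -> mu <= g.[y].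
Proof.
move=> g0 gY crit y /andP[]; rewrite le_eqVlt => /orP[/eqP<- //|y0].
rewrite le_eqVlt => /orP[/eqP-> //|yY].
have [d0|dn] := eqVneq g^`().[y] 0; first by apply: crit => //; rewrite y0.
(* [g] is monotone between [y] and a neighbouring critical point or end. *)
have sgn z : {in `](Num.min y z), (Num.max y z)[, forall z, ~~ root g^`() z} ->
    forall c, Num.min y z < c < Num.max y z -> 0 < g^`().[y] * g^`().[c].
  move=> nr c /andP[c1 c2]; rewrite lt_def mulf_neq0 //=; last first.
    by have := nr c; rewrite in_itv /= c1 c2 => /(_ isT); rewrite rootE.
  rewrite leNgt; apply/negP => neg.
  have [yc|cy] := leP y c.
    have [r] := poly_ivtoo yc neg; rewrite in_itv /= => /andP[r1 r2].
    apply/negP; apply: nr; rewrite in_itv /= (lt_trans r2 c2) andbT.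
    by rewrite gt_min r1.
  rewrite mulrC in neg; have [r] := poly_ivtoo (ltW cy) neg.
  rewrite in_itv /= => /andP[r1 r2].
  by apply/negP; apply: nr; rewrite in_itv /= (lt_trans c1 r1) lt_max r2.
have [dp|dm] := ltP 0 g^`().[y].
  have [a [a0 ay ma nr]] : exists a, [/\ 0 <= a, a < y, mu <= g.[a] &
      {in `]a, y[, forall z, ~~ root g^`() z}].
    case: (prev_rootP g^`() 0 y) => [e|a _ da|a _ _] => [|aI nr|nr].
    - by rewrite e horner0 eqxx in dn.
    - move: aI; rewrite in_itv /= => /andP[a0 ay].
      exists a; split => //; first exact: ltW.
      by apply: crit => //; rewrite a0 (lt_trans ay).
    by exists 0; split.
  have [c] := poly_mvt g ay; rewrite in_itv /= => /andP[ac cy] e.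
  have := sgn a; rewrite min_r ?max_l ?(ltW ay) // => /(_ nr c).
  rewrite ac cy => /(_ isT); rewrite pmulr_rgt0 // => gc.
  apply: (le_trans ma); rewrite -subr_ge0 e mulr_ge0 ?(ltW gc) //.
  by rewrite subr_ge0 ltW.
have {dm} dm : g^`().[y] < 0 by rewrite lt_neqAle dn.
have [b [yb bY mb nr]] : exists b, [/\ y < b, b <= Y, mu <= g.[b] &
    {in `]y, b[, forall z, ~~ root g^`() z}].
  case: (next_rootP g^`() y Y) => [e|b _ db|b _ _] => [|bI nr|nr].
  - by rewrite e horner0 eqxx in dn.
  - move: bI; rewrite in_itv /= => /andP[yb bY].
    exists b; split => //; first exact: ltW.
    by apply: crit => //; rewrite bY (lt_trans y0).
  by exists Y; split.
have [c] := poly_mvt g yb; rewrite in_itv /= => /andP[yc cb] e.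
have := sgn b; rewrite min_l ?max_r ?(ltW yb) // => /(_ nr c).
rewrite yc cb => /(_ isT); rewrite nmulr_rgt0 // => gc.
apply: (le_trans mb); rewrite -subr_le0 e nmulr_rle0 //.
by rewrite subr_ge0 ltW.
Qed.

(** A nonconstant divisor of minimal degree plays the part of an irreducible factor. Over a domain,
    divisibility is up to scalars, so this means irreducible over the fraction field. *)
Lemma minimal_divisor (S : idomainType) (g : {poly S}) : g != 0 -> (1 < size g)%N ->
  exists P : {poly S}, [/\ (1 < size P)%N, P %| g &
    forall Q, Q %| P -> (1 < size Q)%N -> (size P <= size Q)%N].
Proof.
move=> g0; have [n] := ubnP (size g); elim: n g g0 => // n IH g g0 sg s1.
have [[Q [Qg Q1 lt]]|no] := pselect (exists Q, [/\ Q %| g, (1 < size Q)%N &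
    (size Q < size g)%N]); last first.
  exists g; split => // Q Qg Q1; rewrite leqNgt; apply/negP => lt.
  by apply: no; exists Q.
have Q0 : Q != 0 by rewrite -size_poly_gt0 ltnW.
have [|P [P1 PQ mP]] := IH Q Q0 _ Q1; first exact: leq_trans lt _.
by exists P; split => //; apply: dvdp_trans Qg.
Qed.

Section SquareFactor.
Variable R : numFieldType.
Implicit Types (f P G : {poly {poly R}}) (e p : {poly R}).

Lemma deriv_neq0 P : (1 < size P)%N -> P^`() != 0.
Proof.
move=> sP; apply/eqP => /(congr1 (fun Q : {poly _} => Q`_(size P).-2)).
rewrite coef_deriv coef0 -(subnK sP) !addn2 /=.
rewrite -scaler_nat => /eqP; rewrite scaler_eq0 pnatr_eq0 /=.
have -> : (size P - 2).+1 = (size P).-1 by rewrite -subn1; lia.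
by rewrite -lead_coefE lead_coef_eq0 -size_poly_eq0; case: (size P) sP.
Qed.

(** A minimal divisor [P] of gcd(f, f') is coprime to its own derivative. Writing f = q P up to a
    scalar, f' = q' P + q P' shows that P divides q. The scalar [e] is the price of division over
    R[x]. *)
Lemma square_factor_scaled f : f != 0 -> ~~ coprimep f f^`() ->
  exists e P G, [/\ e != 0, (1 < size P)%N & e *: f = P ^+ 2 * G].
Proof.
move=> f0 nc; pose g := gcdp f f^`().
have g0 : g != 0 by rewrite gcdp_eq0 (negPf f0).
have g1 : (1 < size g)%N.
  have : (0 < size g)%N by rewrite size_poly_gt0.
  by move: nc; rewrite coprimep_def -/g; case: (size g) => [|[]].
have [P [P1 Pg minP]] := minimal_divisor g0 g1.
have Pf : P %| f by apply: dvdp_trans Pg (dvdp_gcdl _ _).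
have Pf' : P %| f^`() by apply: dvdp_trans Pg (dvdp_gcdr _ _).
have P0 : P != 0 by rewrite -size_poly_gt0 ltnW.
have cop : coprimep P P^`().
  have d0 := deriv_neq0 P1.
  rewrite coprimep_def eqn_leq size_poly_gt0 gcdp_eq0 (negPf P0) andbT.
  rewrite leqNgt; apply/negP => /(minP _ (dvdp_gcdl _ _)); apply/negP; rewrite -ltnNge.
  apply: leq_ltn_trans (dvdp_leq d0 (dvdp_gcdr _ _)) _.
  exact: lt_size_deriv.
have [[c q] /= c0 qE] := Pdiv.WeakIdomain.dvdpP _ _ Pf.
have Pq : P %| q.
  have e : c *: f^`() = q^`() * P + q * P^`() by rewrite -derivZ qE derivM.
  rewrite -(Gauss_dvdpl q cop) -(dvdp_addr _ (dvdp_mull q^`() (dvdpp P))) -e.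
  by rewrite dvdpZr.
have [[d r] /= d0 rE] := Pdiv.WeakIdomain.dvdpP _ _ Pq.
exists (d * c), P, r; split; rewrite ?mulf_neq0 //.
by rewrite -scalerA qE scalerAl rE expr2 mulrC mulrA mulrAC -mulrA mulrC.
Qed.

(* Gauss's lemma for a divisor of minimal degree. *)
Lemma minimal_divisor_prime (p : {poly R}) P G :
  (forall q, q %| p -> (1 < size q)%N -> (size p <= size q)%N) -> (1 < size p)%N ->
  (forall i, p %| (P * G)`_i) -> (forall i, p %| P`_i) \/ (forall i, p %| G`_i).
Proof.
move=> minp p1 h.
have prime a b : p %| a * b -> p %| a \/ p %| b.
  move=> pab; have p0 : p != 0 by rewrite -size_poly_gt0 ltnW.
  have [cop|nc] := boolP (coprimep p a).
    by right; rewrite -(Gauss_dvdpr b cop).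
  left; have g1 : (1 < size (gcdp p a))%N.
    have : (0 < size (gcdp p a))%N by rewrite size_poly_gt0 gcdp_eq0 (negPf p0).
    by move: nc; rewrite coprimep_def; case: (size _) => [|[]].
  have := minp _ (dvdp_gcdl p a) g1 => le.
  have : gcdp p a %= p.
    by rewrite -dvdp_size_eqp ?dvdp_gcdl // eqn_leq le dvdp_leq // dvdp_gcdl.
  by move=> /eqp_dvdl <-; apply: dvdp_gcdr.
have [hP|nP] := pselect (forall i, p %| P`_i); [by left|right=> j0].
have {nP} exP : exists i, ~~ (p %| P`_i).
  by apply: contrapT => no; apply: nP => i; apply: contrapT => ni; apply: no; exists i; apply/negP.
apply: contrapT => nG0; have exG : exists j, ~~ (p %| G`_j) by exists j0; apply/negP.
case: (ex_minnP exP) => i ni mini; case: (ex_minnP exG) => j nj minj.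
have ij : (i < (i + j).+1)%N by rewrite ltnS leq_addr.
have := h (i + j)%N; rewrite coefM (bigD1 (Ordinal ij)) //= addKn => dv.
have : p %| P`_i * G`_j.
  rewrite -(dvdp_addl _ (_ : p %| \sum_(k < (i + j).+1 | k != Ordinal ij)
      P`_k * G`_(i + j - k))) //.
  elim/big_ind: _ => [|u v|k nk]; [exact: dvdp0|exact: dvdp_add|].
  have ki : nat_of_ord k != i by move: nk; rewrite -val_eqE.
  have [lt|le] := ltnP k i.
    by apply: dvdp_mulr; apply: contraTT lt => /mini; rewrite -leqNgt.
  apply: dvdp_mull; apply: contraT => /minj.
  have kb := ltn_ord k; lia.
by move=> /prime[]; apply/negP.
Qed.

Lemma dvd_coefs_lead (P : {poly {poly R}}) x : (forall i, (P`_i).[x] = 0) ->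
  exists P1, P = ('X - x%:P)%:P * P1.
Proof. by move=> h; apply: dvd_coefs => i; rewrite dvdp_XsubCl rootE h. Qed.

(** The scalar is cancelled one minimal divisor at a time; then common zeros of the coefficients of
    [P] are moved into [G], which ends because the leading coefficient of [P] loses degree. *)
Lemma square_factor f : f != 0 -> ~~ coprimep f f^`() ->
  exists P G, [/\ (1 < size P)%N, f = P ^+ 2 * G & forall x, exists i, (P`_i).[x] != 0].
Proof.
move=> f0 nc; have [e [P [G [e0 P1 eE]]]] := square_factor_scaled f0 nc.
have {nc e e0 P G P1 eE} [P [G [P1 fE]]] : exists P G, (1 < size P)%N /\ f = P ^+ 2 * G.
  have [n] := ubnP (size e); elim: n e e0 P G P1 eE => // n IH e e0 P G P1 eE se.
  have [/size1_polyC ec|e1] := leqP (size e) 1.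
    have c0 : e`_0 != 0 by apply: contraNneq e0 => c0; rewrite ec c0.
    exists P, ((e`_0)^-1%:P *: G); split => //.
    rewrite -scalerAr -eE scalerA ec -polyCM coefC /= mulVf //.
    by rewrite scale1r.
  have [p [p1 pe minp]] := minimal_divisor e0 e1.
  have p0 : p != 0 by rewrite -size_poly_gt0 ltnW.
  have /dvdpP[e' e'E] := pe.
  have e'0 : e' != 0 by apply: contraNneq e0 => z; rewrite e'E z mul0r.
  have se' : (size e' < n)%N.
    move: se; rewrite e'E size_mul //; move: p1; move: (size _) (size _); lia.
  have pc i : p %| (P ^+ 2 * G)`_i by rewrite -eE coefZ e'E mulrAC dvdp_mulIr.
  have pz : p%:P != 0 :> {poly {poly R}} by rewrite polyC_eq0.
  have peE : p%:P * (e' *: f) = e *: f by rewrite mul_polyC scalerA mulrC -e'E.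
  (* If [p] divides [P], the square supplies two factors [p]: one cancels against [e], the other
     goes into [G]. *)
  have [pP|pG] : (forall i, p %| P`_i) \/ (forall i, p %| G`_i).
  - have [|] := minimal_divisor_prime minp p1 pc; last by right.
    by rewrite expr2 => /(minimal_divisor_prime minp p1)[]; left.
  - have [Q PE] := dvd_coefs pP; apply: (IH e' e'0 Q (p%:P * G)) => //.
      by rewrite -(size_scale Q p0) -mul_polyC -PE.
    apply: (mulfI pz); rewrite peE eE PE; ring.
  have [Q GE] := dvd_coefs pG; apply: (IH e' e'0 P Q) => //.
  apply: (mulfI pz); rewrite peE eE GE; ring.
have [n] := ubnP (size (lead_coef P)); elim: n P G P1 fE => // n IH P G P1 fE sl.
have [[x Px]|no] := pselect (exists x, forall i, (P`_i).[x] = 0); last first.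
  exists P, G; split => // x; apply: contrapT => nx; apply: no; exists x => i.
  by apply/eqP; apply: contrapT => /negP ni; apply: nx; exists i.
have [Q PE] := dvd_coefs_lead Px.
have Q1 : (1 < size Q)%N by move: P1; rewrite PE mul_polyC size_scale // polyXsubC_eq0.
apply: (IH Q (('X - x%:P)%:P ^+ 2 * G) Q1); first by rewrite fE PE; ring.
have l0 : lead_coef Q != 0 by rewrite lead_coef_eq0 -size_poly_gt0 ltnW.
move: sl; rewrite PE mul_polyC lead_coefZ size_mul ?polyXsubC_eq0 // size_XsubC.
by rewrite addnC addn2.
Qed.

End SquareFactor.

Lemma geom_le (R : realFieldType) D (y z : R) : 0 <= y <= z -> 1 <= z ->
  \sum_(i < D.+1) y ^+ i <= D.+1%:R * z ^+ D.
Proof.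
move=> /andP[y0 yz] z1.
rewrite mulr_natl -[X in _ *+ X]card_ord -sumr_const; apply: ler_sum => i _.
apply: le_trans (_ : z ^+ i <= _); last by apply: ler_weXn2l; rewrite // -ltnS.
by apply: lerXn2r; rewrite ?nnegrE // (le_trans y0).
Qed.

Lemma bezout_coprime (S : idomainType) (f g : {poly S}) : coprimep f g ->
  exists u v c, c != 0 /\ u * f + v * g = c%:P.
Proof.
rewrite coprimep_def => /size_poly1P[g0 g00 gE].
have [[u v] /= e] := Pdiv.CommonIdomain.Bezoutp f g.
have := Pdiv.CommonIdomain.eqpP _ _ e.
rewrite gE => -[[c1 c2] /= /andP[c10 c20] h].
exists (c1%:P * u), (c1%:P * v), (c2 * g0); rewrite mulf_neq0 //; split => //.
by rewrite -!mulrA -mulrDr mul_polyC h -mul_polyC polyCM.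
Qed.

(** * The lower bound for squarefree polynomials *)

Section LowerBound.
Variables (R : realType) (U : R -> Prop) (A B : R).
Hypothesis UAB : forall x, U x -> A < x < B.

(** Beyond 2 K^2 / p, the lower terms, at most K^2 y^(D-1) in total, take no more than half of the
    leading term. *)
Lemma large_argument (g : {poly R}) D (K p y : R) : size g = D.+1 -> 1 <= K ->
  D.+1%:R <= K -> (forall i, `|g`_i| <= K) -> 0 < p <= g`_D ->
  2%:R * K ^+ 2 / p <= y -> p / 2%:R * y ^+ D <= g.[y].
Proof.
move=> sg K1 DK gK /andP[p0 pl] Yy.
have pK : p <= K by apply: (le_trans pl); apply: le_trans (gK D); exact: ler_norm.
have K0 : 0 < K by apply: lt_le_trans K1.
have y1 : 1 <= y.
  apply: le_trans Yy; rewrite ler_pdivlMr // mul1r; apply: (le_trans pK); nra.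
have y0 : 0 <= y by apply: le_trans y1.
have py : 2%:R * K ^+ 2 <= p * y by rewrite [p * y]mulrC -ler_pdivrMr.
rewrite horner_coef sg big_ord_recr /=.
case: D sg DK pl => [|D] sg DK pl.
  by rewrite big_ord0 add0r expr0 !mulr1; lra.
have low : - (K ^+ 2 * y ^+ D) <= \sum_(i < D.+1) g`_i * y ^+ i.
  rewrite lerNl -sumrN; apply: le_trans (_ : \sum_(i < D.+1) K * y ^+ D <= _).
    apply: ler_sum => i _; apply: le_trans (_ : K * y ^+ i <= _).
      rewrite -mulNr; apply: ler_wpM2r; first exact: exprn_ge0.
      by apply: le_trans (gK i); rewrite -normrN ler_norm.
    by apply: ler_wpM2l; [apply: ltW|apply: ler_weXn2l; rewrite // -ltnS].
  rewrite sumr_const card_ord -mulr_natl mulrA; apply: ler_wpM2r.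
    exact: exprn_ge0.
  rewrite expr2; apply: ler_wpM2r; first exact: ltW.
  by apply: le_trans DK; rewrite ler_nat.
have yD : 0 <= y ^+ D by apply: exprn_ge0.
rewrite exprS; have : p * y * y ^+ D <= g`_D.+1 * (y * y ^+ D).
  by rewrite -mulrA; apply: ler_wpM2r => //; apply: mulr_ge0.
have : 2%:R * K ^+ 2 * y ^+ D <= p * y * y ^+ D by apply: ler_wpM2r.
lra.
Qed.

(* At a critical point [s] of [f(x, -)] the Bezout relation [u f + v f' = c] gives
   [f(x, s) = c(x) / u(x, s)]. *)
Lemma squarefree_lower_bound (f : {poly {poly R}}) : f`_0 != 0 ->
  coprimep f f^`() -> (forall x y, U x -> 0 <= y -> 0 <= ev2 f x y) ->
  exists2 w, w != 0 & lower_bound U f w (size f).-1.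
Proof.
move=> f0 cop pos; have [u [v [c [c0 bez]]]] := bezout_coprime cop.
have fn0 : f != 0 by apply: contraNneq f0 => ->; rewrite coef0.
set D := (size f).-1; have sf : size f = D.+1 by rewrite prednK // size_poly_gt0.
have lE : f`_D = lead_coef f by [].
pose m := size u; pose l := f`_D.
have l0 : l != 0 by rewrite /l lE lead_coef_eq0.
have [K1 K10 hK1] := coefs_bound UAB f.
have [K2 K20 hK2] := coefs_bound UAB u.
have [K3 K30 hK3] := U_bound UAB c.
pose K := K1 + K2 + K3 + D.+1%:R + m.+1%:R.
have Dp : 1 <= D.+1%:R :> R by rewrite ler1n.
have mp : 1 <= m.+1%:R :> R by rewrite ler1n.
have Kge : [/\ K1 <= K, K2 <= K, K3 <= K, D.+1%:R <= K & m.+1%:R <= K].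
  by rewrite /K; split; lra.
have [k1 k2 k3 kD km] := Kge; have K_1 : 1 <= K by lra.
move: K k1 k2 k3 kD km K_1 {Kge} => K k1 k2 k3 kD km K_1.
have K0 : 0 < K by lra.
(* Where [P] does not vanish, the fibre of [f] has a nonzero value at y = 0, full degree [D], and a
   nonzero Bezout constant: the three quantities that bound its minimum. *)
pose P := f`_0 * c * l; pose N := (m + D).+1.
have P0 : P != 0 by rewrite !mulf_neq0.
exists (P ^+ N); first exact: expf_neq0.
(* With Y p = 2 K^2, the estimate on [[0, Y]] needs 2 K^3 (p Y)^(m + D), which is exactly [E]; this
   also explains the exponent [N]. *)
pose E := 2%:R * K ^+ 3 * (2%:R * K ^+ 2) ^+ (m + D).
have E0 : 0 < E by rewrite /E !mulr_gt0 ?exprn_gt0 // mulr_gt0 ?exprn_gt0.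
exists (E^-1 / (K ^+ 3) ^+ N.*2) => [|x y Ux y0].
  by rewrite divr_gt0 ?invr_gt0 ?exprn_gt0.
have [Px|Px] := eqVneq P.[x] 0.
  by rewrite horner_exp Px expr0n expr0n mulr0 mul0r; apply: pos.
(* Each of the three factors of [P] is at most [K] in absolute value, so [p] bounds each of them
   from below, and p <= 1. *)
pose p := `|P.[x]| / K ^+ 3.
have p0 : 0 < p by rewrite divr_gt0 ?normr_gt0 ?exprn_gt0.
pose g := fibre x f.
have gE z : g.[z] = ev2 f x z by rewrite fibreE.
have gc i : g`_i = (f`_i).[x] by rewrite coef_fibre.
have gK i : `|g`_i| <= K by rewrite gc; apply: le_trans (hK1 x i Ux) k1.
have uK i : `|(u`_i).[x]| <= K by apply: le_trans (hK2 x i Ux) k2.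
have cK : `|c.[x]| <= K by apply: le_trans (hK3 x Ux) k3.
have g_ge0 z : 0 <= z -> 0 <= g.[z] by move=> z0; rewrite gE pos.
have pE : p * K ^+ 3 = `|g`_0| * `|c.[x]| * `|g`_D|.
  by rewrite /p divfK ?expf_neq0 ?gt_eqF // /P !hornerM !normrM !gc.
have a_ge : p <= `|g`_0| /\ p <= `|g`_D| /\ p <= `|c.[x]| /\ p <= 1.
  have := gK 0%N; have := gK D; have := cK; move: pE.
  have := normr_ge0 g`_0; have := normr_ge0 g`_D; have := normr_ge0 c.[x].
  move: `|g`_0| `|g`_D| `|c.[x]| => b d a a0 d0 b0 pE aK dK bK.
  have K3' : 0 < K ^+ 3 by apply: exprn_gt0.
  have KK : 0 < K ^+ 2 by apply: exprn_gt0.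
  have le3 (a1 b1 d1 : R) : 0 <= a1 -> 0 <= b1 -> 0 <= d1 -> b1 <= K -> d1 <= K ->
      a1 * b1 * d1 <= a1 * K ^+ 3.
    move=> a10 b10 d10 b1K d1K; rewrite -mulrA; apply: ler_wpM2l => //.
    apply: le_trans (_ : K * K <= _); first exact: ler_pM.
    by rewrite exprSr expr2 ler_peMr // mulr_ge0 // ltW.
  have h2 : p <= b by rewrite -(ler_pM2r K3') pE; apply: le3.
  have h1 : p <= d.
    by rewrite -(ler_pM2r K3') pE (_ : b * a * d = d * a * b); [apply: le3|ring].
  have h3 : p <= a.
    by rewrite -(ler_pM2r K3') pE (_ : b * a * d = a * b * d); [apply: le3|ring].
  have h4 : p <= 1.
    rewrite -(ler_pM2r K3') pE mul1r exprSr expr2.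
    by apply: ler_pM => //; [apply: mulr_ge0|apply: ler_pM].
  by [].
move: a_ge => [pa [pl [pc p1]]].
have ga : p <= g.[0] by rewrite horner_coef0; move: pa; rewrite ger0_norm // -horner_coef0 g_ge0.
have gl : p <= g`_D.
  move: pl; rewrite ger0_norm //; apply: coef_top_ge0 => //.
  by rewrite -sf; apply: size_poly.
have sg : size g = D.+1.
  apply/eqP; rewrite eqn_leq -{1}sf size_poly /= ltnNge.
  by apply/negP => h; move: gl; rewrite nth_default // leNgt p0.
pose Y := 2%:R * K ^+ 2 / p.
have big z : Y <= z -> p / 2%:R * z ^+ D <= g.[z].
  by apply: (large_argument sg K_1 kD gK); rewrite p0.
have K2_1 : 1 <= K ^+ 2 by apply: exprn_ege1.
have Y1 : 1 <= Y.
  by rewrite ler_pdivlMr // mul1r (le_trans p1) // mulr_ege1 // ler1n.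
have Y0 : 0 < Y by apply: lt_le_trans Y1.
have Ym : 1 <= Y ^+ m by apply: exprn_ege1.
have YD : 1 <= Y ^+ D by apply: exprn_ege1.
(* At a critical point in [[0, Y]] the Bezout cofactor [u] is at most K^2 Y^m in absolute value; the
   factor 2 also covers the value p / 2 at the end [Y]. *)
pose M := 2%:R * K ^+ 2 * Y ^+ m.
have M2 : 2%:R <= M.
  by rewrite /M -mulrA ler_peMr // mulr_ege1.
have M0 : 0 < M by apply: lt_le_trans M2.
have small z : 0 <= z <= Y -> p / M <= g.[z].
  apply: poly_ge_critical => [||s /andP[s0 sY] ds].
  - apply: le_trans ga; rewrite ler_pdivrMr // ler_peMr ?(ltW p0) //.
    by apply: le_trans M2; rewrite ler1n.
  - apply: le_trans (big Y (lexx Y)); apply: le_trans (_ : p / 2%:R <= _).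
      by rewrite ler_pM2l // lef_pV2 ?posrE.
    by rewrite ler_peMr // divr_ge0 // ltW.
  have bezx : c.[x] = ev2 u x s * g.[s].
    have -> : c.[x] = ev2 c%:P x s by rewrite /ev2 hornerC.
    rewrite -bez.
    rewrite ev2E evD !evM -!ev2E gE -[ev2 f^`() x s]fibreE.
    by rewrite [fibre _ _](_ : _ = g^`()) ?ds ?mulr0 ?addr0 // /g /fibre deriv_map.
  have ub : `|ev2 u x s| <= K ^+ 2 * Y ^+ m.
    apply: le_trans (ev2_le_geom (leqnSn _) (ltW s0) uK) _.
    rewrite expr2 -mulrA; apply: ler_wpM2l; first exact: ltW.
    apply: le_trans (@geom_le _ m s Y _ Y1) _; first by rewrite !ltW.
    by apply: ler_wpM2r => //; apply: le_trans Ym.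
  rewrite ler_pdivrMr //; apply: (le_trans pc); rewrite bezx normrM.
  have gs : 0 <= g.[s] by apply: g_ge0; apply: ltW.
  rewrite (ger0_norm gs) [X in X <= _]mulrC; apply: (ler_wpM2l gs); apply: (le_trans ub).
  rewrite /M -mulrA; apply: ler_peMl; last by rewrite ler1n.
  by apply: mulr_ge0; [apply/ltW/exprn_gt0|apply: le_trans Ym].
have main : p ^+ N * (\sum_(i < D.+1) y ^+ i) <= E * g.[y].
  have pn0 : 0 <= p ^+ (m + D) by apply/exprn_ge0/ltW.
  have [yY|Yy] := leP y Y.
    have yI : 0 <= y <= Y by rewrite y0.
    have h := small y yI; have h2 := geom_le D yI Y1.
    apply: le_trans (_ : E * (p / M) <= _); last by rewrite ler_pM2l.
    apply: le_trans (_ : p ^+ N * (K * Y ^+ D) <= _).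
      apply: ler_wpM2l; first exact/exprn_ge0/ltW.
      by apply: (le_trans h2); apply: ler_wpM2r => //; apply: le_trans YD.
    rewrite /E /M /N exprS.
    have -> : 2%:R * K ^+ 2 = Y * p by rewrite /Y divfK // gt_eqF.
    rewrite [(Y * p) ^+ _]exprMn [Y ^+ (m + D)]exprD le_eqVlt; apply/orP; left; apply/eqP.
    rewrite [K ^+ 3](_ : _ = K ^+ 2 * K); last by rewrite exprSr.
    have -> : 2%:R * (K ^+ 2 * K) = Y * p * K by rewrite mulrA /Y divfK // gt_eqF.
    have Yn : Y ^+ m != 0 by rewrite expf_neq0 // gt_eqF.
    have Yn0 : Y != 0 by rewrite gt_eqF.
    have pn : p != 0 by rewrite gt_eqF.
    clear - Yn Yn0 pn; clearbody Y p; by field; rewrite Yn0 pn Yn.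
  have yI : 0 <= y <= y by rewrite y0 lexx.
  have h := big y (ltW Yy); have h2 := geom_le D yI (le_trans Y1 (ltW Yy)).
  have yn : 0 <= y ^+ D by apply: exprn_ge0.
  apply: le_trans (_ : E * (p / 2%:R * y ^+ D) <= _); last by rewrite ler_pM2l.
  apply: le_trans (_ : p * (K * y ^+ D) <= _).
    apply: ler_pM; [exact/exprn_ge0/ltW|exact: geom_ge0| |].
      by rewrite /N exprS ler_piMr ?(ltW p0) // exprn_ile1 // ltW.
    by apply: (le_trans h2); apply: ler_wpM2r => //; lra.
  rewrite [X in _ <= X](_ : _ = p * (E / 2%:R * y ^+ D)); last by field.
  rewrite ler_pM2l // ; apply: ler_wpM2r => //; rewrite /E.
  have e1 : 1 <= (2%:R * K ^+ 2) ^+ (m + D) by apply: exprn_ege1; rewrite mulr_ege1 // ler1n.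
  have e3 : K <= K ^+ 3 by rewrite exprSr ler_peMl // ltW.
  have e4 : 0 < K ^+ 3 by apply: exprn_gt0.
  apply: (le_trans e3); rewrite mulrAC [2%:R * _]mulrC mulfK ?pnatr_eq0 //.
  by rewrite ler_peMr // ltW.
rewrite -gE horner_exp -(exprM P.[x] N 2) muln2.
apply: le_trans (_ : E^-1 * (p ^+ N * (\sum_(i < D.+1) y ^+ i)) <= _); last first.
  by rewrite ler_pdivrMl.
have key : (K ^+ 3) ^- N.*2 * P.[x] ^+ N.*2 <= p ^+ N.
  have <- : p ^+ N.*2 = (K ^+ 3) ^- N.*2 * P.[x] ^+ N.*2.
    rewrite /p exprMn exprVn mulrC; congr (_ * _).
    by rewrite -muln2 mulnC !(exprM _ 2) real_normK ?num_real.
  apply: ler_wiXn2l => //; first exact: ltW.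
  by rewrite -addnn leq_addr.
move: (P.[x] ^+ N.*2) ((K ^+ 3) ^+ N.*2) key => s t key.
rewrite -!mulrA ler_pM2l ?invr_gt0 // mulrA; apply: ler_wpM2r => //.
exact: geom_ge0.
Qed.

End LowerBound.

Section Induction.
Variables (R : realType) (U : R -> Prop) (T : {poly {poly R}} -> Prop) (A B : R).
Hypotheses (cT : is_cone T) (TY : T 'X) (UAB : forall x, U x -> A < x < B).
Hypothesis lower_bound_T : forall (f : {poly {poly R}}) (w : {poly R}) D,
  w != 0 -> (size f <= D.+1)%N -> lower_bound U f w D -> T f.

Lemma nonneg_cone (f : {poly {poly R}}) :
  (forall x y, U x -> 0 <= y -> 0 <= ev2 f x y) -> T f.
Proof.
have [TD TM Tsq] := cT.
have [n] := ubnP (size f); elim: n f => // n IH f sf pos.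
have [->|f0] := eqVneq f 0; first exact: cone0.
have [f00|f00] := eqVneq f`_0 0.
  have /factor_theorem[g fE] : root f 0 by rewrite /root horner_coef0 f00.
  rewrite subr0 in fE; rewrite fE; apply: TM => //; apply: IH.
    have g0 : g != 0 by apply: contraNneq f0 => g0; rewrite fE g0 mul0r.
    by move: sf; rewrite fE size_mulX.
  have g_ge0 x y : U x -> 0 < y -> 0 <= ev2 g x y.
    move=> Ux y0; have := pos x y Ux (ltW y0).
    by rewrite fE -!fibreE rmorphM hornerM /= /fibre map_polyX hornerX pmulr_lge0.
  move=> x y Ux; rewrite le_eqVlt => /orP[/eqP<-|y0]; last exact: g_ge0.
  rewrite -fibreE; apply: (poly_right_limit ltr01) => s /andP[s0 _].
  by rewrite add0r fibreE; apply: g_ge0.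
have [cop|ncop] := boolP (coprimep f f^`()).
  have [w w0 lb] := squarefree_lower_bound UAB f00 cop pos.
  by apply: lower_bound_T lb; rewrite // leqSpred.
have [P [G [P1 fE Pn]]] := square_factor f0 ncop.
rewrite fE; apply: TM => //; apply: IH.
  have G0 : G != 0 by apply: contraNneq f0 => G0; rewrite fE G0 mulr0.
  have P0 : P != 0 by rewrite -size_poly_gt0 (leq_trans _ P1).
  move: sf; rewrite fE expr2 !size_mul ?mulf_neq0 //.
  move: (size P) (size G) P1 => r s {}P1; lia.
(* [P] vanishes identically on no fibre, so its square can be divided out fibre by fibre. *)
move=> x y Ux y0; rewrite -fibreE; move: y y0.
have [i Pi] := Pn x.
apply: (@sqr_mul_ge0 _ (fibre x P)) => [|y y0].
  by apply: contraNneq Pi => h; rewrite -coef_fibre h coef0.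
by rewrite -rmorphXn -rmorphM -fE fibreE; apply: pos.
Qed.

End Induction.

(** * The natural generators *)

Lemma uniform_eps (R : realFieldType) (I : eqType) (l : seq I) (P : I -> R -> Prop) :
  (forall i e e', 0 < e' <= e -> P i e -> P i e') ->
  (forall i, i \in l -> exists2 e, 0 < e & P i e) ->
  exists2 e, 0 < e & forall i, i \in l -> P i e.
Proof.
move=> mono; elim: l => [|j l IH] h; first by exists 1.
have [e e0 Pe] := h j (mem_head _ _).
have [|e' e'0 Pe'] := IH; first by move=> i il; apply: h; rewrite inE il orbT.
have m0 : 0 < Num.min e e' by rewrite lt_min e0.
exists (Num.min e e') => // i; rewrite inE => /orP[/eqP->|il].
  by apply: mono Pe; rewrite m0 ge_min lexx.
by apply: mono (Pe' i il); rewrite m0 ge_min lexx orbT.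
Qed.

Lemma positive_min (R : realType) (g : {poly R}) (c d : R) : c <= d ->
  (forall x, c <= x <= d -> 0 < g.[x]) ->
  exists2 e, 0 < e & forall x, c <= x <= d -> e <= g.[x].
Proof.
move=> cd pos; pose h := g \Po ('X + c%:P); pose Y := d - c.
have hE x : h.[x] = g.[x + c] by rewrite horner_comp !hornerE.
have hpos x : 0 <= x <= Y -> 0 < h.[x].
  by move=> xY; rewrite hE pos //; move: xY; rewrite /Y; lra.
have Y0 : 0 <= Y by rewrite subr_ge0.
suff [e e0 he] : exists2 e, 0 < e & forall x, 0 <= x <= Y -> e <= h.[x].
  by exists e => // x xcd; rewrite -(subrK c x) -hE he // /Y; lra.
have [s1|s1] := leqP (size h) 1.
  exists h.[0]; first by apply: hpos; rewrite lexx.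
  by move=> x _; rewrite (size1_polyC s1) !hornerC.
have h'0 : h^`() != 0 by rewrite -size_poly_gt0 size_deriv; case: (size h) s1.
have [||e e0 he] := @uniform_eps R R [:: 0, Y & roots h^`() 0 Y] (fun s e => e <= h.[s]).
- by move=> s e e' /andP[_ ee] /(le_trans ee).
- move=> s sl; exists h.[s]; rewrite ?lexx //; apply: hpos; move: sl.
  rewrite !inE => /or3P[/eqP->|/eqP->|/roots_in]; rewrite ?lexx ?Y0 //.
  by rewrite in_itv /= => /andP[s0 sY]; rewrite !ltW.
exists e => // x xY; apply: (@poly_ge_critical _ h Y) (xY).
- by apply: he; rewrite inE eqxx.
- by apply: he; rewrite !inE eqxx orbT.
move=> s sY hs; apply: he; rewrite !inE; apply/or3P/Or33.
by rewrite root_in_roots // ?in_itv //; apply/eqP.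
Qed.

Section Intervals.
Variables (R : realType) (k : nat) (a b : nat -> R).
Hypotheses (k0 : (0 < k)%N) (ab : forall i, (i < k)%N -> a i <= b i)
  (ba : forall i, (i.+1 < k)%N -> b i < a i.+1).
Let U := in_U k a b.

Lemma in_U_bounds x : U x -> a 0%N <= x <= b k.-1.
Proof.
move=> [i ik /andP[ai ib]]; have ik' : (i <= k.-1)%N by rewrite -ltnS prednK.
have kk : (k.-1 < k)%N by rewrite prednK.
have [_ h1] := endpoints_mono ab ba (leq0n i) ik.
have [h2 _] := endpoints_mono ab ba ik' kk.
by rewrite (le_trans h1) // (le_trans ib).
Qed.

Lemma in_U_compact (p : {poly R}) : (forall x, U x -> 0 < p.[x]) ->
  exists2 e, 0 < e & forall x, U x -> e <= p.[x].
Proof.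
move=> pos.
have [||e e0 he] := @uniform_eps R nat (iota 0 k)
  (fun i e => forall x, a i <= x <= b i -> e <= p.[x]).
- by move=> i e e' /andP[_ ee] h x /h; apply: le_trans.
- move=> i; rewrite mem_iota => ik; apply: positive_min; first exact: ab.
  by move=> x xi; apply: pos; exists i.
by exists e => // x [i ik]; apply: he; rewrite mem_iota.
Qed.

(** Take the point of U nearest to [x]; the factor 2 is the triangle inequality. It replaces
    Bernstein nodes outside U by sample points in U. *)
Lemma in_U_near x : exists2 x', U x' & forall u, U u -> `|x' - u| <= 2%:R * `|x - u|.
Proof.
have [xU|xU] := pselect (U x).
  by exists x => // u _; rewrite ler_peMl // ler1n.
have kk : (k.-1 < k)%N by rewrite prednK.
case: (gap_cases k0 xU) => [xa|bx|[i ik /andP[bx xa]]].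
- exists (a 0%N); first by exists 0%N; rewrite // lexx ab.
  move=> u /in_U_bounds/andP[au _].
  by rewrite !ler0_norm ?subr_le0 //; lra.
- exists (b k.-1); first by exists k.-1; rewrite // lexx ab.
  move=> u /in_U_bounds/andP[_ ub].
  by rewrite !ger0_norm ?subr_ge0 //; lra.
have Ub : U (b i) by exists i; [exact: ltnW|rewrite lexx ab // ltnW].
have Ua : U (a i.+1) by exists i.+1; rewrite // lexx ab.
have side := gap_sides ab ba ik.
have [h|h] := leP (x - b i) (a i.+1 - x).
  exists (b i) => // u /side[ub|au]; first by rewrite !ger0_norm ?subr_ge0 //; lra.
  by rewrite !ler0_norm ?subr_le0 //; lra.
exists (a i.+1) => // u /side[ub|au]; first by rewrite !ger0_norm ?subr_ge0 //; lra.
by rewrite !ler0_norm ?subr_le0 //; lra.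
Qed.

Variable T : {poly {poly R}} -> Prop.
Hypotheses (cT : is_cone T) (Tl : T ('X - (a 0%N)%:P)%:P) (Tr : T ((b k.-1)%:P - 'X)%:P)
  (Tg : forall i, (i.+1 < k)%N -> T (('X - (a i.+1)%:P) * ('X - (b i)%:P))%:P).

Lemma left_generator i : (i < k)%N ->
  exists v : {poly R}, 0 < v.[a i] /\ T (('X - (a i)%:P) * v)%:P.
Proof.
case: i => [|i] ik; first by exists 1; rewrite hornerC mulr1.
by exists ('X - (b i)%:P); rewrite !hornerE subr_gt0 ba //; split => //; apply: Tg.
Qed.

Lemma right_generator i : (i < k)%N ->
  exists v : {poly R}, v.[b i] < 0 /\ T (('X - (b i)%:P) * v)%:P.
Proof.
move=> ik; have [ik1|ki] := ltnP i.+1 k.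
  exists ('X - (a i.+1)%:P); rewrite !hornerE subr_lt0 ba //; split => //.
  by rewrite mulrC; apply: Tg.
have -> : i = k.-1 by lia.
by exists (-1); rewrite !hornerE oppr_lt0 ltr01 mulrN1 opprB; split.
Qed.

(** At an end of a component, the interval weight agrees to any order with the generator vanishing
    there times a square. At an interior point the weight is positive, hence a square modulo powers.
    A component reduced to a point has generators of both signs. *)
Lemma in_U_local x0 : U x0 -> isolated_at T x0 \/ thick_at U T x0.
Proof.
have [TD TM Tsq] := cT.
move=> [i ik /andP[ax xb]].
have [vL [vL0 TL]] := left_generator ik; have [vR [vR0 TR]] := right_generator ik.
have := ab ik; rewrite le_eqVlt => /orP[/eqP abE|abi].
  left; have xa : x0 = a i by apply/eqP; rewrite eq_le ax {1}abE xb.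
  by exists vL, vR; rewrite xa; split=> //; rewrite abE.
right; exists (a i), (b i); split => //; first by rewrite ax.
  by move=> x xi; exists i.
move=> M; rewrite /itv_poly.
have [xa|xa] := eqVneq x0 (a i).
  have [|e he] := @ratio_mod _ ((b i)%:P - 'X) vL x0 M.
    by rewrite !hornerE mulr_gt0 ?xa // subr_gt0.
  exists (('X - (a i)%:P) * vL * e ^+ 2).
    by rewrite polyCM polyC_exp; apply: TM.
  by rewrite -mulrA -mulrBr; apply: dvdp_mull.
have [xb'|xb'] := eqVneq x0 (b i).
  have [|e he] := @ratio_mod _ (- ('X - (a i)%:P)) vR x0 M.
    by rewrite !hornerE nmulr_rgt0 ?xb' // oppr_lt0 subr_gt0.
  exists (('X - (b i)%:P) * vR * e ^+ 2).
    by rewrite polyCM polyC_exp; apply: TM.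
  rewrite -mulrA (_ : ('X - _) * (_ - 'X) = ('X - (b i)%:P) * - ('X - (a i)%:P)); last by ring.
  by rewrite -mulrBr; apply: dvdp_mull.
have [|e he] := @sqrt_mod _ (('X - (a i)%:P) * ((b i)%:P - 'X)) x0 M.
  by rewrite !hornerE mulr_gt0 // subr_gt0 lt_neqAle ?xb ?ax andbT // eq_sym.
by exists (e ^+ 2); rewrite // polyC_exp; apply: Tsq.
Qed.

End Intervals.

(** * Closure properties of the preordering *)

Section Preordering.
Variables (R : comNzRingType) (S : seq {poly {poly R}}).
Let prodS (E : {set 'I_(size S)}) := \prod_(i in E) S`_i.

Lemma preordering_term (s : {poly {poly R}}) E : is_sos s ->
  in_preordering S (s * prodS E).
Proof.
move=> ss; exists (fun F => if F == E then s else 0); split.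
  by move=> F; case: eqP => // _; apply: sos0.
rewrite (bigD1 E) //= eqxx [X in _ = _ + X]big1 ?addr0 // => F /negPf->.
by rewrite mul0r.
Qed.

Lemma preorderingD f g : in_preordering S f -> in_preordering S g ->
  in_preordering S (f + g).
Proof.
move=> [s [ss ->]] [t [ts ->]]; exists (fun E => s E + t E); split.
  by move=> E; apply: sosD.
by rewrite -big_split; apply: eq_bigr => E _; rewrite mulrDl.
Qed.

Lemma preordering_sos (s : {poly {poly R}}) : is_sos s -> in_preordering S s.
Proof. by move=> /preordering_term-/(_ finset.set0); rewrite /prodS big_set0 mulr1. Qed.

Lemma preordering_sum (I : finType) (F : I -> {poly {poly R}}) :
  (forall i, in_preordering S (F i)) -> in_preordering S (\sum_i F i).
Proof.
move=> h; elim/big_ind: _ => // [|f g]; last exact: preorderingD.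
by apply/preordering_sos/sos0.
Qed.

(** Common generators occur squared, and the symmetric difference indexes what is left; this is why
    subsets suffice as exponents. *)
Lemma prodS_mul E F :
  prodS E * prodS F = prodS (E :&: F) ^+ 2 * prodS ((E :\: F) :|: (F :\: E)).
Proof.
have sp A B : prodS A = prodS (A :&: B) * prodS (A :\: B).
  by rewrite /prodS [LHS](big_setID B).
rewrite (sp E F) (sp F E) (sp (_ :|: _) E) [F :&: E]finset.setIC.
have -> : (E :\: F :|: F :\: E) :&: E = E :\: F.
  by apply/finset.setP => x; rewrite !inE; case: (x \in E); case: (x \in F).
have -> : (E :\: F :|: F :\: E) :\: E = F :\: E.
  by apply/finset.setP => x; rewrite !inE; case: (x \in E); case: (x \in F).
ring.
Qed.

Lemma preordering_cone : is_cone (in_preordering S).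
Proof.
split; first exact: preorderingD; last by move=> f; apply/preordering_sos/sos_sqr.
move=> f g [s [ss ->]] [t [ts ->]]; rewrite big_distrlr /=.
apply: preordering_sum => E; apply: preordering_sum => F.
rewrite mulrACA -[X in _ * X]/(prodS E * prodS F) prodS_mul mulrA.
by apply: preordering_term; apply: sosM; [apply: sosM|apply: sos_sqr].
Qed.

Lemma preordering_gen s : s \in S -> in_preordering S s.
Proof.
move=> sS; have lt : (index s S < size S)%N by rewrite index_mem.
have := @preordering_term 1 [set Ordinal lt].
rewrite /prodS big_set1 mul1r nth_index //; apply.
by rewrite -(expr1n _ 2); apply: sos_sqr.
Qed.

End Preordering.

Theorem theorem4 (R : realType) (k : nat) (a b : nat -> R) (q : {poly R}) :
  (0 < k)%N ->
  (forall i, (i < k)%N -> a i <= b i) ->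
  (forall i, (i.+1 < k)%N -> b i < a i.+1) ->
  (forall x, in_U k a b x -> 0 <= q.[x]) ->
  let S := natgens k a b ++ [:: vary R - q%:P] in
  forall f : {poly {poly R}},
    (forall x y, in_KS S x y -> 0 <= ev2 f x y) ->
    in_preordering S f.
Proof.
move=> k0 ab ba _ S f pos.
(* [T] is the preordering in the coordinate y - q(x): membership of ['X] in [T] is that of the
   generator y - q(x) in the original one. *)
pose shift (g : {poly {poly R}}) := g \Po ('X - q%:P).
pose T g := in_preordering S (shift g).
have [SD SM Ssq] := preordering_cone S.
have cT : is_cone T.
  split=> [g h|g h|g]; rewrite /T /shift ?rmorphD ?rmorphM ?rmorphXn //=;
  by [apply: SD|apply: SM|apply: Ssq].
have TC p : in_preordering S p%:P -> T p%:P by rewrite /T /shift comp_polyC.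
have TY : T 'X.
  by rewrite /T /shift comp_polyX; apply: preordering_gen; rewrite mem_cat mem_seq1 eqxx orbT.
have memS s : (s \in S) = [|| s == varx R - cst (a 0%N),
    s \in [seq (varx R - cst (a i.+1)) * (varx R - cst (b i)) | i <- iota 0 k.-1],
    s == cst (b k.-1) - varx R | s == vary R - q%:P].
  by rewrite /S /natgens !mem_cat !mem_seq1 -!orbA.
have Tl : T ('X - (a 0%N)%:P)%:P.
  by apply/TC/preordering_gen; rewrite memS polyCB eqxx.
have Tr : T ((b k.-1)%:P - 'X)%:P.
  by apply/TC/preordering_gen; rewrite memS polyCB eqxx !orbT.
have Tg i : (i.+1 < k)%N -> T (('X - (a i.+1)%:P) * ('X - (b i)%:P))%:P.
  move=> ik; apply/TC/preordering_gen; rewrite memS; apply/or4P; apply: Or42; apply/mapP.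
  by exists i; rewrite ?mem_iota ?polyCM ?polyCB //; lia.
have posT : forall p : {poly R}, (forall x, in_U k a b x -> 0 < p.[x]) -> T p%:P.
  refine (natural_pos k0 ab ba (C := fun p => T p%:P) _ Tl Tr Tg).
  have [TD TM Tsq] := cT; split=> [g h|g h|g].
  - by rewrite polyCD; apply: TD.
  - by rewrite polyCM; apply: TM.
  by rewrite polyC_exp; apply: Tsq.
(* Widening by 1 puts U strictly inside the interval, so that both Bernstein factors are positive on
   U, also when U is a single point. *)
have bnd x : in_U k a b x -> a 0%N - 1 < x < b k.-1 + 1.
  by move=> /(in_U_bounds k0 ab ba); lra.
have AB : a 0%N - 1 < b k.-1 + 1.
  have Ua : in_U k a b (a 0%N) by exists 0%N; rewrite // lexx ab.
  by have /andP[] := bnd _ Ua; apply: lt_trans.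
have lbT := lower_bound_cone cT TY posT AB bnd (in_U_near k0 ab ba)
  (in_U_compact ab) (in_U_local k0 ab ba cT Tl Tr Tg).
have : T (f \Po ('X + q%:P)).
  apply: (nonneg_cone cT TY bnd lbT) => x y Ux y0.
  have -> : ev2 (f \Po ('X + q%:P)) x y = ev2 f x (y + q.[x]).
    rewrite -[RHS]fibreE (_ : y + _ = horner_eval x ('X + q%:P).[y%:P]).
      by rewrite horner_map /ev2 horner_comp.
    by rewrite /horner_eval !hornerE.
  have := in_U_bounds k0 ab ba Ux => /andP[ax xb].
  apply: pos => s; rewrite memS => /or4P[/eqP->|/mapP[j]|/eqP->|/eqP->].
  - by rewrite ev2E evB evX evcst subr_ge0.
  - rewrite mem_iota => jk ->; rewrite ev2E evM !evB evX !evcst /=.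
    have jk' : (j.+1 < k)%N by lia.
    have baj := ba j jk'; case: (gap_sides ab ba jk' Ux) => h.
      by rewrite mulr_le0 ?subr_le0 // (le_trans h) // ltW.
    by rewrite mulr_ge0 ?subr_ge0 // (le_trans _ h) // ltW.
  - by rewrite ev2E evB evX evcst subr_ge0.
  by rewrite ev2E evB evY -ev2E /ev2 hornerC addrK.
by rewrite /T /shift -comp_polyA comp_polyD comp_polyX comp_polyC subrK comp_polyXr.
Qed.
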